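(* Let $k$ be a field of characteristic $0$, let $S = k[u,x,y,z]$ be the standard graded polynomial ring, and let $$I = (x^2+yz+u^2,\ xu,\ x^2+xy,\ xz+yu,\ zu+u^2,\ y^2+z^2).$$ Then $R = S/I$ is non-Koszul, Artinian and superlevel, with $\operatorname{reg}(R) = 2$ and $\operatorname{type}(R) = 4$. Consequently, its idealization $\tilde{R} = R \ltimes \omega_R(-3)$ is a non-Koszul, quadratic, Gorenstein, Artinian, graded $k$-algebra with $\operatorname{reg}(\tilde{R}) = 3$ and $\operatorname{codim}(\tilde{R}) = 8$.
   Context: Let $S=k[x_1,\dots,x_n]$ be a standard graded polynomial ring over a field $k$ and $R=S/I$ with $I$ a homogeneous ideal. For a graded module $M$, $M(d)$ is the shifted module with $M(d)_i=M_{d+i}$. - Graded Betti numbers: $\beta_{ij}^S(R)=\dim_k\operatorname{Tor}_i^S(R,k)_j$. The regularity is $\operatorname{reg}(R)=\max\{j-i \mid \beta_{ij}^S(R)\neq 0\}$. - $R$ is quadratic if $I$ is generated by homogeneous forms of degree $2$. $R$ is Artinian if $\dim_k R<\infty$. - For $R$ Artinian with $I$ containing no linear forms, $\operatorname{codim}(R)=\dim_k R_1$. For $\tilde R$, the regularity and codimension are computed by writing $\tilde R$ as a quotient of a standard graded polynomial ring by a homogeneous ideal containing no linear forms. - $R$ is Koszul if $k$ has a linear free resolution over $R$, that is, $\dim_k\operatorname{Tor}^R_i(k,k)_j=0$ for all $j>i$. - For $R$ Artinian, the canonical module is $\omega_R=\operatorname{Ext}_S^n(R,S)(-n)$. $R$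 is level if $\omega_R$ is generated in a single degree. $\operatorname{type}(R)$ is the minimal number of generators of $\omega_R$. $R$ is Gorenstein if $\operatorname{type}(R)=1$. - $R$ is superlevel if $R$ is level and $\omega_R$ is linearly presented over $R$ (i.e. if $\omega_R$ is generated in degree $d$, its minimal first syzygies over $R$ are generated in degree $d+1$). - The idealization of $R$ with respect to its canonical module is the graded ring $\tilde R=R\ltimes\omega_R(-\operatorname{reg}(R)-1)$, whose underlying graded group is $R\oplus\omega_R(-\operatorname{reg}(R)-1)$, with multiplication $(r_1,z_1)\cdot(r_2,z_2)=(r_1r_2,\ r_1z_2+r_2z_1)$. *)

(* Defs.v *)
From HB Require Import structures.
From mathcomp Require Import all_boot all_order all_algebra.
From mathcomp Require Import ring_quotient.
From mathcomp Require Import boolp.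
From mathcomp.multinomials Require Import mpoly.

Set Implicit Arguments.
Unset Strict Implicit.
Unset Printing Implicit Defensive.

Import GRing.Theory.
Local Open Scope ring_scope.
Local Open Scope quotient_scope.

(** * Gradings *)

(* [gr d] is the set of homogeneous elements of degree [d] (0 included), and
   [V] is the direct sum of these subgroups. *)
Record is_grading (V : zmodType) (gr : int -> V -> Prop) : Prop := IsGrading {
  grading0 : forall d, gr d 0;
  gradingB : forall d x y, gr d x -> gr d y -> gr d (x - y);
  grading_span : forall x, exists (s : seq int) (f : int -> V),
    (forall d, gr d (f d)) /\ x = \sum_(d <- s) f d;
  grading_direct : forall (s : seq int) (f : int -> V), uniq s ->
    (forall d, gr d (f d)) -> \sum_(d <- s) f d = 0 ->
    forall d, d \in s -> f d = 0
}.

(* The two structures below carry only the family of homogeneous pieces; that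
   it is a grading is stated by [is_graded_algebra] and [is_graded_module]. *)
Record gradedAlg (k : fieldType) := GradedAlg {
  galg :> comAlgType k;
  adeg : int -> galg -> Prop
}.

Record is_graded_algebra (k : fieldType) (A : gradedAlg k) : Prop :=
  IsGradedAlgebra {
    galg_grading : is_grading (@adeg k A);
    galg1 : @adeg k A 0 1;
    galgZ : forall d (c : k) (x : A), adeg d x -> adeg d (c *: x);
    galgM : forall d e (x y : A), adeg d x -> adeg e y -> adeg (d + e) (x * y)
  }.

Record gradedMod (k : fieldType) (A : gradedAlg k) := GradedMod {
  gmod :> lmodType A;
  mdg : int -> gmod -> Prop
}.

Record is_graded_module (k : fieldType) (A : gradedAlg k) (M : gradedMod A) :
    Prop := IsGradedModule {
  gmod_grading : is_grading (@mdg k A M);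
  gmodZ : forall d e (a : A) (m : M), adeg d a -> mdg e m -> mdg (d + e) (a *: m)
}.

Definition shift_deg (V : Type) (gr : int -> V -> Prop) (d : int) :
  int -> V -> Prop := fun i => gr (d + i).

Definition mshift (k : fieldType) (A : gradedAlg k) (M : gradedMod A) (d : int) :
  gradedMod A := GradedMod (shift_deg (@mdg k A M) d).

Definition poly_deg (k : fieldType) (n : nat) (d : int) (p : {mpoly k[n]}) :
  Prop := match d with Posz m => p \is m.-homog | Negz _ => p = 0 end.

Definition polyAlg (k : fieldType) (n : nat) : gradedAlg k :=
  @GradedAlg k {mpoly k[n]} (@poly_deg k n).

(* The field [k], concentrated in degree 0. *)
Definition field_deg (k : fieldType) (d : int) (c : k) : Prop := d = 0 \/ c = 0.

(** * Dimension and generators *)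

Definition finite_dim (k : fieldType) (V : lmodType k) : Prop :=
  exists (m : nat) (b : 'I_m -> V),
    forall v, exists c : 'I_m -> k, v = \sum_i c i *: b i.

Definition has_dim (k : fieldType) (V : lmodType k) (W : V -> Prop) (m : nat) :
    Prop :=
  exists b : 'I_m -> V,
    [/\ forall i, W (b i),
        forall v, W v -> exists c : 'I_m -> k, v = \sum_i c i *: b i
      & forall c : 'I_m -> k, \sum_i c i *: b i = 0 -> forall i, c i = 0].

Definition generates (A : nzRingType) (M : lmodType A) (m : nat)
    (e : 'I_m -> M) : Prop :=
  forall w, exists c : 'I_m -> A, w = \sum_i c i *: e i.

Definition min_number_generators (A : nzRingType) (M : lmodType A) (m : nat) :
    Prop :=
  (exists e : 'I_m -> M, generates e) /\
  (forall m' (e : 'I_m' -> M), generates e -> (m <= m')%N).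

Definition generated_in_degree (k : fieldType) (A : gradedAlg k)
    (M : gradedMod A) (d : int) : Prop :=
  exists (m : nat) (e : 'I_m -> M), (forall i, mdg d (e i)) /\ generates e.

(* For [M] generated in degree [d]: a syzygy of minimal generators of degree [d]
   is homogeneous of degree [d + 1] when its entries have degree 1. *)
Definition linearly_presented (k : fieldType) (A : gradedAlg k)
    (M : gradedMod A) (d : int) : Prop :=
  exists (m : nat) (e : 'I_m -> M),
    [/\ forall i, mdg d (e i), generates e, min_number_generators M m
      & forall c : 'I_m -> A, \sum_i c i *: e i = 0 ->
        exists (q : nat) (syz : 'I_q -> 'I_m -> A) (b : 'I_q -> A),
          [/\ forall l i, adeg 1 (syz l i),
              forall l, \sum_i syz l i *: e i = 0
            & forall i, c i = \sum_l b l * syz l i]].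

(** * Graded free resolutions *)

(* [F_i] is the free module of row vectors of length [frank i], whose basis
   vector number [a] has degree [fshift i a]; the differential
   [F_(i+1) -> F_i] is right multiplication by [fdiff i]. *)
Record free_complex (A : Type) := FreeComplex {
  frank : nat -> nat;
  fshift : forall i, 'I_(frank i) -> int;
  fdiff : forall i, 'M[A]_(frank i.+1, frank i)
}.

Section Resolutions.
Variables (k : fieldType) (A : gradedAlg k).

(* [e] gives the images in [M] of the basis vectors of [F_0]; the [B]-module [M]
   is regarded as an [A]-module through [phi]. *)
Definition augmentation_map (B : nzRingType) (M : lmodType B) (phi : A -> B)
    (n : nat) (e : 'I_n -> M) (v : 'rV[A]_n) : M :=
  \sum_i phi (v 0 i) *: e i.

Record is_free_resolution (B : nzRingType) (M : lmodType B)
    (grM : int -> M -> Prop) (phi : A -> B) (F : free_complex A)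
    (e : 'I_(frank F 0) -> M) : Prop := IsFreeResolution {
  res_aug_deg : forall a, grM (fshift a) (e a);
  res_diff_deg : forall i (a : 'I_(frank F i.+1)) (b : 'I_(frank F i)),
    adeg (fshift a - fshift b) (fdiff F i a b);
  res_surj : forall x, exists v, x = augmentation_map phi e v;
  res_exact0 : forall v : 'rV[A]_(frank F 0),
    augmentation_map phi e v = 0 <-> exists w, v = w *m fdiff F 0;
  res_exact : forall i (v : 'rV[A]_(frank F i.+1)),
    v *m fdiff F i = 0 <-> exists w, v = w *m fdiff F i.+1
}.

Section Tor.
Variables (eps : A -> k) (F : free_complex A).

Definition res_diff (i : nat) : 'M[k]_(frank F i.+1, frank F i) :=
  map_mx eps (fdiff F i).

Definition degree_part (i : nat) (j : int) : 'M[k]_(frank F i) :=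
  \matrix_(a, b) ((a == b) && (fshift a == j))%:R.

Definition tor_cycles (i : nat) (j : int) : 'M[k]_(frank F i) :=
  match i with
  | 0 => degree_part 0 j
  | m.+1 => (kermx (res_diff m) :&: degree_part m.+1 j)%MS
  end.

Definition tor_boundaries (i : nat) (j : int) :
  'M[k]_(frank F i.+1, frank F i) := degree_part i.+1 j *m res_diff i.

(* dim_k of H_i (F (x)_A k)_j, where A acts on k through [eps]. *)
Definition tor_dim (i : nat) (j : int) : nat :=
  (\rank (tor_cycles i j) - \rank (tor_boundaries i j))%N.

End Tor.

(* The dual complex Hom_A(F, A): column vectors of length [frank F i], a column
   [c] standing for the functional [v |-> v *m c]. *)
Definition ext_cocycle (F : free_complex A) (i : nat) (c : 'cV[A]_(frank F i)) :
  Prop := fdiff F i *m c = 0.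

Definition ext_coboundary (F : free_complex A) (i : nat) :
    'cV[A]_(frank F i) -> Prop :=
  match i with
  | 0 => fun c => c = 0
  | m.+1 => fun c => exists c', c = fdiff F m *m c'
  end.

(* [c] raises degrees by [j]. *)
Definition dual_deg (F : free_complex A) (i : nat) (j : int)
    (c : 'cV[A]_(frank F i)) : Prop :=
  forall a, adeg (fshift a + j) (c a 0).

(* The graded ring retraction [A -> k] with kernel the elements of positive
   degree, through which [A] acts on [k]. *)
Definition is_residue_map (eps : {lrmorphism A -> k^o}) : Prop :=
  forall d (a : A), adeg d a -> d <> 0 -> eps a = 0.

(* [k] has a linear free resolution.  Finite ranks are no restriction when [A]
   is Noetherian. *)
Definition koszul : Prop :=
  exists (eps : {lrmorphism A -> k^o}) (F : free_complex A)
         (e : 'I_(frank F 0) -> k^o),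
    [/\ is_residue_map eps,
        is_free_resolution (M := k^o) (@field_deg k) eps e
      & forall i (a : 'I_(frank F i)), fshift a = i%:Z].

End Resolutions.

(** * Invariants of a quotient of a standard graded polynomial ring *)

Section Presentation.
Variables (k : fieldType) (A : gradedAlg k) (n : nat).
Variable pi : {lrmorphism {mpoly k[n]} -> A}.

Definition is_presentation : Prop :=
  (forall a, exists p, pi p = a) /\
  (forall d p, poly_deg d p -> adeg d (pi p)).

Definition no_linear_forms : Prop :=
  forall p : {mpoly k[n]}, p \is 1.-homog -> pi p = 0 -> p = 0.

Definition has_codim (m : nat) : Prop :=
  no_linear_forms /\ has_dim (V := A) (@adeg k A 1) m.

Definition quadratic : Prop :=
  forall p : {mpoly k[n]}, pi p = 0 ->
    exists (m : nat) (q c : 'I_m -> {mpoly k[n]}),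
      (forall i, q i \is 2.-homog /\ pi (q i) = 0) /\ p = \sum_i c i * q i.

(* [F] is a graded free resolution of [A] over the polynomial ring. *)
Definition resolves (F : free_complex {mpoly k[n]})
    (e : 'I_(frank F 0) -> A^o) : Prop :=
  is_free_resolution (A := polyAlg k n) (M := A^o) (@adeg k A) pi e.

(* Tor does not depend on the resolution used to compute it. *)
Definition betti (F : free_complex {mpoly k[n]}) (i : nat) (j : int) : nat :=
  tor_dim (A := polyAlg k n) (mcoeff 0%MM) F i j.

Definition has_regularity (r : int) : Prop :=
  exists (F : free_complex {mpoly k[n]}) (e : 'I_(frank F 0) -> A^o),
    [/\ resolves e,
        exists i j, betti F i j <> 0%N /\ j - i%:Z = r
      & forall i j, betti F i j <> 0%N -> j - i%:Z <= r].

(* [W] is Ext^n_S(A, S)(-n), up to isomorphism: [tau] sends a cocycle to its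
   cohomology class, and S acts on [W] through [pi]. *)
Definition is_canonical_module (W : gradedMod A) : Prop :=
  is_graded_module W /\
  exists (F : free_complex {mpoly k[n]}) (e : 'I_(frank F 0) -> A^o)
         (tau : 'cV[{mpoly k[n]}]_(frank F n) -> W),
    let Z := @ext_cocycle k (polyAlg k n) F n in
    let B := @ext_coboundary k (polyAlg k n) F n in
    [/\ resolves e,
        forall s c c', Z c -> Z c' -> tau (s *: c + c') = pi s *: tau c + tau c',
        forall w, exists2 c, Z c & tau c = w,
        forall c, Z c -> (tau c = 0 <-> B c)
      & forall j c, Z c -> @dual_deg k (polyAlg k n) F n (j - n%:Z) c ->
          mdg j (tau c)].

(* Canonical modules are unique up to graded isomorphism, so the choice of [W]
   is immaterial here and below. *)
Definition has_type (m : nat) : Prop :=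
  exists2 W : gradedMod A, is_canonical_module W & min_number_generators W m.

Definition gorenstein : Prop := has_type 1.

Definition superlevel : Prop :=
  exists2 W : gradedMod A, is_canonical_module W &
    exists d, generated_in_degree W d /\ linearly_presented W d.

End Presentation.

Definition artinian (k : fieldType) (A : gradedAlg k) : Prop := finite_dim A.

(** * Idealization *)

Definition idealization (k : fieldType) (A : comAlgType k) (M : lmodType A) :
  Type := (A * M)%type.

Section IdealizationStructure.
Variables (k : fieldType) (A : comAlgType k) (M : lmodType A).
Local Notation T := (idealization M).

HB.instance Definition _ := GRing.Zmodule.copy T (A * M)%type.

Definition ideal_one : T := (1, 0).
Definition ideal_mul (a b : T) : T := (a.1 * b.1, a.1 *: b.2 + b.1 *: a.2).
Definition ideal_scale (c : k) (a : T) : T := (c *: a.1, c%:A *: a.2).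

Lemma ideal_mulA : associative ideal_mul.
Proof.
move=> [a x] [b y] [c z]; rewrite /ideal_mul /=; congr (_, _); first exact: mulrA.
by rewrite !scalerDr !scalerA -addrA (mulrC c a) (mulrC c b).
Qed.

Lemma ideal_mulC : commutative ideal_mul.
Proof.
by move=> [a x] [b y]; rewrite /ideal_mul /= mulrC addrC.
Qed.

Lemma ideal_mul1 : left_id ideal_one ideal_mul.
Proof.
by move=> [a x]; rewrite /ideal_mul /= mul1r scale1r scaler0 addr0.
Qed.

Lemma ideal_mulDl : left_distributive ideal_mul +%R.
Proof.
move=> [a x] [b y] [c z]; rewrite /ideal_mul /=; congr (_, _); first exact: mulrDl.
by rewrite scalerDl scalerDr addrACA.
Qed.

Lemma ideal_one_neq0 : ideal_one != 0.
Proof.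
by apply/eqP => /(congr1 fst) /= /eqP; rewrite oner_eq0.
Qed.

HB.instance Definition _ := GRing.Zmodule_isComNzRing.Build T
  ideal_mulA ideal_mulC ideal_mul1 ideal_mulDl ideal_one_neq0.

Lemma ideal_scaleA (c d : k) (a : T) :
  ideal_scale c (ideal_scale d a) = ideal_scale (c * d) a.
Proof.
case: a => a x; rewrite /ideal_scale /=; congr (_, _); first exact: scalerA.
by rewrite scalerA -scalerAl mul1r scalerA.
Qed.

Lemma ideal_scale1 : left_id 1 ideal_scale.
Proof. by move=> [a x]; rewrite /ideal_scale /= !scale1r. Qed.

Lemma ideal_scaleDr : right_distributive ideal_scale +%R.
Proof.
by move=> c [a x] [b y]; rewrite /ideal_scale /=; congr (_, _); rewrite /= scalerDr.
Qed.

Lemma ideal_scaleDl (a : T) : {morph ideal_scale^~ a : c d / c + d}.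
Proof.
by move=> c d; case: a => a x; rewrite /ideal_scale /=; congr (_, _);
   rewrite /= !scalerDl.
Qed.

HB.instance Definition _ := GRing.Zmodule_isLmodule.Build k T
  ideal_scaleA ideal_scale1 ideal_scaleDr ideal_scaleDl.

Lemma ideal_scaleAl (c : k) (a b : T) : c *: (a * b) = (c *: a) * b.
Proof.
case: a b => a x [b y]; congr (_, _); rewrite /=; first exact: scalerAl.
rewrite scalerDr !scalerA; congr (_ *: _ + _ *: _).
  by rewrite -scalerAl mul1r.
by rewrite mulrC.
Qed.

HB.instance Definition _ := GRing.Lmodule_isLalgebra.Build k T ideal_scaleAl.
HB.instance Definition _ := GRing.Lalgebra_isComAlgebra.Build k T.

End IdealizationStructure.

Definition idealization_alg (k : fieldType) (A : gradedAlg k)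
    (M : gradedMod A) : gradedAlg k :=
  @GradedAlg k (idealization M) (fun d a => adeg d a.1 /\ mdg d a.2).

(** * The algebra S/I *)

Section TheAlgebra.
Variable k : fieldType.
Local Notation S := {mpoly k[4]}.

Definition var_u : S := 'X_(inord 0).
Definition var_x : S := 'X_(inord 1).
Definition var_y : S := 'X_(inord 2).
Definition var_z : S := 'X_(inord 3).

Definition gensI : seq S :=
  [:: var_x ^+ 2 + var_y * var_z + var_u ^+ 2;
      var_x * var_u;
      var_x ^+ 2 + var_x * var_y;
      var_x * var_z + var_y * var_u;
      var_z * var_u + var_u ^+ 2;
      var_y ^+ 2 + var_z ^+ 2].

Definition idealI : {pred S} :=
  fun p => `[< exists c : 'I_6 -> S, p = \sum_i c i * gensI`_i >].

Lemma idealI_closed : idealr_closed idealI.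
Proof.
split.
- apply/asboolP; exists (fun=> 0).
  by rewrite big1 // => i _; rewrite mul0r.
- apply/asboolP => -[c] /(congr1 (mcoeff 0%MM)) /eqP.
  rewrite raddf_sum /= mcoeff1 eqxx big1 ?oner_eq0 // => i _.
  rewrite rmorphM /= (_ : mcoeff _ gensI`_i = 0) ?mulr0 //.
  have v0 j : mcoeff 0%MM ('X_j : S) = 0.
    by rewrite mcoeffX; case: eqP => // /(congr1 (@mdeg 4)); rewrite mdeg1 mdeg0.
  case: i => -[|[|[|[|[|[|//]]]]]] /= _;
    by rewrite ?raddfD /= ?rmorphXn ?rmorphM /= ?v0 ?expr0n ?mulr0 ?addr0.
- move=> a p q /asboolP [c ->] /asboolP [d ->].
  apply/asboolP; exists (fun i => a * c i + d i).
  rewrite mulr_sumr -big_split /=; apply: eq_bigr => i _.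
  by rewrite mulrDl mulrA.
Qed.

HB.instance Definition _ := isIdealr.Build S idealI idealI_closed.

Definition quoR : Type := {ideal_quot idealI}.
HB.instance Definition _ := GRing.ComNzRing.on quoR.

Definition quo_pi (p : S) : quoR := \pi_({ideal_quot idealI}) p.

Lemma quo_pi_zmod : zmod_morphism quo_pi.
Proof. by move=> p q; rewrite /quo_pi raddfB. Qed.
HB.instance Definition _ := GRing.isZmodMorphism.Build S quoR quo_pi quo_pi_zmod.

Lemma quo_pi_monoid : monoid_morphism quo_pi.
Proof. by split=> [|p q]; rewrite /quo_pi ?rmorph1 ?rmorphM. Qed.
HB.instance Definition _ :=
  GRing.isMonoidMorphism.Build S quoR quo_pi quo_pi_monoid.

Lemma quo_pi_eq0 (p : S) : quo_pi p = 0 <-> p \in idealI.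
Proof.
rewrite -[p]subr0 Quotient.idealrBE /quo_pi subr0 raddf0.
by split=> [->|/eqP] //; rewrite raddf0.
Qed.

Definition quo_scale (c : k) (x : quoR) : quoR := quo_pi c%:MP * x.

Lemma quo_scaleA (c d : k) (x : quoR) :
  quo_scale c (quo_scale d x) = quo_scale (c * d) x.
Proof. by rewrite /quo_scale mulrA -rmorphM -mpolyCM. Qed.

Lemma quo_scale1 : left_id 1 quo_scale.
Proof. by move=> x; rewrite /quo_scale mpolyC1 rmorph1 mul1r. Qed.

Lemma quo_scaleDr : right_distributive quo_scale +%R.
Proof. by move=> c x y; rewrite /quo_scale mulrDr. Qed.

Lemma quo_scaleDl (x : quoR) : {morph quo_scale^~ x : c d / c + d}.
Proof. by move=> c d; rewrite /quo_scale mpolyCD rmorphD mulrDl. Qed.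

HB.instance Definition _ := GRing.Zmodule_isLmodule.Build k quoR
  quo_scaleA quo_scale1 quo_scaleDr quo_scaleDl.

Lemma quo_scaleAl (c : k) (x y : quoR) : c *: (x * y) = (c *: x) * y.
Proof. exact: mulrA. Qed.

HB.instance Definition _ := GRing.Lmodule_isLalgebra.Build k quoR quo_scaleAl.
HB.instance Definition _ := GRing.Lalgebra_isComAlgebra.Build k quoR.

Lemma quo_pi_scalable : scalable quo_pi.
Proof. by move=> c p; rewrite -mul_mpolyC rmorphM. Qed.
HB.instance Definition _ := GRing.isScalable.Build k S quoR *:%R quo_pi
  quo_pi_scalable.

Definition algR : gradedAlg k :=
  @GradedAlg k quoR
    (fun d a => exists2 p : S, poly_deg d p & a = quo_pi p).

Definition piR : {lrmorphism S -> algR} := quo_pi.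

End TheAlgebra.

(* Main.v *)
(** Let [A] be a finite-dimensional graded algebra that is a quotient of
    [S = k[x_1, .., x_n]]; in a homogeneous basis of [A], multiplication by the
    image of [x_j] is a matrix [X_j].  The Koszul complex of the commuting operators
    [x_j - X_j] on [S (x)_k A] is a finite free resolution of [A] over [S] with an
    explicit contraction.  It shows that the regularity is the top degree of [A]
    and, after transposition, that [Ext^n_S (A, S)(-n)] is the [k]-dual of [A]; the
    comparison theorem then identifies every canonical module with this dual.

    For [R = S/I], with basis [1, u, x, y, z, xy, xz, yz, z^2], type 4 and the linear
    presentation of the dual are linear algebra over [k], as is a functional that
    obstructs the exactness of the linear strand of a linear resolution of [k].
    The obstruction passes to algebras that retract onto [R], such as the
    idealization.  The dual of the idealization is generated by the single
    functional [(r, f) |-> f 1], so the idealization is Gorenstein; its relations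
    are those of [R], the linear syzygies of the dual and the products of two dual
    elements, which are all quadratic. *)

Require Import Defs.
From HB Require Import structures.
From mathcomp Require Import all_boot all_order all_algebra.
From mathcomp Require Import ring_quotient boolp ring.
From mathcomp.multinomials Require Import mpoly.

Set Implicit Arguments.
Unset Strict Implicit.
Unset Printing Implicit Defensive.

Import GRing.Theory.
Local Open Scope ring_scope.

(** * Koszul complexes of commuting operators *)

(** The definitions admit every graded free resolution and every canonical module, and no minimal
    resolution is computed. The complex on [x_j - X_j] is far from minimal, since the entries of
    [X_j] are constants, but it has one shape for [R] (4 variables, dimension 9) and for its
    idealization (8 variables, dimension 18). Its shifts bound the regularity; its last term attains
    the bound and carries [Ext^n]. The contraction exists because the [X_j] are nilpotent: division
    by the monic [x_j - X_j] is a finite geometric series. The same division replaces a Groebner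
    basis. The generators of [I] yield the multiplication table and kill degree 3, so nine monomials
    span [R]; they are independent because the table defines commuting nilpotent matrices on [k^9],
    at which polynomials can be evaluated. Linearity of a resolution of [k] is refuted in
    homological degrees 0 to 3, from the linear entries of the differentials alone. Characteristic 0
    enters through the invertibility of 2: the obstruction takes the value 2, and the quadratic
    syzygies of the dual are combinations of linear ones after division by 2. *)

Definition signed (V : zmodType) (b : bool) (x : V) : V := if b then - x else x.

Fact signed_is_additive (V : zmodType) b : zmod_morphism (@signed V b).
Proof. by case: b => x y //=; rewrite opprD. Qed.
HB.instance Definition _ (V : zmodType) b :=
  GRing.isZmodMorphism.Build V V (@signed V b) (@signed_is_additive V b).

Lemma signedN (V : zmodType) b (x : V) : signed (~~ b) x = - signed b x.
Proof. by case: b; rewrite /= ?opprK. Qed.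

Lemma raddf_signed (V W : zmodType) (f : {additive V -> W}) b x :
  f (signed b x) = signed b (f x).
Proof. by case: b => //=; rewrite raddfN. Qed.

Lemma signed_addb (V : zmodType) b c (x : V) :
  signed b (signed c x) = signed (b (+) c) x.
Proof. by case: b; case: c; rewrite /= ?opprK. Qed.

Lemma signed0 (V : zmodType) b : signed b (0 : V) = 0.
Proof. exact: raddf0. Qed.

Section KoszulSign.
Variable n : nat.
Implicit Types (A B : {set 'I_n}) (i j : 'I_n).

(** The parity of the position of [j] in [j |: B] listed increasingly, hence the sign with which
    removing [j] enters the Koszul differential. *)
Definition ksign j B : bool := odd #|[set i in B | (i < j)%N]|.

Lemma ksignU j l B : l \notin B -> ksign j (l |: B) = (l < j)%N (+) ksign j B.
Proof.
move=> lB; rewrite /ksign; case: (boolP (l < j)%N) => lj.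
  rewrite (_ : [set i in l |: B | (i < j)%N] = l |: [set i in B | (i < j)%N]).
    by rewrite cardsU1 !inE (negPf lB) oddD.
  by apply/setP => i; rewrite !inE; case: eqP => // ->; rewrite lj.
rewrite addFb; congr odd; apply: eq_card => i; rewrite !inE.
by case: eqP => // ->; rewrite (negPf lj) !andbF.
Qed.

(** Exactly one of [j < l] and [l < j] holds, so passing from one order of insertion to the other
    changes a single parity. This sign makes the differential square to zero. *)
Lemma ksign_swap j l B : j != l -> j \notin B -> l \notin B ->
  ksign j B (+) ksign l (j |: B) = ~~ (ksign l B (+) ksign j (l |: B)).
Proof.
move=> jl jB lB; rewrite !ksignU //; rewrite -val_eqE /= in jl.
by case: ltngtP jl => //; case: ksign; case: ksign.
Qed.

Lemma ksign_small j B : (forall i, i \in B -> (j <= i)%N) -> ksign j B = false.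
Proof.
move=> le; rewrite /ksign (_ : [set i in B | _] = set0) ?cards0 //.
apply/setP => i; rewrite !inE; apply/negP => /andP [/le].
by rewrite leqNgt => /negP.
Qed.

End KoszulSign.

(* The Koszul complex of commuting operators [a j] on [N]; a chain is a family
   of elements of [N] indexed by the subsets of the variables. *)
Section AbstractKoszul.
Variables (n : nat) (N : zmodType) (a q : 'I_n -> {additive N -> N}).
Hypothesis aC : forall i j x, a i (a j x) = a j (a i x).
Hypothesis qa1 : forall j x, q j (a j x) = x.
Hypothesis qaC : forall i j x, i != j -> q i (a j x) = a j (q i x).
Implicit Types (A B : {set 'I_n}) (f : {set 'I_n} -> N).

Definition kdiff f B : N :=
  \sum_(j | j \notin B) signed (ksign j B) (a j (f (j |: B))).

Lemma kdiffK f B : kdiff (kdiff f) B = 0.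
Proof.
pose T j l := signed (ksign j B (+) ksign l (j |: B)) (a j (a l (f (l |: (j |: B))))).
have TN j l : j != l -> j \notin B -> l \notin B -> T l j = - T j l.
  move=> jl jB lB; rewrite /T ksign_swap ?(eq_sym l j) // signedN aC.
  by rewrite setUCA.
pose F j l := if [&& j \notin B, l \notin B & j != l] then T j l else 0.
have -> : kdiff (kdiff f) B = \sum_j \sum_l F j l.
  rewrite /kdiff big_mkcond; apply: eq_bigr => j _; rewrite /F; case: ifP => jB /=; last first.
    by rewrite big1.
  rewrite raddf_sum raddf_sum /= big_mkcond; apply: eq_bigr => l _ /=.
  rewrite !inE negb_or eq_sym andbC; case: ifP => // _.
  by rewrite raddf_signed signed_addb /T.
(* The diagonal is zero by definition of [F]; once reindexed, the lower triangle is the opposite of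
   the upper one by [TN]. *)
have -> : \sum_j \sum_l F j l =
    \sum_(j < n) \sum_(l < n | (j < l)%N) F j l +
    \sum_(j < n) \sum_(l < n | (l < j)%N) F j l.
  rewrite -big_split; apply: eq_bigr => j _ /=.
  rewrite (bigID (fun l : 'I_n => (j < l)%N)) /=; congr (_ + _).
  rewrite (bigD1 j) ?ltnn //= /F eqxx !andbF add0r; apply: eq_bigl => l.
  by rewrite -leqNgt ltn_neqAle andbC.
rewrite [X in _ + X](exchange_big_dep xpredT) //= -big_split big1 // => j _ /=.
rewrite -big_split big1 // => l jl /=; rewrite /F eq_sym andbCA.
case: ifP => [/and3P [lB jB lj]|]; last by rewrite addr0.
by rewrite (TN j l) ?subrr // eq_sym.
Qed.

(** The remainder of the division by [a j], with [q j] as quotient. *)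
Definition kproj1 (j : 'I_n) (x : N) : N := x - a j (q j x).

Fact kproj1_additive j : zmod_morphism (kproj1 j).
Proof.
by move=> x y; rewrite /kproj1 2!raddfB 2!opprD !opprK addrACA.
Qed.
HB.instance Definition _ j := GRing.isZmodMorphism.Build N N (kproj1 j)
  (kproj1_additive j).

(** Successive remainders modulo the first [m] operators. Outside the range of indices [insub] fails
    and the step is the identity, so that [m] may be any natural number. *)
Fixpoint kproj (m : nat) (x : N) : N :=
  if m is m'.+1 then
    (if insub m' is Some j then kproj1 j (kproj m' x) else kproj m' x)
  else x.

Fact kproj_additive m : zmod_morphism (kproj m).
Proof.
elim: m => [|m IH] x y //=; case: insub => [j|]; rewrite IH //.
by rewrite raddfB.
Qed.
HB.instance Definition _ m := GRing.isZmodMorphism.Build N N (kproj m)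
  (kproj_additive m).

Lemma kprojS (j : 'I_n) x : kproj j.+1 x = kproj1 j (kproj j x).
Proof. by rewrite /= valK. Qed.

Lemma kproj1_aC i j x : i != j -> kproj1 i (a j x) = a j (kproj1 i x).
Proof. by move=> ij; rewrite /kproj1 qaC // aC raddfB. Qed.

Lemma kproj1_a j x : kproj1 j (a j x) = 0.
Proof. by rewrite /kproj1 qa1 subrr. Qed.

Lemma kproj_aC m (j : 'I_n) x : (m <= j)%N -> kproj m (a j x) = a j (kproj m x).
Proof.
elim: m => //= m IH mj; case: insubP => [i _ im|_]; rewrite IH 1?ltnW //.
by rewrite kproj1_aC // -val_eqE /= im neq_ltn mj.
Qed.

Lemma kproj_a m (j : 'I_n) x : (j < m)%N -> kproj m (a j x) = 0.
Proof.
elim: m => //= m IH; rewrite ltnS leq_eqVlt => /orP [/eqP <-|jm].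
  by rewrite valK kproj_aC // kproj1_a.
  by rewrite IH //; case: insub => // i; rewrite raddf0.
Qed.

Lemma kproj_telescope m x : (m <= n)%N ->
  x - kproj m x = \sum_(j < n | (j < m)%N) a j (q j (kproj j x)).
Proof.
elim: m => [|m IH] mn; first by rewrite subrr big_pred0_eq.
rewrite (bigD1 (Ordinal mn)) // -[m.+1]/((Ordinal mn).+1) kprojS addrC.
rewrite (eq_bigl (fun j : 'I_n => (j < m)%N)) => [|j]; last first.
  by rewrite ltnS -val_eqE /= [RHS]ltn_neqAle andbC.
by rewrite -IH 1?ltnW // /kproj1 opprB -addrA [- _ + x]addrC.
Qed.

(* The tensor product of the one-variable contractions (q j, projection) sees
   only the least element of [B]. *)
Definition khtpy f B : N :=
  if [pick m in B | [forall i in B, m <= i]%N] is Some m then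
    q m (kproj m (f (B :\ m))) else 0.

Lemma khtpyE f B (m : 'I_n) : m \in B -> (forall i, i \in B -> (m <= i)%N) ->
  khtpy f B = q m (kproj m (f (B :\ m))).
Proof.
move=> mB mm; rewrite /khtpy; case: pickP => [m' /andP [m'B /forall_inP le]|].
  suff -> : m' = m by [].
  by apply/val_inj/anti_leq; rewrite le // mm.
by move/(_ m); rewrite mB /=; case: forall_inP => // -[].
Qed.

(** Let [m] be the least element of [B]. In the first term the indices [j < m] telescope to
    [f B - kproj m (f B)]. In the second term the index [m] gives back [kproj m (f B)], because
    [q m] undoes [a m]. Everything else vanishes or cancels. At [B = set0] there is no least
    element, and the full projection survives as the homology. *)
Lemma kdiff_htpy f B : B != set0 ->
  kdiff (khtpy f) B + khtpy (kdiff f) B = f B.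
Proof.
case/set0Pn => i0 i0B.
case: (arg_minnP (fun i : 'I_n => i : nat) i0B) => m mB mm.
have {}mB : m \in B by [].
rewrite (khtpyE _ mB mm) /kdiff.
rewrite (bigID (fun j : 'I_n => (j < m)%N)) /=.
rewrite (eq_bigr (fun j => a j (q j (kproj j (f B))))) => [|j /andP [jB jm]]; last first.
  have jmin i : i \in j |: B -> (j <= i)%N.
    by rewrite !inE => /orP [/eqP -> //|/mm]; apply: leq_trans (ltnW jm).
  rewrite ksign_small => [|i iB]; last by apply: jmin; rewrite inE iB orbT.
  by rewrite /= (@khtpyE _ _ j) ?setU11 // setU1K.
rewrite (eq_bigl (fun j : 'I_n => (j < m)%N)) => [|j]; last first.
  by apply: andb_idl; rewrite ltnNge => /negP nmj; apply/negP => /mm.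
rewrite -kproj_telescope 1?ltnW //.
rewrite [\sum_(j | j \notin B :\ m) _](bigD1 m) ?setD11 //.
rewrite ksign_small => [|i]; last by rewrite !inE => /andP [_ /mm].
rewrite /= setD1K // raddfD /= kproj_aC // raddfD qa1 addrACA subrK.
rewrite -[RHS]addr0; congr (_ + _); rewrite !raddf_sum.
(* Indices below [m] are killed by [kproj m]. Those above [m] cancel in pairs, since restoring
   [m < j] to [B :\ m] flips the sign of [j]. *)
rewrite [X in _ + X](bigID (fun j : 'I_n => (j < m)%N)) /=.
rewrite [X in _ + (X + _)]big1 => [|j /andP [_ jm]]; last first.
  by rewrite !raddf_signed /= kproj_a // !raddf0.
rewrite add0r [X in _ + X](eq_bigl (fun j => (j \notin B) && ~~ (j < m)%N)) => [|j]; last first.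
  rewrite !inE negb_and negbK; case: eqP => [->|] /=; last by rewrite andbT.
  by rewrite mB.
apply/eqP; rewrite addr_eq0 -sumrN; apply/eqP/eq_bigr => j /andP [jB].
rewrite -leqNgt leq_eqVlt.
case: eqP => [/val_inj mj|_ /= mj]; first by rewrite -mj mB in jB.
have mnj : m != j by rewrite -val_eqE /= neq_ltn mj.
rewrite (@khtpyE _ _ m) ?inE ?mB ?orbT // => [|i]; last first.
  by rewrite !inE => /orP [/eqP ->|/mm //]; apply: ltnW.
rewrite !raddf_signed /= kproj_aC 1?ltnW // qaC //.
have -> : (j |: B) :\ m = j |: B :\ m.
  by apply/setP => i; rewrite !inE; case: eqP => // ->; rewrite (negPf mnj).
have : ksign j B = ~~ ksign j (B :\ m).
  by rewrite -{1}(setD1K mB) ksignU ?setD11 // mj.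
by move=> ->; rewrite signedN [RHS]raddfN.
Qed.

End AbstractKoszul.

(** * The Koszul resolution over a polynomial ring *)

Section DivideByVariable.
Variables (n : nat) (R : comNzRingType).
Implicit Types (p : {mpoly R[n]}) (i j : 'I_n).

Definition divX j p : {mpoly R[n]} :=
  \sum_(m <- msupp p) p@_m *: (if (0 < m j)%N then 'X_[m - U_(j)] else 0).

Lemma mcoeff_divX j p m : (divX j p)@_m = p@_(m + U_(j)).
Proof.
have eqm (l : 'X_{1..n}) :
    (if (0 < l j)%N then 'X_[l - U_(j)] else 0 : {mpoly R[n]})@_m =
    (l == m + U_(j))%MM%:R.
  case: ifP => lj.
    rewrite mcoeffX; congr (_%:R : R); congr nat_of_bool.
    apply/eqP/eqP => [<-|->]; last by rewrite addmK.
    by rewrite submK // lep1mP -lt0n.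
  rewrite mcoeff0; case: eqP => // lE; move: lj.
  by rewrite lE mnmDE mnm1E eqxx addn1.
rewrite /divX raddf_sum /= [p in RHS]mpolyE raddf_sum /=; apply: eq_bigr => l _.
by rewrite !mcoeffZ eqm mcoeffX.
Qed.

Fact divX_linear j : linear (divX j).
Proof. by move=> c p q; apply/mpolyP => m; rewrite !(mcoeff_divX, mcoeffD, mcoeffZ). Qed.
HB.instance Definition _ j := GRing.isLinear.Build R {mpoly R[n]} {mpoly R[n]} _
  (divX j) (divX_linear j).

Lemma divX_mulX j p : divX j ('X_j * p) = p.
Proof. by apply/mpolyP => m; rewrite mcoeff_divX mulrC addmC mcoeffMX. Qed.

Lemma divX_mulXC i j p : i != j -> divX i ('X_j * p) = 'X_j * divX i p.
Proof.
move=> ij; apply/mpolyP => m; rewrite mcoeff_divX.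
have [mj|] := boolP (0 < m j)%N.
  have <- : (m - U_(j) + U_(j))%MM = m by rewrite submK // lep1mP -lt0n.
  move: (m - U_(j))%MM => l; rewrite !(mulrC 'X_j) -addmA [(U_(j) + _)%MM]addmC addmA.
  by rewrite ![(_ + U_(j))%MM]addmC !mcoeffMX mcoeff_divX.
rewrite -eqn0Ngt => /eqP mj.
have no0 (q : {mpoly R[n]}) (l : 'X_{1..n}) : l j = 0%N -> ('X_j * q)@_l = 0.
  move=> lj; rewrite mulrC mcoeffM big1 // => -[a b] /= /eqP lE.
  rewrite mcoeffX; case: eqP => [bE|]; last by rewrite mulr0.
  have := congr1 (fun k : 'X_{1..n} => k j) lE; rewrite mnmDE -bE mnm1E eqxx lj.
  by rewrite addnC.
by rewrite !no0 // mnmDE mnm1E (negPf ij) mj.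
Qed.

Lemma divXC i j p : divX i (divX j p) = divX j (divX i p).
Proof. by apply/mpolyP => m; rewrite !mcoeff_divX -!addmA [(U_(i) + _)%MM]addmC. Qed.

Lemma divX_eq0 p : (forall j, divX j p = 0) -> p = (p@_0)%:MP.
Proof.
move=> p0; apply/mpolyP => m; rewrite mcoeffC eq_sym.
have [->|/eqP mN0] := eqVneq m 0%MM; first by rewrite mulr1.
have [i mi] : exists i, m i != 0%N.
  apply/existsP; rewrite -[X in is_true X]negbK negb_exists; apply/negP => /forallP m0.
  by apply: mN0; apply/mnmP => i; rewrite mnm0E; apply/eqP; move: (m0 i); rewrite negbK.
by rewrite -(@submK _ U_(i)%MM m) ?lep1mP // -mcoeff_divX p0 mcoeff0 mulr0.
Qed.

End DivideByVariable.

Lemma map_mx_const_mul (n : nat) (R : comNzRingType) (f : {linear {mpoly R[n]} -> {mpoly R[n]}})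
   (p m l : nat) (v : 'M_(p, m)) (Y : 'M[R]_(m, l)) :
  map_mx f (v *m map_mx (@mpolyC n R) Y) = map_mx f v *m map_mx (@mpolyC n R) Y.
Proof.
apply/matrixP => i j; rewrite !mxE raddf_sum /=; apply: eq_bigr => s _.
by rewrite !mxE mulrC mul_mpolyC linearZ /= mulrC mul_mpolyC.
Qed.

Lemma scale_sub_mulmxC (R : comNzRingType) m (x y : R) (v : 'rV_m) (C D : 'M_m) :
  C *m D = D *m C ->
  x *: (y *: v - v *m C) - (y *: v - v *m C) *m D =
  y *: (x *: v - v *m D) - (x *: v - v *m D) *m C.
Proof.
move=> CD; rewrite 2!mulmxBl 2!scalerBr 2!scalerA -2!scalemxAl -2!mulmxA CD mulrC.
have swap (V : zmodType) (p q r t : V) : p - q - (r - t) = p - r - (q - t).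
  by rewrite 2!opprB -2!addrA; congr (p + _); rewrite addrCA [RHS]addrCA [- q - r]addrC.
exact: swap.
Qed.

Lemma mulmx_exprSr (R : comNzRingType) l m (v : 'M[R]_(l, m)) (C : 'M_m) s :
  v *m C ^+ s.+1 = v *m C ^+ s *m C.
Proof. by rewrite exprSr mulmxA. Qed.

(* A module over [R[x_1, .., x_n]] that is free of rank [m] over [R], each
   variable acting nilpotently by the matrix [X j]. *)
Section DiagonalKoszul.
Variables (n : nat) (R : comNzRingType) (m : nat) (X : 'I_n -> 'M[R]_m) (L : nat).
Hypothesis XC : forall i j, X i *m X j = X j *m X i.
Hypothesis Xnil : forall j, X j ^+ L = 0.
Local Notation S := {mpoly R[n]}.
Local Notation N := 'rV[S]_m.
Implicit Types (v w : N).

Definition cstX j : 'M[S]_m := map_mx (@mpolyC n R) (X j).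

Lemma cstXC i j : cstX i *m cstX j = cstX j *m cstX i.
Proof. by rewrite -!map_mxM XC. Qed.

Lemma cstXE j s : cstX j ^+ s = map_mx (@mpolyC n R) (X j ^+ s).
Proof.
elim: s => [|s IH]; first by rewrite !expr0 [RHS]map_mx1.
by rewrite !exprS IH -[X j * _]/(X j *m _) map_mxM.
Qed.

Definition diag_mul j v : N := 'X_j *: v - v *m cstX j.

Fact diag_mul_linear j : linear (diag_mul j).
Proof.
move=> c v w; rewrite /diag_mul scalerDr scalerA mulmxDl -scalemxAl opprD addrACA.
by rewrite scalerBr scalerA mulrC.
Qed.
HB.instance Definition _ j := GRing.isLinear.Build S N N _ (diag_mul j)
  (diag_mul_linear j).

(** Division by [x_j - X_j] as the series of the [x_j^-(s+1) X_j^s], a negative power of [x_j] being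
    read as iterated [divX]. It stops at [L] because [X_j ^+ L = 0]. *)
Definition diag_div j v : N :=
  \sum_(s < L) map_mx (iter s.+1 (divX j)) v *m cstX j ^+ s.

Lemma iter_divX_linear j s : linear (iter s (@divX n R j)).
Proof. elim: s => //= s IH c p q; have /= -> := IH c p q; exact: linearP. Qed.
HB.instance Definition _ j s := GRing.isLinear.Build R S S _
  (iter s (@divX n R j)) (iter_divX_linear j s).

Fact diag_div_additive j : zmod_morphism (diag_div j).
Proof.
move=> v w; rewrite /diag_div -sumrB; apply: eq_bigr => s _.
by rewrite -mulmxBl; congr (_ *m _); apply/matrixP => a b; rewrite !mxE raddfB.
Qed.
HB.instance Definition _ j := GRing.isZmodMorphism.Build N N (diag_div j)
  (diag_div_additive j).

Lemma diag_mulC i j v : diag_mul i (diag_mul j v) = diag_mul j (diag_mul i v).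
Proof.
by apply: scale_sub_mulmxC; apply: cstXC.
Qed.

(** [divX j] cancels the factor [x_j], so the summand of index [s] becomes [g s - g s.+1] and the
    sum telescopes; the last term [g L] vanishes by nilpotency. *)
Lemma diag_div_mul j v : diag_div j (diag_mul j v) = v.
Proof.
pose g s := map_mx (iter s (divX j)) v *m cstX j ^+ s.
have vE : v = g 0%N - g L.
  rewrite /g (cstXE j L) Xnil map_mx0 mulmx0 subr0 expr0 mulmx1.
  by apply/matrixP => a b; rewrite !mxE.
rewrite [RHS]vE -opprB -telescope_sumr // big_mkord -sumrN; apply: eq_bigr => s _.
rewrite opprB /g /diag_mul exprS mulmxA -mulmxBl; congr (_ *m _).
rewrite map_mxB map_mx_const_mul; congr (_ - _).
by apply/matrixP => a b; rewrite !mxE -[LHS]/(iter s.+1 (divX j) _) iterSr divX_mulX.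
Qed.

Lemma diag_div_mulC i j v : i != j ->
  diag_div i (diag_mul j v) = diag_mul j (diag_div i v).
Proof.
move=> ij; rewrite /diag_div raddf_sum /=; apply: eq_bigr => s _.
rewrite /diag_mul map_mxB map_mx_const_mul mulmxBl scalemxAl; congr (_ - _).
  congr (_ *m _); apply/matrixP => a b; rewrite !mxE.
  by elim: s.+1 => //= s' ->; rewrite divX_mulXC.
rewrite -!mulmxA; congr (_ *m _); elim: (s : nat) => [|s' IH].
  by rewrite expr0 mulmx1 mul1mx.
by rewrite exprS mulmxA cstXC -!mulmxA IH.
Qed.

Lemma map_divX_mul i j v : i != j ->
  map_mx (divX i) (diag_mul j v) = diag_mul j (map_mx (divX i) v).
Proof.
move=> ij; rewrite /diag_mul map_mxB map_mx_const_mul; congr (_ - _).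
by apply/matrixP => a b; rewrite !mxE -[LHS]/(divX i _) divX_mulXC.
Qed.

Lemma map_divX_div i j v :
  map_mx (divX i) (diag_div j v) = diag_div j (map_mx (divX i) v).
Proof.
rewrite /diag_div map_mx_sum; apply: eq_bigr => s _.
rewrite cstXE map_mx_const_mul; congr (_ *m _); apply/matrixP => a b.
by rewrite !mxE; elim: s.+1 => //= s' IH; rewrite divXC IH.
Qed.

Local Notation proj1 := (kproj1 diag_mul diag_div).
Local Notation proj := (kproj diag_mul diag_div).

(** The remainder modulo [x_i - X_i] no longer contains [x_i]. After all [n] divisions only
    constants are left, which is why [diag_eval] loses nothing by reading constant coefficients. *)
Lemma divX_proj1 i v : map_mx (divX i) (proj1 i v) = 0.
Proof.
pose g s := map_mx (iter s.+1 (divX i)) v *m cstX i ^+ s.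
rewrite /kproj1 /diag_mul !map_mxB map_mx_const_mul map_divX_div.
have -> : map_mx (divX i) ('X_i *: diag_div i v) = diag_div i v.
  by apply/matrixP => a b; rewrite !mxE divX_mulX.
have vE : map_mx (divX i) v = - (g L - g 0%N).
  by rewrite /g (cstXE i L) Xnil map_mx0 mulmx0 sub0r expr0 mulmx1 opprK.
apply/eqP; rewrite subr_eq0 {1}vE -telescope_sumr // big_mkord -sumrN; apply/eqP.
rewrite /diag_div mulmx_suml -sumrB; apply: eq_bigr => s _.
rewrite opprB /g mulmx_exprSr.
have -> : map_mx (iter s.+1 (divX i)) (map_mx (divX i) v) =
    map_mx (iter s.+2 (divX i)) v by apply/matrixP => a b; rewrite !mxE -iterSr.
by [].
Qed.

Lemma divX_proj k (i : 'I_n) v : (i < k)%N -> map_mx (divX i) (proj k v) = 0.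
Proof.
elim: k => //= k IH; case: insubP => [j _ jk|]; last first.
  move=> kn; rewrite ltnS leq_eqVlt => /orP [/eqP ik|/IH //].
  by move: (ltn_ord i); rewrite ik => kn'; rewrite kn' in kn.
have [<-|ij] := eqVneq i j; first by rewrite divX_proj1.
rewrite ltnS leq_eqVlt -{1}jk -[(_ == _ :> nat)]/(i == j) (negPf ij) /= => /IH IHi.
rewrite /kproj1 map_mxB map_divX_mul // map_divX_div IHi.
by rewrite (raddf0 (diag_div j)) (raddf0 (diag_mul j)) subrr.
Qed.

(* Substituting the matrices [X] for the variables. *)
Definition diag_eval v : 'rV[R]_m := map_mx (mcoeff 0%MM) (proj n v).

Lemma diag_eval_cst v : map_mx (@mpolyC n R) (diag_eval v) = proj n v.
Proof.
apply/matrixP => a b; rewrite !mxE -divX_eq0 // => j.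
by have /matrixP /(_ a b) := @divX_proj n j v (ltn_ord j); rewrite !mxE.
Qed.

Lemma diag_eval_additive : zmod_morphism diag_eval.
Proof. by move=> v w; rewrite /diag_eval raddfB /= map_mxB. Qed.
HB.instance Definition _ := GRing.isZmodMorphism.Build N 'rV[R]_m diag_eval
  diag_eval_additive.

Lemma diag_eval_diag j v : diag_eval (diag_mul j v) = 0.
Proof.
have p0 : proj n (diag_mul j v) = 0.
  exact: (kproj_a diag_mulC diag_div_mul diag_div_mulC v (ltn_ord j)).
by rewrite /diag_eval p0 map_mx0.
Qed.

Lemma diag_eval_decomp v :
  v = map_mx (@mpolyC n R) (diag_eval v) +
      \sum_j diag_mul j (diag_div j (proj j v)).
Proof.
rewrite diag_eval_cst; apply/eqP; rewrite addrC -subr_eq kproj_telescope //.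
by apply/eqP/eq_bigl => j; rewrite ltn_ord.
Qed.

Lemma diag_eval_eq0 v : diag_eval v = 0 <-> exists w : 'I_n -> N, v = \sum_j diag_mul j (w j).
Proof.
split=> [v0|[w ->]].
  exists (fun j => diag_div j (proj j v)).
  by rewrite {1}(diag_eval_decomp v) v0 map_mx0 add0r.
by rewrite raddf_sum big1 // => j _; exact: diag_eval_diag.
Qed.

(** A constant matrix that commutes with every [X j] commutes with multiplication and division by
    [x_j - X_j], hence with the projection. Applied to [X j] itself and to scalar matrices, this
    makes [diag_eval] linear over the polynomial ring. *)
Lemma diag_eval_mulmx (Y : 'M[R]_m) v : (forall j, Y *m X j = X j *m Y) ->
  diag_eval (v *m map_mx (@mpolyC n R) Y) = diag_eval v *m Y.
Proof.
move=> YC; have YC' j : map_mx (@mpolyC n R) Y *m cstX j = cstX j *m map_mx (@mpolyC n R) Y.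
  by rewrite /cstX -!map_mxM YC.
have mulY j w : diag_mul j (w *m map_mx (@mpolyC n R) Y) =
    diag_mul j w *m map_mx (@mpolyC n R) Y.
  by rewrite /diag_mul mulmxBl -scalemxAl -!mulmxA YC'.
have divY j w : diag_div j (w *m map_mx (@mpolyC n R) Y) =
    diag_div j w *m map_mx (@mpolyC n R) Y.
  rewrite /diag_div mulmx_suml; apply: eq_bigr => s _.
  rewrite map_mx_const_mul -!mulmxA; congr (_ *m _).
  elim: (s : nat) => [|s' IH]; first by rewrite expr0 mulmx1 mul1mx.
  by rewrite exprS mulmxA YC' -!mulmxA IH.
suff projY l : proj l (v *m map_mx (@mpolyC n R) Y) = proj l v *m map_mx (@mpolyC n R) Y.
  rewrite /diag_eval projY -diag_eval_cst -map_mxM.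
  by apply/matrixP => a b; rewrite !mxE !mcoeffC eqxx mulr1; apply: eq_bigr => c _;
     rewrite !mxE mcoeffC eqxx mulr1.
elim: l => //= l IH; case: insub => [j|]; rewrite IH //.
by rewrite /kproj1 /= divY mulY [RHS]mulmxBl.
Qed.

Lemma diag_evalX j v : diag_eval ('X_j *: v) = diag_eval v *m X j.
Proof.
have := diag_eval_diag j v; rewrite /diag_mul raddfB /= => /eqP.
by rewrite subr_eq0 => /eqP ->; apply: diag_eval_mulmx => i; exact: XC.
Qed.

Lemma diag_evalZ c v : diag_eval (c%:MP *: v) = c *: diag_eval v.
Proof.
have -> : c%:MP *: v = v *m map_mx (@mpolyC n R) c%:M.
  by rewrite map_scalar_mx mul_mx_scalar.
rewrite diag_eval_mulmx => [|j]; last by rewrite scalar_mxC.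
by rewrite mul_mx_scalar.
Qed.

Lemma diag_evalC (c : 'rV[R]_m) : diag_eval (map_mx (@mpolyC n R) c) = c.
Proof.
have divC j : diag_div j (map_mx (@mpolyC n R) c) = 0.
  rewrite /diag_div big1 // => s _; rewrite (_ : map_mx _ _ = 0) ?mul0mx //.
  apply/matrixP => a b; rewrite !mxE.
  elim: (s : nat) => [|s' /= ->]; last by rewrite raddf0.
  apply/mpolyP => l; rewrite mcoeff_divX mcoeffC mcoeff0.
  case: eqP => [/(congr1 (fun l : 'X_{1..n} => l j))|]; last by rewrite mulr0.
  by rewrite mnmDE mnm1E eqxx mnm0E addn1.
have projC l : proj l (map_mx (@mpolyC n R) c) = map_mx (@mpolyC n R) c.
  elim: l => //= l ->; case: insub => // j.
  by rewrite /kproj1 /= divC (raddf0 (diag_mul j)) subr0.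
by rewrite /diag_eval projC; apply/matrixP => a b; rewrite !mxE mcoeffC eqxx mulr1.
Qed.

End DiagonalKoszul.

Lemma mpoly_indX (n : nat) (R : comNzRingType) (P : {mpoly R[n]} -> Prop) :
  (forall c, P c%:MP) -> (forall p q, P p -> P q -> P (p + q)) ->
  (forall j p, P p -> P ('X_j * p)) -> forall p, P p.
Proof.
move=> PC PD PX p; rewrite [p]mpolyE; elim/big_ind: _ => [|? ? ? ?|m _].
- by rewrite -mpolyC0; apply: PC.
- exact: PD.
rewrite -mul_mpolyC mpolyXE_id; move: (index_enum _) => s.
rewrite mulrC; elim: s => [|i s IH]; first by rewrite big_nil mul1r.
rewrite big_cons -mulrA; elim: (m i) => [|e IHe]; first by rewrite expr0 mul1r.
by rewrite exprS -mulrA; apply: PX.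
Qed.

(* A chain in homological degree [i] is recorded by its coordinates over the
   basis [(B, b)], [B] a set of [i] variables and [b] a basis vector. *)
Section KoszulMatrices.
Variables (n m : nat) (S : comNzRingType).
Local Notation N := 'rV[S]_m.
Variables (a : 'I_n -> {linear N -> N}) (q : 'I_n -> {additive N -> N}).
Hypothesis aC : forall i j x, a i (a j x) = a j (a i x).
Hypothesis qa1 : forall j x, q j (a j x) = x.
Hypothesis qaC : forall i j x, i != j -> q i (a j x) = a j (q i x).
Implicit Types (f : {set 'I_n} -> N) (B : {set 'I_n}).

Definition kbasis i := {x : {set 'I_n} * 'I_m | #|x.1| == i}.
Definition krank i := #|{: kbasis i}|.
Definition kset i (t : 'I_(krank i)) := (val (enum_val t)).1.
Definition kvec i (t : 'I_(krank i)) := (val (enum_val t)).2.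

Lemma card_kset i (t : 'I_(krank i)) : #|kset t| = i.
Proof. exact/eqP/(valP (enum_val t)). Qed.

Definition kindex i B (b : 'I_m) (Bi : #|B| == i) : 'I_(krank i) :=
  enum_rank (Sub (B, b) Bi : kbasis i).

Lemma ksetK i B b (Bi : #|B| == i) : kset (kindex b Bi) = B.
Proof. by rewrite /kset enum_rankK. Qed.

Lemma kvecK i B b (Bi : #|B| == i) : kvec (kindex b Bi) = b.
Proof. by rewrite /kvec enum_rankK. Qed.

(** Subsets of the wrong cardinality receive 0, so that a vector of one homological degree becomes a
    family on which [kdiff] and [khtpy] act without degree bookkeeping. *)
Definition tochain i (v : 'rV[S]_(krank i)) B : N :=
  \row_b (if insub (B, b) is Some t then v 0 (enum_rank (t : kbasis i)) else 0).

Definition ofchain i f : 'rV[S]_(krank i) := \row_t f (kset t) 0 (kvec t).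

Lemma eq_ofchain i f g : (forall B, #|B| = i -> f B = g B) ->
  ofchain i f = ofchain i g.
Proof. by move=> fg; apply/rowP => t; rewrite !mxE fg // card_kset. Qed.

Lemma tochainE i v B b (Bi : #|B| == i) : tochain v B 0 b = v 0 (kindex b Bi).
Proof. by rewrite mxE insubT. Qed.

Lemma tochain_supp i (v : 'rV_(krank i)) B : #|B| != i -> tochain v B = 0.
Proof. by move=> Bi; apply/rowP => b; rewrite !mxE insubF //= (negPf Bi). Qed.

Lemma tochainK i (v : 'rV_(krank i)) : ofchain i (tochain v) = v.
Proof.
apply/rowP => t; rewrite !mxE /kset /kvec -surjective_pairing valK.
by rewrite enum_valK.
Qed.

Lemma ofchainK i f : (forall B, #|B| != i -> f B = 0) -> tochain (ofchain i f) = f.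
Proof.
move=> f0; apply/funext => B; have [Bi|/[dup] /f0 -> Bi] := boolP (#|B| == i).
  by apply/rowP => b; rewrite (tochainE _ _ Bi) mxE ksetK kvecK.
exact: tochain_supp.
Qed.

Lemma tochain_linear i B : linear (fun v : 'rV_(krank i) => tochain v B).
Proof.
move=> c v w; apply/rowP => b; rewrite !mxE.
by case: insub => [t|]; rewrite ?mxE ?mulr0 ?addr0.
Qed.

Definition kstep i (v : 'rV[S]_(krank i.+1)) : 'rV[S]_(krank i) :=
  ofchain i (kdiff a (tochain v)).

Fact kstep_linear i : linear (@kstep i).
Proof.
move=> c v w; apply/rowP => t; rewrite !mxE /kdiff.
rewrite !summxE mulr_sumr -big_split; apply: eq_bigr => j _ /=.
rewrite (tochain_linear _ c v w) linearP.
by case: ksign; rewrite /= !mxE // opprD mulrN.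
Qed.
HB.instance Definition _ i := GRing.isLinear.Build S _ _ _ (@kstep i)
  (@kstep_linear i).

Definition kmatrix i : 'M[S]_(krank i.+1, krank i) := lin1_mx (@kstep i).

Lemma mul_kmatrix i v : v *m kmatrix i = kstep v.
Proof. exact: mul_rV_lin1. Qed.

Lemma kdiff_supp i f B : (forall B, #|B| != i.+1 -> f B = 0) -> #|B| != i ->
  kdiff a f B = 0.
Proof.
move=> f0 Bi; rewrite /kdiff big1 // => j jB.
by rewrite f0 ?raddf0 ?signed0 // ?cardsU1 ?jB ?raddf0.
Qed.

Lemma khtpy_supp i f B : (forall B, #|B| != i -> f B = 0) -> #|B| != i.+1 ->
  khtpy a q f B = 0.
Proof.
move=> f0 Bi; rewrite /khtpy; case: pickP => // l /andP [lB _].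
by rewrite f0 ?raddf0 //; move: Bi; rewrite (cardsD1 l B) lB.
Qed.

(** A cycle is the differential of its image under [khtpy]. The homotopy identity is needed at sets
    with [i.+1] elements only, and these are nonempty. *)
Lemma kmatrix_exact i (v : 'rV_(krank i.+1)) :
  v *m kmatrix i = 0 <-> exists w, v = w *m kmatrix i.+1.
Proof.
rewrite mul_kmatrix; split => [v0|[w ->]].
  have d0 : kdiff a (tochain v) = fun=> 0.
    apply/funext => B; have [Bi|Bi] := boolP (#|B| == i); last first.
      by apply: kdiff_supp Bi => B'; apply: tochain_supp.
    apply/rowP => b; have := congr1 (fun w : 'rV_ _ => w 0 (kindex b Bi)) v0.
    by rewrite !mxE ksetK kvecK.
  exists (ofchain i.+2 (khtpy a q (tochain v))); rewrite mul_kmatrix /kstep.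
  rewrite ofchainK => [|B]; last by apply: khtpy_supp => B'; apply: tochain_supp.
  rewrite -[LHS]tochainK; apply: eq_ofchain => B Bi.
  rewrite -[LHS](@kdiff_htpy _ _ a q) //; last by rewrite -cards_eq0 Bi.
  rewrite d0 [X in _ + X](_ : _ = 0) ?addr0 //.
  by rewrite /khtpy; case: pickP => // l _; rewrite !raddf0.
rewrite mul_kmatrix /kstep ofchainK => [|B]; last first.
  by apply: kdiff_supp => B'; apply: tochain_supp.
by apply/rowP => t; rewrite !mxE kdiffK // mxE.
Qed.

Lemma kmatrix_exact0 (v : 'rV_(krank 0)) :
  (exists w, v = w *m kmatrix 0) <->
  exists w : 'I_n -> N, tochain v set0 = \sum_j a j (w j).
Proof.
have kd0 f : kdiff a f set0 = \sum_j a j (f [set j]).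
  rewrite /kdiff; apply: eq_big => j; first by rewrite inE.
  by rewrite setU0 ksign_small // => i; rewrite inE.
split=> [[w ->]|[w vE]].
  exists (fun j => tochain w [set j]); rewrite mul_kmatrix /kstep ofchainK ?kd0 //.
  by move=> B; apply: kdiff_supp => B'; apply: tochain_supp.
pose f B : N := if [pick j in B] is Some j then (if #|B| == 1%N then w j else 0) else 0.
exists (ofchain 1 f); rewrite mul_kmatrix /kstep ofchainK; last first.
  by move=> B /negPf B1; rewrite /f; case: pickP => // j _; rewrite B1.
rewrite -[LHS]tochainK; apply: eq_ofchain => B /eqP; rewrite cards_eq0 => /eqP ->.
rewrite vE kd0.
apply: eq_bigr => j _; rewrite /f cards1 eqxx.
by case: pickP => [l|/(_ j)]; rewrite inE ?eqxx // => /eqP ->.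
Qed.

End KoszulMatrices.

(** * Homogeneous polynomials, gradings read off coordinates, and homogeneous bases *)

Section PolyDeg.
Variables (k : fieldType) (n : nat).
Implicit Types (p q : {mpoly k[n]}) (d : int).

Lemma poly_degP d p :
  poly_deg d p <-> forall l : 'X_{1..n}, p@_l != 0 -> d = (mdeg l)%:Z.
Proof.
case: d => d /=; split.
- by move=> /dhomogP hp l; rewrite -mcoeff_msupp => /hp ->.
- by move=> hp; apply/dhomogP => l; rewrite mcoeff_msupp => /hp [].
- by move=> -> l; rewrite mcoeff0 eqxx.
- move=> hp; apply/mpolyP => l; rewrite mcoeff0; apply/eqP/negPn/negP.
  by move/hp.
Qed.

Lemma poly_deg0 d : poly_deg d (0 : {mpoly k[n]}).
Proof. by apply/poly_degP => l; rewrite mcoeff0 eqxx. Qed.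

Lemma poly_degD d p q : poly_deg d p -> poly_deg d q -> poly_deg d (p + q).
Proof.
move=> /poly_degP hp /poly_degP hq; apply/poly_degP => l; rewrite mcoeffD.
by have [-> |/hp //] := eqVneq p@_l 0; rewrite add0r => /hq.
Qed.

Lemma poly_degN d p : poly_deg d p -> poly_deg d (- p).
Proof.
by move=> /poly_degP hp; apply/poly_degP => l; rewrite mcoeffN oppr_eq0 => /hp.
Qed.

Lemma poly_deg_sum (I : Type) (s : seq I) (P : pred I) d (F : I -> {mpoly k[n]}) :
  (forall i, P i -> poly_deg d (F i)) -> poly_deg d (\sum_(i <- s | P i) F i).
Proof. by move=> hF; elim/big_ind: _ => //; [exact: poly_deg0|exact: poly_degD]. Qed.

Lemma poly_degM d e p q : poly_deg d p -> poly_deg e q -> poly_deg (d + e) (p * q).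
Proof.
case: d => d /= hp; last by rewrite hp mul0r => _; apply: poly_deg0.
case: e => e /= hq; last by rewrite hq mulr0; apply: poly_deg0.
exact: dhomogM.
Qed.

Lemma poly_degX j : poly_deg 1 ('X_j : {mpoly k[n]}).
Proof.
by apply/poly_degP => l; rewrite mcoeffX; case: (_ =P l) => [<-|_]; rewrite ?eqxx ?mdeg1.
Qed.

Lemma poly_degC c : poly_deg 0 (c%:MP : {mpoly k[n]}).
Proof.
apply/poly_degP => l; rewrite mcoeffC.
by case: (l =P 0%MM) => [->|_]; rewrite ?mulr0 ?eqxx ?mdeg0.
Qed.

End PolyDeg.

(* A grading in which homogeneity is read off coordinates. *)
Lemma coordinate_grading (k : fieldType) (V : zmodType) (m : nat)
    (co : V -> 'I_m -> k) (dg : 'I_m -> int) (comp : int -> V -> V) :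
  (forall x y i, co (x - y) i = co x i - co y i) ->
  (forall x, (forall i, co x i = 0) -> x = 0) ->
  (forall d x i, co (comp d x) i = if dg i == d then co x i else 0) ->
  is_grading (fun d x => forall i, co x i != 0 -> d = dg i).
Proof.
move=> coB co_inj coE.
have co0 i : co 0 i = 0 by have := coB 0 0 i; rewrite !subrr.
have coD x y i : co (x + y) i = co x i + co y i.
  by rewrite -[in LHS](opprK y) coB -[- y in LHS]sub0r coB co0 sub0r opprK.
have coS (s : seq int) (f : int -> V) i : co (\sum_(d <- s) f d) i = \sum_(d <- s) co (f d) i.
  by elim: s => [|d s IH]; rewrite ?big_nil // !big_cons coD IH.
split.
- by move=> d i; rewrite co0 eqxx.
- move=> d x y hx hy i; rewrite coB; have [->|/hx //] := eqVneq (co x i) 0.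
  by rewrite sub0r oppr_eq0 => /hy.
- move=> x; exists (undup (codom dg)), (fun d => comp d x).
  split=> [d i|]; first by rewrite coE; case: (dg i =P d) => // _; rewrite eqxx.
  apply/eqP; rewrite -subr_eq0; apply/eqP/co_inj => i.
  rewrite coB coS (bigD1_seq (dg i)) ?undup_uniq ?mem_undup ?codom_f //=.
  rewrite coE eqxx big1 ?addr0 ?subrr // => d /negPf di.
  by rewrite coE eq_sym di.
- move=> s f us hf s0 d ds; apply: co_inj => i.
  apply/eqP/negPn/negP => fi; have dE := hf _ _ fi.
  have := congr1 (co^~ i) s0; rewrite coS co0 (bigD1_seq d) //= big1 ?addr0.
    by move=> f0; rewrite f0 eqxx in fi.
  move=> e ed; apply/eqP/negPn/negP => /hf ei.
  by rewrite ei dE eqxx in ed.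
Qed.

(** The equivalence in [hadeg] says that each homogeneous piece is a coordinate subspace; degree
    questions become questions about nonzero coordinates. *)
Record hbasis (k : fieldType) (A : gradedAlg k) (m : nat) := HBasis {
  hb : 'I_m -> A;
  hco : A -> 'rV[k]_m;
  hdeg : 'I_m -> nat;
  hcoK : forall a, a = \sum_i hco a 0 i *: hb i;
  hco_sum : forall c : 'rV_m, hco (\sum_i c 0 i *: hb i) = c;
  hadeg : forall d a, adeg d a <-> forall i, hco a 0 i != 0 -> d = (hdeg i)%:Z
}.

Section HomogeneousBasis.
Variables (k : fieldType) (A : gradedAlg k) (m : nat) (H : hbasis A m).
Hypothesis gA : is_graded_algebra A.
Implicit Types (a b x : A).

Fact hco_linear : linear (hco H).
Proof.
move=> c x y; have -> : c *: x + y = \sum_i (c *: hco H x + hco H y) 0 i *: hb H i.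
  rewrite {1}[x](hcoK H) {1}[y](hcoK H) scaler_sumr -big_split; apply: eq_bigr => i _.
  by rewrite !mxE scalerDl scalerA.
exact: hco_sum.
Qed.
HB.instance Definition _ := GRing.isLinear.Build k A 'rV[k]_m _ (hco H) hco_linear.

Lemma hco_inj x : hco H x = 0 -> x = 0.
Proof.
by move=> x0; rewrite [x](hcoK H) x0 big1 // => i _; rewrite mxE scale0r.
Qed.

Lemma hco_hb i : hco H (hb H i) = delta_mx 0 i.
Proof.
rewrite -[RHS](hco_sum H) (bigD1 i) //= mxE !eqxx scale1r big1 ?addr0 // => l li.
by rewrite mxE (negPf li) andbF scale0r.
Qed.

Lemma hb_deg i : adeg (hdeg H i)%:Z (hb H i).
Proof.
by apply/(hadeg H) => l; rewrite hco_hb mxE; case: (l =P i) => [-> //|_]; rewrite andbF eqxx.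
Qed.

(** Rows are images of basis elements: coordinates are row vectors acted on from the right, and
    functionals are columns acted on from the left. *)
Definition rho a : 'M[k]_m := \matrix_(i, l) hco H (a * hb H i) 0 l.

Lemma hcoM a x : hco H (a * x) = hco H x *m rho a.
Proof.
rewrite {1}[x](hcoK H) mulr_sumr raddf_sum /=; apply/rowP => l.
rewrite summxE mxE; apply: eq_bigr => i _.
by rewrite -scalerAr linearZ /= !mxE.
Qed.

Lemma rhoE a i : row i (rho a) = hco H (a * hb H i).
Proof. by apply/rowP => l; rewrite !mxE. Qed.

Lemma rhoM a b : rho (a * b) = rho a *m rho b.
Proof.
by apply/row_matrixP => i; rewrite row_mul !rhoE -mulrA mulrCA !hcoM.
Qed.

Lemma rhoC a b : rho a *m rho b = rho b *m rho a.
Proof. by rewrite -!rhoM mulrC. Qed.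

Lemma rho1 : rho 1 = 1%:M.
Proof. by apply/row_matrixP => i; rewrite rhoE mul1r hco_hb rowE mulmx1. Qed.

Lemma rhoX a s : rho (a ^+ s) = rho a ^+ s.
Proof. by elim: s => [|s IH]; [exact: rho1|rewrite !exprS rhoM IH]. Qed.

Lemma rho_linear : linear rho.
Proof.
move=> c a b; apply/row_matrixP => i.
by rewrite rhoE linearP /= !rhoE mulrDl -scalerAl linearP.
Qed.
HB.instance Definition _ := GRing.isLinear.Build k A 'M[k]_m _ rho rho_linear.

Lemma rho_deg d a i l : adeg d a -> rho a i l != 0 ->
  (hdeg H l)%:Z = d + (hdeg H i)%:Z.
Proof.
rewrite mxE => ad; have /(hadeg H) := galgM gA ad (hb_deg i).
by move=> h /h ->.
Qed.

(* The k-linear dual of [A]; a functional is the column of its values on the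
   basis. *)
Definition dualmod : Type := 'cV[k]_m.
HB.instance Definition _ := GRing.Zmodule.copy dualmod 'cV[k]_m.

Definition dual_scale a (f : dualmod) : dualmod := rho a *m f.

Fact dual_scaleA a b f : dual_scale a (dual_scale b f) = dual_scale (a * b) f.
Proof. by rewrite /dual_scale mulmxA -rhoM. Qed.

Fact dual_scale1 : left_id 1 dual_scale.
Proof. by move=> f; rewrite /dual_scale rho1 mul1mx. Qed.

Fact dual_scaleDr : right_distributive dual_scale +%R.
Proof. by move=> a f g; rewrite /dual_scale mulmxDr. Qed.

Fact dual_scaleDl f : {morph dual_scale^~ f : a b / a + b}.
Proof. by move=> a b; rewrite /dual_scale raddfD mulmxDl. Qed.

HB.instance Definition _ := GRing.Zmodule_isLmodule.Build A dualmod
  dual_scaleA dual_scale1 dual_scaleDr dual_scaleDl.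

Definition dual_graded : gradedMod A :=
  @GradedMod k A dualmod
    (fun d (f : 'cV[k]_m) => forall i, f i 0 != 0 -> d = - (hdeg H i)%:Z).

Lemma dual_scaleE a (f : dual_graded) : a *: f = rho a *m (f : 'cV_m).
Proof. by []. Qed.

Lemma dual_is_graded : is_graded_module dual_graded.
Proof.
split=> [|d e a f ad fe i].
  apply: (@coordinate_grading k dualmod m (fun f i => f i 0)
    (fun i => - (hdeg H i)%:Z)
    (fun d (f : 'cV[k]_m) => \col_i (if - (hdeg H i)%:Z == d then f i 0 else 0))).
  - by move=> f g i; rewrite !mxE.
  - by move=> f f0; apply/colP => i; rewrite mxE.
  - by move=> d f i; rewrite mxE.
rewrite dual_scaleE mxE => s0.
have [l] : exists l, rho a i l * (f : 'cV_m) l 0 != 0.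
  apply/existsP; rewrite -[X in is_true X]negbK negb_exists; apply/negP => /forallP l0.
  by move/eqP: s0; apply; rewrite big1 // => l _; apply/eqP; move: (l0 l); rewrite negbK.
rewrite mulf_eq0 negb_or => /andP [al /fe ->].
by rewrite (rho_deg ad al) opprD addrA subrr sub0r.
Qed.

End HomogeneousBasis.

(** * Regularity and canonical module of an Artinian algebra *)

Section CanonicalDual.
Variables (k : fieldType) (A : gradedAlg k) (m : nat) (H : hbasis A m).
Hypothesis gA : is_graded_algebra A.
Variables (n : nat) (pi : {lrmorphism {mpoly k[n]} -> A}).
Hypothesis pi_pres : is_presentation pi.
Variable r : nat.
Hypothesis hdeg_le : forall i, (hdeg H i <= r)%N.
Local Notation S := {mpoly k[n]}.

Definition var_mx (j : 'I_n) : 'M[k]_m := rho H (pi 'X_j).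

Lemma pi_degX j : adeg 1 (pi 'X_j).
Proof. exact/(proj2 pi_pres)/poly_degX. Qed.

Lemma var_mxC i j : var_mx i *m var_mx j = var_mx j *m var_mx i.
Proof. exact: rhoC. Qed.

Lemma var_mx_deg j i l : var_mx j i l != 0 -> hdeg H l = (hdeg H i).+1.
Proof. by move=> /(rho_deg gA (pi_degX j)) []. Qed.

Lemma var_mx_nil j : var_mx j ^+ r.+1 = 0.
Proof.
suff p0 : pi 'X_j ^+ r.+1 = 0 by rewrite /var_mx -rhoX p0 raddf0.
rewrite -rmorphXn; apply/(hco_inj (H := H))/rowP => i; rewrite mxE; apply/eqP/negPn/negP.
have : adeg r.+1%:Z (pi ('X_j ^+ r.+1)).
  apply: (proj2 pi_pres); rewrite -[in Posz _](mul1n r.+1).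
  exact/dhomogMn/(poly_degX k j).
by move=> /(hadeg H) h /h [] ri; have := hdeg_le i; rewrite -ri ltnn.
Qed.

Local Notation a := (diag_mul var_mx).
Local Notation q := (diag_div var_mx r.+1).
Let aC := diag_mulC var_mxC.
Let qa1 := diag_div_mul var_mx_nil.
Let qaC := @diag_div_mulC n k m var_mx r.+1 var_mxC.

(** With these shifts both parts of [x_j - X_j] are homogeneous: an entry [x_j] has degree 1, and a
    nonzero entry of [X_j] joins basis elements whose degrees differ by 1, which compensates the
    change of homological degree. *)
Definition kres : free_complex S :=
  @FreeComplex S (krank n m) (fun i t => (i + hdeg H (kvec t))%:Z)
    (kmatrix (diag_mul var_mx)).

Definition kres_aug (t : 'I_(frank kres 0)) : A^o := hb H (kvec t).

Lemma mem_kset0 (t : 'I_(krank n m 0)) : kset t = set0.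
Proof. by apply/eqP; rewrite -cards_eq0 card_kset. Qed.

Lemma kindex_bij :
  bijective (fun b : 'I_m => kindex b (introT eqP (cards0 'I_n))).
Proof.
exists (fun t : 'I_(krank n m 0) => kvec t) => [b|t]; first exact: kvecK.
rewrite /kindex -[RHS]enum_valK; congr enum_rank; apply: val_inj => /=.
by rewrite -(mem_kset0 t) [RHS]surjective_pairing.
Qed.

Lemma kres_augE (v : 'rV[S]_(krank n m 0)) :
  augmentation_map (A := polyAlg k n) (M := A^o) pi kres_aug v =
    \sum_b pi (tochain v set0 0 b) *: (hb H b : A^o).
Proof.
rewrite /augmentation_map (reindex _ (onW_bij _ kindex_bij)) /=.
by apply: eq_bigr => b _; rewrite /kres_aug kvecK (tochainE _ _ (introT eqP (cards0 'I_n))).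
Qed.

(** The sides agree on constants. The augmentation kills the image of [x_j - X_j], since row [l] of
    [X_j] expands the product of the class of [x_j] with the basis element [l]; [diag_eval_decomp]
    leaves no other case. *)
Lemma sum_pi_eval (w : 'rV[S]_m) :
  \sum_b pi (w 0 b) *: (hb H b : A^o) =
  \sum_b diag_eval var_mx r.+1 w 0 b *: hb H b.
Proof.
have sumD (x y : 'rV[S]_m) : \sum_b pi ((x + y) 0 b) *: (hb H b : A^o) =
    \sum_b pi (x 0 b) *: (hb H b : A^o) + \sum_b pi (y 0 b) *: (hb H b : A^o).
  by rewrite -big_split; apply: eq_bigr => b _; rewrite mxE raddfD scalerDl.
have piC c : pi (c%:MP) = c%:A by rewrite -[c%:MP]mulr1 mul_mpolyC linearZ /= rmorph1.
rewrite {1}[w](diag_eval_decomp var_mx_nil) sumD.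
rewrite (eq_bigr (fun b => diag_eval var_mx r.+1 w 0 b *: hb H b)) => [|b _]; last first.
  by rewrite mxE piC -[LHS]scalerAl mul1r.
rewrite [X in _ + X](_ : _ = 0) ?addr0 //.
have sum0 (F : 'I_n -> 'rV[S]_m) :
    (forall j, \sum_b pi (F j 0 b) *: (hb H b : A^o) = 0) ->
    \sum_b pi ((\sum_j F j) 0 b) *: (hb H b : A^o) = 0.
  move=> F0; elim/big_rec: (\sum_j F j) => [|j x _ x0].
    by rewrite big1 // => b _; rewrite mxE rmorph0 scale0r.
  by rewrite sumD x0 F0 addr0.
apply: sum0 => j; move: (diag_div _ _ _ _) => x.
rewrite /diag_mul (eq_bigr (fun b => pi 'X_j * (pi (x 0 b) * hb H b) -
    \sum_l var_mx j l b *: (pi (x 0 l) * hb H b))) => [|b _]; last first.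
  rewrite !mxE (rmorphB pi) (rmorphM pi) scalerBl -[_ *: _]/(_ * _) mulrA; congr (_ - _).
  rewrite (rmorph_sum pi) scaler_suml; apply: eq_bigr => l _.
  have -> : cstX var_mx j l b = (var_mx j l b)%:MP by rewrite /cstX [LHS]mxE.
  by rewrite (rmorphM pi) /= piC -[LHS]/(_ * _) mulr_algr -scalerAl.
rewrite sumrB exchange_big -sumrB big1 // => l _ /=.
rewrite mulrCA (hcoK H (pi 'X_j * hb H l)) mulr_sumr -sumrB big1 // => b _.
by rewrite -scalerAr mxE subrr.
Qed.

Lemma kmatrixE i t t' : kmatrix a i t t' =
  \sum_(j | j \notin kset t') signed (ksign j (kset t'))
    (if j |: kset t' == kset t then
       'X_j * (kvec t == kvec t')%:R - (var_mx j (kvec t) (kvec t'))%:MP else 0).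
Proof.
rewrite [LHS]mxE mxE /kdiff summxE; apply: eq_bigr => j jt.
have -> : tochain (delta_mx 0 t) (j |: kset t') =
    if j |: kset t' == kset t then delta_mx 0 (kvec t) else 0 :> 'rV[S]_m.
  have uT (u : kbasis n m i.+1) : (enum_rank u == t) = (val u == (kset t, kvec t)).
    rewrite /kset /kvec -surjective_pairing val_eqE -{1}[t]enum_valK.
    exact: (inj_eq enum_rank_inj).
  case: eqP => [->|Bt]; apply/rowP => b; rewrite !mxE.
    case: insubP => [u _ uE|]; last by rewrite card_kset eqxx.
    by rewrite mxE uT uE xpair_eqE !eqxx.
  by case: insubP => [u _ uE|//]; rewrite mxE uT uE xpair_eqE (introF eqP Bt) andbF.
have signedE b (x : 'rV[S]_m) c : signed b x 0 c = signed b (x 0 c).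
  by case: b; rewrite /= ?mxE.
rewrite signedE; congr (signed _ _); case: ifP => _; last by rewrite raddf0 mxE.
rewrite /diag_mul !mxE eqxx /= eq_sym; congr (_ - _).
rewrite (bigD1 (kvec t)) //= big1 ?addr0 => [|l /negPf lt]; last first.
  by rewrite mxE lt andbF mul0r.
by rewrite mxE !eqxx mul1r /cstX [LHS]mxE [in LHS]mxE.
Qed.

Lemma kres_resolves : resolves pi kres_aug.
Proof.
split=> /=.
- by move=> t; rewrite /kres_aug add0n; exact: hb_deg.
- move=> i t t'; rewrite kmatrixE; apply: poly_deg_sum => j jt.
  suff: poly_deg ((i.+1 + hdeg H (kvec t))%:Z - (i + hdeg H (kvec t'))%:Z)
      (if j |: kset t' == kset t then 'X_j * (kvec t == kvec t')%:R -
          (var_mx j (kvec t) (kvec t'))%:MP else 0).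
    by case: ksign => //; exact: poly_degN.
  case: ifP => _; last exact: poly_deg0.
  apply: poly_degD; [|apply: poly_degN].
    case: eqP => [->|_]; last by rewrite mulr0; exact: poly_deg0.
    rewrite mulr1 (_ : _ - _ = 1); first exact: poly_degX.
    by rewrite addSn -addn1 PoszD addrC addKr.
  have [->|/var_mx_deg ->] := eqVneq (var_mx j (kvec t) (kvec t')) 0.
    by rewrite mpolyC0; exact: poly_deg0.
  by rewrite addnS addSn subrr; exact: poly_degC.
- move=> x; pose v : 'rV[S]_m := map_mx (@mpolyC n k) (hco H x).
  exists (ofchain 0 (fun B => if #|B| == 0%N then v else 0)).
  rewrite kres_augE ofchainK => [|B /negPf -> //]; rewrite cards0 /=.
  by rewrite sum_pi_eval diag_evalC // -hcoK.
- move=> v; rewrite kres_augE sum_pi_eval.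
  rewrite (kmatrix_exact0 (diag_mul var_mx)) -(diag_eval_eq0 var_mxC var_mx_nil).
  split=> [v0|->]; last by rewrite big1 // => b _; rewrite mxE scale0r.
  by rewrite -(hco_sum H (diag_eval _ _ _)) v0 raddf0.
- by move=> i v; exact: (kmatrix_exact aC qa1 qaC).
Qed.

End CanonicalDual.

Section RegularityCanonical.
Variables (k : fieldType) (A : gradedAlg k) (m : nat) (H : hbasis A m).
Hypothesis gA : is_graded_algebra A.
Variables (n' : nat) (pi : {lrmorphism {mpoly k[n'.+1]} -> A}).
Hypothesis pi_pres : is_presentation pi.
Variable r : nat.
Hypothesis hdeg_le : forall i, (hdeg H i <= r)%N.
Local Notation n := n'.+1.
Local Notation S := {mpoly k[n]}.
Local Notation X := (var_mx H pi).
Local Notation F := (kres H pi).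

Lemma cardT_ord : #|[set: 'I_n]| == n.
Proof. by rewrite cardsT card_ord. Qed.

Lemma krank_top : krank n m n.+1 = 0%N.
Proof.
apply: eq_card0 => -[[B b] /= cB]; have := max_card (mem B).
by rewrite (eqP cB) card_ord ltnn.
Qed.

Lemma kset_top (t : 'I_(krank n m n)) : kset t = setT.
Proof.
by apply/eqP; rewrite eqEcard subsetT cardsT card_ord card_kset leqnn.
Qed.

Lemma kindex_top (t : 'I_(krank n m n)) : kindex (kvec t) cardT_ord = t.
Proof.
rewrite /kindex -[RHS]enum_valK; congr enum_rank; apply: val_inj => /=.
by rewrite -(kset_top t) -surjective_pairing.
Qed.

Lemma degree_part0 i j : (forall t : 'I_(frank F i), fshift t != j) ->
  degree_part (A := polyAlg k n) F i j = 0.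
Proof. by move=> ne; apply/matrixP => s t; rewrite !mxE (negPf (ne s)) andbF. Qed.

(** A shift minus its homological degree is the degree of a basis element, hence at most [r]. The
    bound is attained in homological degree [n]: modulo the variables the differential keeps only
    entries of the [X_j], which raise degrees and so vanish on a basis element of degree [r], and
    nothing bounds there because the next term is zero. *)
Lemma kres_regularity : (exists i, hdeg H i = r) -> has_regularity pi r%:Z.
Proof.
case=> b0 b0r; exists F, (@kres_aug k A m H n'.+1 pi); split.
- exact: (kres_resolves gA pi_pres hdeg_le).
- exists n, (n + r)%:Z; split; last by rewrite PoszD addrC addKr.
  pose t0 := kindex b0 cardT_ord; pose d0 : 'rV[k]_(krank n m n) := delta_mx 0 t0.
  rewrite /betti /tor_dim (_ : \rank (tor_boundaries (A := polyAlg k n) _ F n _) = 0%N); last first.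
    have := rank_leq_row (tor_boundaries (A := polyAlg k n) (mcoeff 0%MM) F n (n + r)%:Z).
    by rewrite [X in (_ <= X)%N]krank_top leqn0 => /eqP.
  rewrite subn0 => /eqP; rewrite mxrank_eq0 => /eqP cyc0.
  have : (d0 <= tor_cycles (A := polyAlg k n) (mcoeff 0%MM) F n (n + r)%:Z)%MS.
    rewrite /tor_cycles sub_capmx; apply/andP; split.
      apply/sub_kermxP; rewrite -rowE; apply/rowP => t'.
      rewrite [LHS]mxE [LHS]mxE [X in mcoeff _ X]kmatrixE raddf_sum mxE big1 //= => j jt'.
      rewrite raddf_signed /=.
      rewrite (_ : mcoeff _ _ = 0) ?signed0 //; case: ifP => _; last by rewrite mcoeff0.
      rewrite mcoeffB mcoeffC eqxx mulr1 rmorphM /= mcoeffX.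
      case: eqP => [/(congr1 (@mdeg _))|_]; first by rewrite mdeg1 mdeg0.
      rewrite mul0r sub0r kvecK; apply/eqP; rewrite oppr_eq0; apply/negPn/negP.
      move=> /(var_mx_deg gA pi_pres) bE; have := hdeg_le (kvec t').
      by rewrite bE b0r ltnn.
    apply/submxP; exists d0; apply/rowP => t; rewrite -rowE !mxE eqxx /= kvecK b0r.
    by rewrite eqxx andbT eq_sym.
  rewrite cyc0 submx0 => /eqP /rowP /(_ t0); rewrite !mxE !eqxx => /eqP.
  by rewrite oner_eq0.
- move=> i j betti0.
  have [t tj] : exists t : 'I_(frank F i), fshift t = j.
    apply/not_existsP => ne; apply: betti0.
    have dp0 : degree_part (A := polyAlg k n) F i j = 0 by apply: degree_part0 => t; apply/eqP/ne.
    rewrite /betti /tor_dim (_ : \rank (tor_cycles (A := polyAlg k n) _ F i j) = 0%N) //.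
    apply/eqP; rewrite -leqn0; case: i ne dp0 => [|i] ne dp0 /=.
      by rewrite dp0 mxrank0.
    by apply: leq_trans (mxrankS (capmxSr _ _)) _; rewrite dp0 mxrank0.
  by rewrite -tj /= PoszD addrC addKr; exact: hdeg_le.
Qed.

Definition top_vec (c : 'cV[S]_(krank n m n)) : 'rV[S]_m :=
  \row_b c (kindex b cardT_ord) 0.

(** The functional with value at [a] the sum over [b] of the coordinate [b] of [pi (c_b) * a]; in
    other words the sum of the [pi (c_b)] times the dual basis. *)
Definition dual_class (c : 'cV[S]_(krank n m n)) : dual_graded H :=
  (\col_i \sum_b rho H (pi (top_vec c 0 b)) i b : 'cV[k]_m).

Definition var_trmx j := (X j)^T.

Lemma var_trmxC i j : var_trmx i *m var_trmx j = var_trmx j *m var_trmx i.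
Proof. by rewrite -!trmx_mul var_mxC. Qed.

Lemma var_trmx_nil j : var_trmx j ^+ r.+1 = 0.
Proof.
have trX s : var_trmx j ^+ s = (X j ^+ s)^T.
  elim: s => [|s IH]; first by rewrite !expr0 [RHS]trmx1.
  by rewrite exprSr exprS IH [RHS]trmx_mul.
by rewrite trX (var_mx_nil pi_pres hdeg_le) trmx0.
Qed.

Local Notation evT := (diag_eval var_trmx r.+1).

Lemma diag_eval_scale s (v : 'rV[S]_m) :
  evT (s *: v) = evT v *m (rho H (pi s))^T.
Proof.
elim/mpoly_indX: s => [c|p q IHp IHq|j p IHp].
- rewrite (diag_evalZ var_trmx_nil) -[c%:MP]mulr1 mul_mpolyC linearZ /= rmorph1.
  by rewrite linearZ /= rho1 linearZ /= trmx1 -scalemxAr mulmx1.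
- by rewrite scalerDl raddfD /= IHp IHq -mulmxDr (rmorphD pi) (raddfD (rho H)) (raddfD trmx).
- rewrite -scalerA (diag_evalX var_trmxC var_trmx_nil) IHp rmorphM rhoM trmx_mul.
  by rewrite -mulmxA -!trmx_mul -!rhoM mulrC.
Qed.

Lemma dual_classE c : dual_class c = (evT (top_vec c))^T :> 'cV_m.
Proof.
apply/colP => i; rewrite [RHS]mxE [LHS]mxE [in RHS](row_sum_delta (top_vec c)).
rewrite raddf_sum summxE; apply: eq_bigr => b _; rewrite /= diag_eval_scale.
have -> : delta_mx 0 b = map_mx (@mpolyC n k) (delta_mx 0 b) :> 'rV[S]_m.
  by apply/rowP => l; rewrite !mxE; case: (_ && _).
by rewrite diag_evalC -rowE [RHS]mxE [RHS]mxE.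
Qed.

Lemma card_setC1_ord (j : 'I_n) : #|~: [set j]| == n'.
Proof. by rewrite cardsC1 card_ord. Qed.

Lemma setU1_eqT (j : 'I_n) (t : 'I_(krank n m n')) :
  ((j \notin kset t) && (j |: kset t == setT)) = (kset t == ~: [set j]).
Proof.
apply/andP/eqP => [[jt /eqP jT]|->].
  apply/setP => l; rewrite !inE; have /setP /(_ l) := jT; rewrite !inE.
  by case: eqP => [->|] //= _; apply: negPf.
by rewrite !inE eqxx /= setUCr eqxx.
Qed.

Definition cotop_vec (c : 'cV[S]_(krank n m n')) (j : 'I_n) : 'rV[S]_m :=
  \row_b signed (ksign j (~: [set j])) (c (kindex b (card_setC1_ord j)) 0).

(** Self-duality of the Koszul complex. Sets of [n - 1] variables are complements of single
    variables, and up to the signs absorbed in [cotop_vec] the dual of the last differential is the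
    first differential for the transposed matrices. *)
Lemma mul_kmatrix_top (c : 'cV[S]_(krank n m n')) :
  top_vec (kmatrix (diag_mul X) n' *m c) =
  \sum_j diag_mul var_trmx j (cotop_vec c j).
Proof.
apply/rowP => b; rewrite [LHS]mxE [LHS]mxE summxE.
under eq_bigr => t _ do rewrite kmatrixE kset_top kvecK mulr_suml big_mkcond.
rewrite exchange_big; apply: eq_bigr => j _ /=.
rewrite -big_mkcond (bigID (fun t => j |: kset t == setT)) /= addrC big1 ?add0r; last first.
  by move=> t /andP [_ /negPf ->]; rewrite signed0 mul0r.
rewrite (eq_bigl (fun t => kset t == ~: [set j])) => [|t]; last exact: setU1_eqT.
rewrite (reindex_onto (fun b => kindex b (card_setC1_ord j)) (@kvec n m n')) /=; last first.
  move=> t /eqP tj; rewrite /kindex -[RHS]enum_valK; congr enum_rank; apply: val_inj => /=.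
  by rewrite -tj -surjective_pairing.
rewrite (eq_bigl xpredT) => [|b']; last by rewrite ksetK kvecK !eqxx.
under eq_bigr => b' _.
  rewrite ksetK kvecK setUCr eqxx.
  have -> : forall e (x y : S), signed e x * y = x * signed e y.
    by case=> x y; rewrite /= ?mulNr ?mulrN.
  rewrite mulrBl; over.
rewrite /diag_mul sumrB !mxE; congr (_ - _).
  rewrite (bigD1 b) //= big1 ?addr0 => [|b' bb']; first by rewrite eqxx mulr1.
  by rewrite eq_sym (negPf bb') mulr0 mul0r.
by apply: eq_bigr => b' _; rewrite /cstX !mxE mulrC.
Qed.

Lemma top_vec_inj c c' : top_vec c = top_vec c' -> c = c'.
Proof.
move=> cc'; apply/colP => t; have /rowP /(_ (kvec t)) := cc'.
by rewrite !mxE kindex_top.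
Qed.

Lemma coboundary_top c : (exists c', c = kmatrix (diag_mul X) n' *m c') <->
  exists w : 'I_n -> 'rV[S]_m, top_vec c = \sum_j diag_mul var_trmx j (w j).
Proof.
split=> [[c' ->]|[w cw]]; first by exists (cotop_vec c'); exact: mul_kmatrix_top.
exists (\col_t if [pick j | kset t == ~: [set j]] is Some j then
          signed (ksign j (~: [set j])) (w j 0 (kvec t)) else 0).
apply: top_vec_inj; rewrite mul_kmatrix_top cw; apply: eq_bigr => j _.
congr diag_mul; apply/rowP => b; rewrite !mxE.
case: pickP => [l|/(_ j)]; rewrite ksetK ?eqxx // => /eqP /setC_inj /set1_inj <-.
by rewrite signed_addb addbb kvecK.
Qed.

Lemma dual_class_linear s c c' :
  dual_class (s *: c + c') = pi s *: dual_class c + dual_class c'.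
Proof.
rewrite dual_scaleE; apply/colP => i.
rewrite [LHS]mxE [RHS]mxE [X in _ = X + _]mxE [X in _ = _ + X]mxE.
have -> : \sum_l rho H (pi s) i l * dual_class c l 0 =
    \sum_b rho H (pi (s * top_vec c 0 b)) i b.
  under eq_bigr => l _ do rewrite [X in _ * X]mxE mulr_sumr.
  rewrite exchange_big; apply: eq_bigr => b _ /=.
  by rewrite (rmorphM pi) rhoM [RHS]mxE.
rewrite -big_split; apply: eq_bigr => b _ /=.
have -> : top_vec (s *: c + c') 0 b = s * top_vec c 0 b + top_vec c' 0 b.
  by rewrite !mxE.
by rewrite (rmorphD pi) (raddfD (rho H)) [LHS]mxE.
Qed.

Lemma dual_class_cst (w : dual_graded H) :
  dual_class (\col_t ((w : 'cV_m) (kvec t) 0)%:MP) = w.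
Proof.
rewrite dual_classE; apply/colP => i.
rewrite (_ : top_vec _ = map_mx (@mpolyC n k) (w : 'cV_m)^T); last first.
  by apply/rowP => b; rewrite !mxE kvecK.
by rewrite diag_evalC trmxK.
Qed.

Lemma dual_class_surj j (w : dual_graded H) : mdg j w ->
  exists2 c, dual_class c = w & @dual_deg k (polyAlg k n) F n (j - n%:Z) c.
Proof.
move=> wj; exists (\col_t ((w : 'cV_m) (kvec t) 0)%:MP).
  exact: dual_class_cst.
move=> t; rewrite mxE /=; have [->|/wj ->] := eqVneq ((w : 'cV_m) (kvec t) 0) 0.
  by rewrite mpolyC0; exact: poly_deg0.
by rewrite PoszD (_ : _ + _ = 0); [exact: poly_degC|ring].
Qed.

Lemma dual_class_eq0 c : dual_class c = 0 <->
  exists c', c = kmatrix (diag_mul X) n' *m c'.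
Proof.
rewrite coboundary_top -(diag_eval_eq0 var_trmxC var_trmx_nil) dual_classE.
by split=> [/(congr1 trmx)|->]; rewrite ?trmxK ?trmx0.
Qed.

Lemma dual_class_deg j c : @dual_deg k (polyAlg k n) F n (j - n%:Z) c ->
  mdg j (dual_class c).
Proof.
move=> cj i; rewrite mxE => s0.
have [b rb] : exists b, rho H (pi (top_vec c 0 b)) i b != 0.
  apply/existsP; rewrite -[X in is_true X]negbK negb_exists; apply/negP => /forallP l0.
  by move/eqP: s0; apply; rewrite big1 // => l _; apply/eqP; move: (l0 l); rewrite negbK.
have := cj (kindex b cardT_ord); rewrite /= kvecK => cb'.
have {cb'}cb := proj2 pi_pres _ _ cb'.
rewrite [top_vec c 0 b]mxE in rb; have e := rho_deg gA cb rb.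
apply: (addIr (hdeg H i)%:Z); rewrite addNr.
by apply: (addrI (hdeg H b)%:Z); rewrite addr0 [RHS]e PoszD; ring.
Qed.

Lemma dual_cocycle c : @ext_cocycle k (polyAlg k n) F n c.
Proof.
apply/colP => -[l lt]; exfalso; move: lt.
by rewrite [X in (_ < X)%N]krank_top ltn0.
Qed.

Lemma dual_is_canonical : is_canonical_module pi (dual_graded H).
Proof.
split; first exact: dual_is_graded.
exists F, (@kres_aug k A m H n'.+1 pi), dual_class => Z B; split.
- exact: (kres_resolves gA pi_pres hdeg_le).
- by move=> s c c' _ _; exact: dual_class_linear.
- move=> w; exists (\col_t ((w : 'cV_m) (kvec t) 0)%:MP); first exact: dual_cocycle.
  exact: dual_class_cst.
- by move=> c _; exact: dual_class_eq0.
- by move=> j c _; exact: dual_class_deg.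
Qed.

End RegularityCanonical.

(** * Comparison of resolutions and uniqueness of the canonical module *)

Lemma dependent_choice (T : nat -> Type) (P : forall i, T i -> Prop)
    (Q : forall i, T i -> T i.+1 -> Prop) (x0 : T 0) :
  P 0 x0 -> (forall i x, P i x -> exists y, Q i x y /\ P i.+1 y) ->
  exists f : forall i, T i, f 0 = x0 /\ forall i, Q i (f i) (f i.+1).
Proof.
move=> P0 next.
pose step i (x : {x | P i x}) : {y | Q i (sval x) y /\ P i.+1 y} :=
  cid (next i (sval x) (svalP x)).
pose f := nat_rect (fun i => {x | P i x}) (exist _ x0 P0)
  (fun i x => exist _ (sval (step i x)) (proj2 (svalP (step i x)))).
exists (fun i => sval (f i)); split=> // i.
exact: (proj1 (svalP (step i (f i)))).
Qed.

Lemma row_factor (S : comNzRingType) p q r (M : 'M[S]_(p, r)) (D : 'M[S]_(q, r)) :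
  (forall a, exists w, row a M = w *m D) -> exists N, M = N *m D.
Proof.
move=> /fin_all_exists [w wE]; exists (\matrix_a w a).
by apply/row_matrixP => a; rewrite row_mul rowK.
Qed.

Section HomogeneousPart.
Variables (k : fieldType) (n : nat).
Implicit Types (p q : {mpoly k[n]}) (d e : int).

Definition hom_part d p : {mpoly k[n]} :=
  if d is Posz e then pihomog mdeg e p else 0.

Fact hom_part_linear d : linear (hom_part d).
Proof. by case: d => d c p q /=; [exact: linearP|rewrite scaler0 addr0]. Qed.
HB.instance Definition _ d := GRing.isLinear.Build k _ _ _ (hom_part d)
  (hom_part_linear d).

Lemma hom_part_deg d p : poly_deg d (hom_part d p).
Proof. by case: d => d //=; exact: pihomogP. Qed.

Lemma hom_part_id d e p : poly_deg e p -> hom_part d p = if d == e then p else 0.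
Proof.
case: (d =P e) => [<-|de]; first by case: d => d //=; exact: pihomog_dE.
case: d e de => d [] e de //=; last by move=> ->; rewrite raddf0.
by apply: pihomog_ne0; apply/eqP => ed; apply: de; rewrite ed.
Qed.

Lemma hom_partM d e p q : poly_deg e q ->
  hom_part (d + e) (p * q) = hom_part d p * q.
Proof.
move=> hq; have := pihomog_partitionE (leqnn (mmeasure mdeg p)).
move: (mmeasure mdeg p) => N pE; rewrite pE mulr_suml !raddf_sum mulr_suml.
apply: eq_bigr => i _; have hi : poly_deg (i : nat)%:Z (pihomog mdeg i p) by exact: pihomogP.
rewrite /= (hom_part_id _ (poly_degM hi hq)) (hom_part_id _ hi).
by rewrite (inj_eq (addIr e)); case: eqP; rewrite ?mul0r.
Qed.

End HomogeneousPart.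

Section Comparison.
Variables (k : fieldType) (A : gradedAlg k) (n : nat).
Variable pi : {lrmorphism {mpoly k[n]} -> A}.
Local Notation S := {mpoly k[n]}.
Local Notation aug e v := (augmentation_map (A := polyAlg k n) (M := A^o) pi e v).

Lemma augB r (e : 'I_r -> A^o) (v w : 'rV[S]_r) : aug e (v - w) = aug e v - aug e w.
Proof.
by rewrite /augmentation_map -sumrB; apply: eq_bigr => i _; rewrite !mxE raddfB scalerBl.
Qed.

Lemma diff_diff (F : free_complex S) (e : 'I_(frank F 0) -> A^o) i :
  resolves pi e -> fdiff F i.+1 *m fdiff F i = 0.
Proof.
move=> [_ _ _ _ ex]; apply/row_matrixP => a; rewrite row_mul row0.
by apply/ex; exists (delta_mx 0 a); rewrite rowE.
Qed.

Lemma aug_diff (F : free_complex S) (e : 'I_(frank F 0) -> A^o) (v : 'rV_(frank F 1)) :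
  resolves pi e -> aug e (v *m fdiff F 0) = 0.
Proof. by move=> [_ _ _ ex _]; apply/ex; exists v. Qed.

Section ChainMap.
Variables (F G : free_complex S).
Variables (eF : 'I_(frank F 0) -> A^o) (eG : 'I_(frank G 0) -> A^o).
Hypotheses (resF : resolves pi eF) (resG : resolves pi eG).

Lemma lift_aug : exists f : 'M[S]_(frank F 0, frank G 0),
  forall v, aug eG (v *m f) = aug eF v.
Proof.
have [_ _ surj _ _] := resG.
have /fin_all_exists [w wE] : forall a, exists w, eF a = aug eG w by move=> a; exact: surj.
exists (\matrix_a w a) => v; rewrite /augmentation_map.
transitivity (\sum_a \sum_b pi (v 0 a * w a 0 b) *: eG b).
  rewrite exchange_big; apply: eq_bigr => b _ /=.
  rewrite mxE raddf_sum scaler_suml; apply: eq_bigr => a _.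
  by rewrite mxE.
apply: eq_bigr => a _; rewrite wE /augmentation_map scaler_sumr.
by apply: eq_bigr => b _; rewrite rmorphM scalerA.
Qed.

Lemma lift_chain (f0 : 'M[S]_(frank F 0, frank G 0)) :
  (forall v, aug eG (v *m f0) = aug eF v) ->
  exists f : forall i, 'M[S]_(frank F i, frank G i),
    f 0 = f0 /\ forall i, fdiff F i *m f i = f i.+1 *m fdiff G i.
Proof.
move=> augf; have [_ _ _ ex0 ex] := resG.
apply: (@dependent_choice (fun i => 'M[S]_(frank F i, frank G i))
  (fun i f => forall a, exists w, row a (fdiff F i *m f) = w *m fdiff G i)
  (fun i f g => fdiff F i *m f = g *m fdiff G i)).
  move=> a; apply/ex0; rewrite row_mul augf.
  by rewrite rowE; exact: (aug_diff _ resF).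
move=> i f /row_factor [g gE]; exists g; split=> // a; apply/ex.
by rewrite -row_mul -mulmxA -gE mulmxA (diff_diff _ resF) mul0mx row0.
Qed.

(** Lifts obtained from exactness need not preserve degrees. Keeping the part of the right degree in
    each entry repairs this and respects commutation with the differentials, because those are
    homogeneous. *)
Definition hom_chain i (f : 'M[S]_(frank F i, frank G i)) : 'M[S]_(frank F i, frank G i) :=
  \matrix_(a, b) hom_part (fshift a - fshift b) (f a b).

Lemma hom_chain_diff i (f : 'M_(frank F i, frank G i)) (g : 'M_(frank F i.+1, frank G i.+1)) :
  fdiff F i *m f = g *m fdiff G i ->
  fdiff F i *m hom_chain f = hom_chain g *m fdiff G i.
Proof.
have [_ hF _ _ _] := resF; have [_ hG _ _ _] := resG.
move=> /matrixP fg; apply/matrixP => a b.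
have := congr1 (hom_part (fshift a - fshift b)) (fg a b).
rewrite !mxE !raddf_sum => E.
transitivity (\sum_j hom_part (fshift a - fshift b) (fdiff F i a j * f j b)).
  apply: eq_bigr => j _; rewrite mxE mulrC [X in _ = hom_part _ X]mulrC.
  rewrite -(hom_partM _ _ (hF i a j)); congr hom_part.
  by rewrite addrC addrA subrK.
rewrite E; apply: eq_bigr => j _ /=.
rewrite mxE -(hom_partM _ _ (hG i j b)); congr hom_part.
by rewrite addrA subrK.
Qed.

End ChainMap.

(** The factorization of [x 0] through the first differential starts the recursion. The conclusion
    is stated in positive homological degrees, where it is applied: [Ext^n] is compared with
    [n = n'.+1]. *)
Lemma null_homotopy (F : free_complex S) (eF : 'I_(frank F 0) -> A^o)
    (x : forall i, 'M[S]_(frank F i)) :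
  resolves pi eF ->
  (forall v, aug eF (v *m x 0) = 0) ->
  (forall i, fdiff F i *m x i = x i.+1 *m fdiff F i) ->
  exists h : forall i, 'M[S]_(frank F i, frank F i.+1),
    forall i, x i.+1 = h i.+1 *m fdiff F i.+1 + fdiff F i *m h i.
Proof.
move=> resF x0 xC; have [_ _ _ ex0 ex] := resF.
have [h0 h0E] : exists h0, x 0 = h0 *m fdiff F 0.
  by apply: row_factor => a; apply/ex0; rewrite rowE.
have [|i h /row_factor [g gE]|h [_ hE]] := @dependent_choice
  (fun i => 'M[S]_(frank F i, frank F i.+1))
  (fun i h => forall a, exists w,
     row a (x i.+1 - fdiff F i *m h) = w *m fdiff F i.+1)
  (fun i h g => x i.+1 - fdiff F i *m h = g *m fdiff F i.+1) h0.
- move=> a; apply/ex; rewrite -row_mul mulmxBl -mulmxA -h0E xC subrr row0 //.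
- exists g; split=> // a; apply/ex; rewrite -row_mul mulmxBl -mulmxA -gE.
  by rewrite mulmxBr mulmxA (diff_diff _ resF) mul0mx subr0 xC subrr row0.
by exists h => i; rewrite -hE subrK.
Qed.

Lemma chain_endo_homotopic (F : free_complex S) (eF : 'I_(frank F 0) -> A^o)
    (x : forall i, 'M[S]_(frank F i)) :
  resolves pi eF ->
  (forall v, aug eF (v *m x 0) = aug eF v) ->
  (forall i, fdiff F i *m x i = x i.+1 *m fdiff F i) ->
  exists h : forall i, 'M[S]_(frank F i, frank F i.+1),
    forall i, x i.+1 = 1%:M + h i.+1 *m fdiff F i.+1 + fdiff F i *m h i.
Proof.
move=> resF x0 xC.
have [v|i|h hE] := @null_homotopy F eF (fun i => x i - 1%:M) resF.
- by rewrite mulmxBr mulmx1 augB x0 subrr.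
- by rewrite mulmxBr mulmxBl xC mulmx1 mul1mx.
by exists h => i; rewrite -addrA -hE addrC subrK.
Qed.

End Comparison.

Section CanonicalUnique.
Variables (k : fieldType) (A : gradedAlg k) (m : nat) (H : hbasis A m).
Hypothesis gA : is_graded_algebra A.
Variables (n' : nat) (pi : {lrmorphism {mpoly k[n'.+1]} -> A}).
Hypothesis pi_pres : is_presentation pi.
Variable r : nat.
Hypothesis hdeg_le : forall i, (hdeg H i <= r)%N.
Local Notation n := n'.+1.
Local Notation S := {mpoly k[n]}.
Local Notation K := (kres H pi).
Local Notation eK := (@kres_aug k A m H n pi).
Local Notation dclass := (@dual_class k A m H n' pi).
Local Notation aug e v := (augmentation_map (A := polyAlg k n) (M := A^o) pi e v).

Section LiftToKoszul.
Variables (F : free_complex S) (e : 'I_(frank F 0) -> A^o).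
Hypothesis resF : resolves pi e.

Definition lift0 : 'M[S]_(frank F 0, frank K 0) :=
  \matrix_(a, t) (hco H (e a) 0 (kvec t))%:MP.

Lemma lift0_aug v : aug eK (v *m lift0) = aug e v.
Proof.
have piC c : pi (c%:MP) = c%:A by rewrite -[c%:MP]mulr1 mul_mpolyC linearZ /= rmorph1.
rewrite /augmentation_map.
transitivity (\sum_a \sum_t pi (v 0 a * lift0 a t) *: eK t).
  rewrite exchange_big; apply: eq_bigr => t _ /=.
  by rewrite mxE raddf_sum scaler_suml.
apply: eq_bigr => a _; rewrite [in RHS](hcoK H (e a)) scaler_sumr.
rewrite (reindex _ (onW_bij _ (kindex_bij m n))) /=; apply: eq_bigr => b _.
rewrite mxE kvecK (rmorphM pi) -scalerA /= piC /kres_aug kvecK; congr (_ *: _).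
by rewrite -[LHS]/(_ * _) -scalerAl mul1r.
Qed.

(** The lift in degree 0 is constant and already homogeneous, so passing to homogeneous parts does
    not disturb its compatibility with the augmentations. *)
Lemma lift0_hom : hom_chain lift0 = lift0.
Proof.
have [eD _ _ _ _] := resF; apply/matrixP => a t; rewrite !mxE.
have [->|c0] := eqVneq (hco H (e a) 0 (kvec t)) 0; first by rewrite mpolyC0 raddf0.
rewrite (hom_part_id _ (poly_degC _ _)) (iffLR (hadeg H _ _) (eD a) _ c0) /=.
by rewrite add0n subrr eqxx.
Qed.

Lemma lift_to_koszul : exists f : forall i, 'M[S]_(frank F i, frank K i),
  [/\ forall v, aug eK (v *m f 0) = aug e v,
      forall i, fdiff F i *m f i = f i.+1 *m fdiff K i
    & forall i a t, poly_deg (fshift a - fshift t) (f i a t)].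
Proof.
have resK := kres_resolves gA pi_pres hdeg_le.
have [f [f0 fC]] := lift_chain resF resK lift0_aug.
exists (fun i => hom_chain (f i)); split.
- by move=> v; rewrite f0 lift0_hom lift0_aug.
- by move=> i; apply: (hom_chain_diff resF resK).
- by move=> i a t; rewrite mxE; exact: hom_part_deg.
Qed.

End LiftToKoszul.

(** [is_canonical_module] only sends cochains of a given degree to classes of that degree; this
    supplies the converse. The components of [x] outside degree [j] have a sum whose image lies in
    degree [j] and in the span of the other degrees, hence is 0, and [th] is injective. *)
Lemma graded_reflect (V W : zmodType) (gV : int -> V -> Prop) (gW : int -> W -> Prop)
    (th : {additive V -> W}) (x : V) (s : seq int) (c : int -> V) j :
  is_grading gV -> is_grading gW -> injective th ->
  (forall d v, gV d v -> gW d (th v)) ->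
  (forall d, gV d (c d)) -> uniq s -> x = \sum_(d <- s) c d ->
  gW j (th x) -> gV j x.
Proof.
move=> hV hW th_inj thD cD us xE xj.
have js0 : \sum_(d <- rem j s) c d = 0.
  pose y := \sum_(d <- rem j s) c d; apply: th_inj; rewrite raddf0.
  have yj : gW j (th y).
    have [js|js] := boolP (j \in s).
      have -> : y = x - c j.
        by rewrite xE (perm_big _ (perm_to_rem js)) big_cons addrC addKr.
      by rewrite raddfB; apply: (gradingB hW) => //; apply: thD.
    by rewrite /y rem_id // -xE.
  pose f d := if d == j then th y else - th (c d).
  have jr : j \notin rem j s by rewrite mem_rem_uniq // !inE eqxx.
  have := @grading_direct _ _ hW (j :: rem j s) f.
  rewrite cons_uniq jr rem_uniq // big_cons /f eqxx => /(_ isT) D.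
  have := D _ _ j; rewrite eqxx inE eqxx; apply => //.
    move=> d; case: eqP => [->//|_]; rewrite -raddfN; apply: thD.
    by rewrite -sub0r; apply: (gradingB hV) => //; exact: (grading0 hV).
  rewrite big_seq (eq_bigr (fun d => - th (c d))) => [|d dr]; last first.
    by case: eqP => // dj; move: dr; rewrite dj (negPf jr).
  by rewrite -big_seq sumrN -raddf_sum subrr.
have [js|js] := boolP (j \in s).
  by rewrite xE (perm_big _ (perm_to_rem js)) big_cons js0 /= addr0.
by rewrite xE -(rem_id js) js0; exact: (grading0 hV).
Qed.

(** A functional is represented by a constant cochain on the Koszul resolution, pulled back along a
    homogeneous chain map [f] and sent to its class by [tau]. A chain map [g] in the other
    direction, with [f g] and [g f] homotopic to the identity, gives bijectivity. *)
Lemma canonical_unique (W : gradedMod A) : is_canonical_module pi W ->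
  exists th : {linear dual_graded H -> W},
    bijective th /\ forall d f, mdg d (th f) <-> mdg d f.
Proof.
case=> gW [F [e [tau]]] /= [resF tauL tauS tau0 tauD].
have resK := kres_resolves gA pi_pres hdeg_le.
have [f [augf fC fD]] := lift_to_koszul resF.
have [g0 augg] := lift_aug eK resF.
have [g [g0E gC]] := lift_chain resK resF augg.
have [|i|hF hFE] := @chain_endo_homotopic _ _ _ _ F e (fun i => f i *m g i) resF.
- by move=> v; rewrite mulmxA g0E augg augf.
- by rewrite mulmxA fC -!mulmxA gC.
have [|i|hK hKE] := @chain_endo_homotopic _ _ _ _ K eK (fun i => g i *m f i) resK.
- by move=> v; rewrite mulmxA augf g0E augg.
- by rewrite mulmxA gC -!mulmxA fC.
have Zf (c : 'cV[S]_(frank K n)) : fdiff F n *m (f n *m c) = 0.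
  by rewrite mulmxA fC -mulmxA [X in _ *m X](dual_cocycle c) mulmx0.
have tauD2 c c' : fdiff F n *m c = 0 -> fdiff F n *m c' = 0 -> tau (c + c') = tau c + tau c'.
  by move=> Zc Zc'; have := tauL 1 c c' Zc Zc'; rewrite scale1r rmorph1 scale1r.
pose T c := tau (f n *m c).
have TL s c c' : T (s *: c + c') = pi s *: T c + T c'.
  by rewrite /T mulmxDr -scalemxAr tauL.
have T0 c : dclass c = 0 -> T c = 0.
  move=> /(dual_class_eq0 pi_pres hdeg_le) [c' ->]; apply/tau0; first exact: Zf.
  by exists (f n' *m c'); rewrite !mulmxA fC.
have TE c c' : dclass c = dclass c' -> T c = T c'.
  move=> cc'; have := TL 1 (c - c') c'; rewrite scale1r subrK rmorph1 scale1r => ->.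
  rewrite T0 ?add0r // addrC -scaleN1r dual_class_linear rmorphN rmorph1 scaleN1r cc'.
  exact: addNr.
pose cst (w : dual_graded H) : 'cV[S]_(frank K n) := \col_t ((w : 'cV_m) (kvec t) 0)%:MP.
have cstK w : dclass (cst w) = w by exact: (dual_class_cst pi_pres hdeg_le).
pose th w := T (cst w).
have thL : linear th.
  move=> a w w'; have [s <-] := (proj1 pi_pres) a.
  by rewrite /th -TL; apply: TE; rewrite dual_class_linear !cstK.
pose thl : {linear dual_graded H -> W} := HB.pack th (GRing.isLinear.Build _ _ _ _ th thL).
have th_inj : injective th.
  apply: (raddf_inj (f := thl)) => w /= thw0.
  have /tau0 : tau (f n *m cst w) = 0 by [].
  case; first exact: Zf.
  move=> d fd; rewrite -[w]cstK; apply/(dual_class_eq0 pi_pres hdeg_le).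
  (* Multiplying [fd] by [g n] and replacing [g n *m f n] by the identity plus homotopy terms
     exhibits [cst w] as a coboundary; the term through degree [n.+1] is 0 since every top cochain
     is a cocycle. *)
  exists (g n' *m d - hK n' *m cst w).
  have := congr1 (mulmx (g n)) fd; rewrite mulmxA hKE !mulmxDl mul1mx.
  rewrite -(mulmxA (hK n)) [fdiff K n *m _](dual_cocycle (cst w)) mulmx0 addr0.
  move=> E; rewrite mulmxBr mulmxA [fdiff K n' *m g n']gC -mulmxA -E.
  by rewrite -mulmxA addrK.
have th_surj w : exists x, th x = w.
  (* The pullback of [g n *m d] along [f] differs from the cocycle [d] by the coboundary of
     [hF n' *m d]. *)
  have [d Zd <-] := tauS w; exists (dclass (g n *m d)).
  rewrite /th (TE _ (g n *m d)) ?cstK // /T mulmxA hFE !mulmxDl mul1mx.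
  rewrite -(mulmxA (hF n)) [fdiff F n *m d]Zd mulmx0 addr0.
  have ZB (c : 'cV[S]_(frank F n')) : fdiff F n *m (fdiff F n' *m c) = 0.
    by rewrite mulmxA (diff_diff _ resF) mul0mx.
  rewrite tauD2 //; last by rewrite -mulmxA ZB.
  rewrite [X in _ + X](_ : _ = 0) ?addr0 //; apply/tau0; first by rewrite /ext_cocycle -mulmxA ZB.
  by exists (hF n' *m d); rewrite mulmxA.
have th_deg d w : mdg d w -> mdg d (th w).
  move=> wd; have [c cw cd] := dual_class_surj pi_pres hdeg_le wd.
  rewrite /th (TE _ c) ?cstK //; apply: tauD; first exact: Zf.
  move=> a; rewrite mxE; apply: poly_deg_sum => t _.
  rewrite (_ : _ + _ = (fshift a - fshift t) + (fshift t + (d - n%:Z))); last first.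
    by rewrite [RHS]addrA subrK.
  by apply: poly_degM; [exact: fD|exact: cd].
exists thl; split.
  exists (fun w => sval (cid (th_surj w))) => x; last exact: (svalP (cid (th_surj x))).
  by apply: th_inj; exact: (svalP (cid (th_surj _))).
move=> d w; split; last exact: th_deg.
pose c j : 'cV[k]_m := \col_i (if - (hdeg H i)%:Z == j then (w : 'cV_m) i 0 else 0).
apply: (@graded_reflect _ _ _ _ thl w (undup (codom (fun i => - (hdeg H i)%:Z))) c d
  (gmod_grading (dual_is_graded H gA)) (gmod_grading gW)) => //.
- by move=> j i; rewrite mxE; case: ifP => [/eqP -> //|_]; rewrite eqxx.
- exact: undup_uniq.
- apply/colP => i; rewrite summxE (bigD1_seq (- (hdeg H i)%:Z)) ?undup_uniq //=; last first.
    by rewrite mem_undup codom_f.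
  rewrite mxE eqxx big1 ?addr0 // => j /negPf ji.
  by rewrite mxE eq_sym ji.
Qed.

End CanonicalUnique.

(** * A criterion for non-Koszulness *)

Lemma sum_rotate (V : nmodType) (I J L : finType) (f : I -> J -> L -> V) :
  \sum_i \sum_j \sum_l f i j l = \sum_l \sum_i \sum_j f i j l.
Proof.
rewrite [RHS]exchange_big; apply: eq_bigr => i _ /=.
exact: exchange_big.
Qed.

(* If the quadratic algebra with multiplication table [rel] is Koszul, the
   linear strand [V (x) K_3 -> R_2 (x) K_2] of its Priddy complex is onto.  The
   functional [g] vanishes on its image by [certificate], but not at
   [m (x) (\sum_j u_j (x) v_j)].  Only the values of [eps], [tau], [rhot] matter, so
   that the criterion also applies to algebras having such a quadratic algebra
   as a retract. *)
Section NonKoszulCriterion.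
Variables (k : fieldType) (A : gradedAlg k) (n q : nat).
Variables (v u : 'I_n -> A) (m : A).
Variables (tau : 'I_n -> {additive A -> k}) (rhot : 'I_q -> {additive A -> k}).
Variables (rel : 'I_q -> 'I_n -> 'I_n -> k) (g : 'I_q -> 'I_n -> 'I_n -> k).
Variables (c1 c2 : 'I_q -> 'I_n -> 'I_n -> k).

Hypothesis tauM : forall (eps : {lrmorphism A -> k^o}) j a b, is_residue_map eps ->
  tau j (a * b) = (eps a : k) * tau j b + tau j a * eps b.
Hypothesis rhotM : forall (eps : {lrmorphism A -> k^o}) t a b, is_residue_map eps ->
  rhot t (a * b) = (eps a : k) * rhot t b + rhot t a * eps b +
    \sum_i \sum_j rel t i j * (tau i a * tau j b).
Hypothesis rhot1 : forall t a, adeg 1 a -> rhot t a = 0.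
Hypothesis v_deg : forall j, adeg 1 (v j).
Hypothesis u_deg : forall j, adeg 1 (u j).
Hypothesis m_deg : adeg 2 m.
Hypothesis tau_v : forall i j, tau i (v j) = (i == j)%:R.
Hypothesis tau_m : forall j, tau j m = 0.
Hypothesis uv0 : \sum_j u j * v j = 0.
Hypothesis mu0 : forall j, m * u j = 0.
Hypothesis certificate : forall i j x y,
  \sum_t rel t i j * g t x y =
  \sum_t c1 t i y * rel t j x + \sum_t c2 t i j * rel t x y.
Hypothesis nonzero :
  \sum_t rhot t m * (\sum_x \sum_y tau x (u y) * g t x y) != 0.

Lemma not_koszul : ~ koszul A.
Proof.
case=> eps [F [e [res [_ degD surj ex0 ex] lin]]].
have D1 i (a : 'I_(frank F i.+1)) b : adeg 1 (fdiff F i a b).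
  have := degD i a b; rewrite !lin (_ : _ - _ = 1) //.
  by rewrite -addn1 PoszD addrC addKr.
have eps1 a : adeg 1 a -> eps a = 0 :> k by move/res; apply.
have epsD i (a : 'I_(frank F i.+1)) b : eps (fdiff F i a b) = 0 :> k by apply: eps1.
have epsm : eps m = 0 :> k by apply: (res 2).
have rhoD t (a b : A) : adeg 1 b -> (eps a : k) * rhot t b + rhot t a * eps b = 0.
  by move=> b1; rewrite rhot1 // [eps b]eps1 // !mulr0 addr0.
have DD i : fdiff F i.+1 *m fdiff F i = 0.
  apply/row_matrixP => a; rewrite row_mul row0.
  by apply/ex; exists (delta_mx 0 a); rewrite rowE.
have tauF r (w : 'rV[A]_r) (D : 'I_r -> A) i :
    (forall b, adeg 1 (D b)) ->
    tau i (\sum_b w 0 b * D b) = \sum_b (eps (w 0 b) : k) * tau i (D b).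
  move=> hD; rewrite raddf_sum; apply: eq_bigr => b _ /=.
  by rewrite (tauM _ _ _ res) [eps (D b)]eps1 // mulr0 addr0.
have rhoF r (w D : 'I_r -> A) t : (forall b, adeg 1 (D b)) ->
    rhot t (\sum_b w b * D b) =
    \sum_b \sum_i \sum_j rel t i j * (tau i (w b) * tau j (D b)).
  move=> hD; rewrite raddf_sum; apply: eq_bigr => b _ /=.
  by rewrite (rhotM _ _ _ res) rhoD // add0r.
(* [f0], [f1 j] and [f2] lift [1], [v_j] and the sum of the [u_j] tensor [v_j] through the first
   three terms. Then [m *: f2] is a cycle, because [m] kills each [u_j], hence a boundary of some
   [w]. *)
have [f0 f0E] := surj 1.
have f1P j : exists w, v j *: f0 = w *m fdiff F 0.
  apply/ex0; rewrite /augmentation_map big1 // => c _.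
  by rewrite mxE rmorphM /= [eps (v j)]eps1 // mul0r scale0r.
have [f1 f1E] := fin_all_exists f1P.
have [f2 f2E] : exists w, \sum_j u j *: f1 j = w *m fdiff F 1.
  apply/ex; rewrite mulmx_suml.
  rewrite (eq_bigr (fun j => (u j * v j) *: f0)) => [|j _].
    by rewrite -scaler_suml uv0 scale0r.
  by rewrite -scalemxAl -f1E scalerA.
have [w wE] : exists w, m *: f2 = w *m fdiff F 2.
  apply/ex; rewrite -scalemxAl -f2E scaler_sumr big1 // => j _.
  by rewrite scalerA mu0 scale0r.
(* [s1], [s2], [s3] are the tensors attached to a basis vector by composing the linear coefficients
   of the differentials down to [F_0]. By [E1] and [E2] the constant parts of [f1 j] and [f2]
   recover [v_j] and the sum of the [u_j] tensor [v_j]. *)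
pose s1 b l : k := \sum_c tau l (fdiff F 0 b c) * e c.
pose s2 b x y : k := \sum_c tau x (fdiff F 1 b c) * s1 c y.
pose s3 b j x y : k := \sum_c tau j (fdiff F 2 b c) * s2 c x y.
have E1 j l : \sum_b (eps (f1 j 0 b) : k) * s1 b l = (l == j)%:R.
  transitivity (\sum_c (\sum_b (eps (f1 j 0 b) : k) * tau l (fdiff F 0 b c)) * e c).
    under [RHS]eq_bigr => c _ do rewrite mulr_suml.
    rewrite exchange_big; apply: eq_bigr => b _; rewrite mulr_sumr.
    by apply: eq_bigr => c _; rewrite mulrA.
  have := f0E; rewrite /augmentation_map => /(congr1 (fun x : k => (l == j)%:R * x)).
  rewrite mulr1 => ->; rewrite mulr_sumr; apply: eq_bigr => c _.
  rewrite -tauF // -[_ *: _]/(_ * _) mulrA; congr (_ * _).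
  have /rowP /(_ c) := f1E j; rewrite !mxE => <-.
  by rewrite (tauM _ _ _ res) tau_v [eps (v j)]eps1 // mul0r add0r.
have E2 x y : \sum_b (eps (f2 0 b) : k) * s2 b x y = tau x (u y).
  transitivity (\sum_c (\sum_b (eps (f2 0 b) : k) * tau x (fdiff F 1 b c)) * s1 c y).
    under [RHS]eq_bigr => c _ do rewrite mulr_suml.
    rewrite exchange_big; apply: eq_bigr => b _; rewrite mulr_sumr.
    by apply: eq_bigr => c _; rewrite mulrA.
  transitivity (\sum_c \sum_j tau x (u j) * ((eps (f1 j 0 c) : k) * s1 c y)).
    apply: eq_bigr => c _; rewrite -tauF //.
    have /rowP /(_ c) := f2E; rewrite summxE [in RHS]mxE => <-.
    rewrite raddf_sum mulr_suml; apply: eq_bigr => j _ /=.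
    by rewrite mxE (tauM _ _ _ res) [eps (u j)]eps1 // mul0r add0r mulrA.
  rewrite exchange_big (bigD1 y) //= [X in _ + X]big1 ?addr0 => [|j jy].
    by rewrite -mulr_sumr E1 eqxx mulr1.
  by rewrite -mulr_sumr E1 eq_sym (negPf jy) mulr0.
(* The quadratic coordinates of two consecutive differentials compose to 0. Hence [s2 b] lies in the
   kernel of multiplication, and [s3 b] does so in its first two and in its last two factors
   ([rel3], [rel3']). *)
have rel2 b t : \sum_x \sum_y rel t x y * s2 b x y = 0.
  transitivity (\sum_d rhot t (\sum_c fdiff F 1 b c * fdiff F 0 c d) * e d).
    symmetry; under eq_bigr => d _ do rewrite rhoF // mulr_suml.
    under eq_bigr => d _ do under eq_bigr => c _ do rewrite mulr_suml.
    under eq_bigr => d _ do under eq_bigr => c _ do under eq_bigr => x _ do rewrite mulr_suml.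
    rewrite sum_rotate; apply: eq_bigr => x _; rewrite sum_rotate.
    apply: eq_bigr => y _; rewrite exchange_big mulr_sumr.
    apply: eq_bigr => c _; rewrite /s1 !mulr_sumr; apply: eq_bigr => d _.
    by rewrite !mulrA.
  rewrite big1 // => d _; have /matrixP /(_ b d) := DD 0; rewrite !mxE => ->.
  by rewrite raddf0 mul0r.
have rel3 b t y : \sum_j \sum_x rel t j x * s3 b j x y = 0.
  transitivity (\sum_d rhot t (\sum_c fdiff F 2 b c * fdiff F 1 c d) * s1 d y).
    symmetry; under eq_bigr => d _ do rewrite rhoF // mulr_suml.
    under eq_bigr => d _ do under eq_bigr => c _ do rewrite mulr_suml.
    under eq_bigr => d _ do under eq_bigr => c _ do under eq_bigr => j _ do rewrite mulr_suml.
    rewrite sum_rotate; apply: eq_bigr => j _; rewrite sum_rotate.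
    apply: eq_bigr => x _; rewrite exchange_big mulr_sumr.
    apply: eq_bigr => c _; rewrite /s2 !mulr_sumr; apply: eq_bigr => d _.
    by rewrite !mulrA.
  rewrite big1 // => d _; have /matrixP /(_ b d) := DD 1%N; rewrite !mxE => ->.
  by rewrite raddf0 mul0r.
have rel3' b t j : \sum_x \sum_y rel t x y * s3 b j x y = 0.
  transitivity (\sum_c tau j (fdiff F 2 b c) * (\sum_x \sum_y rel t x y * s2 c x y)).
    symmetry; under eq_bigr => c _ do rewrite mulr_sumr.
    rewrite exchange_big; apply: eq_bigr => x _.
    under eq_bigr => c _ do rewrite mulr_sumr.
    rewrite exchange_big; apply: eq_bigr => y _.
    by rewrite /s3 mulr_sumr; apply: eq_bigr => c _; rewrite mulrCA.
  by rewrite big1 // => c _; rewrite rel2 mulr0.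
(* The two sums of the certificate contain one relation each: that of [c1] sits in the first two
   slots of [s3], that of [c2] in the last two. *)
have cert3 b i :
    \sum_j \sum_x \sum_y (\sum_t rel t i j * g t x y) * s3 b j x y = 0.
  under eq_bigr => j _ do under eq_bigr => x _ do under eq_bigr => y _ do
    rewrite certificate mulrDl.
  under eq_bigr => j _ do under eq_bigr => x _ do rewrite big_split /=.
  under eq_bigr => j _ do rewrite big_split /=.
  rewrite big_split /= [X in X + _](_ : _ = 0) ?add0r.
    rewrite big1 // => j _.
    transitivity (\sum_t c2 t i j * (\sum_x \sum_y rel t x y * s3 b j x y)).
      under eq_bigr => x _ do under eq_bigr => y _ do rewrite mulr_suml.
      under eq_bigr => x _ do rewrite exchange_big.
      rewrite exchange_big; apply: eq_bigr => t _; rewrite mulr_sumr.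
      by apply: eq_bigr => x _; rewrite mulr_sumr; apply: eq_bigr => y _; rewrite /= mulrA.
    by rewrite big1 // => t _; rewrite rel3' mulr0.
  transitivity (\sum_y \sum_t c1 t i y * (\sum_j \sum_x rel t j x * s3 b j x y)).
    under eq_bigr => j _ do rewrite exchange_big.
    rewrite exchange_big; apply: eq_bigr => y _.
    under eq_bigr => j _ do under eq_bigr => x _ do rewrite mulr_suml.
    under eq_bigr => j _ do rewrite exchange_big.
    rewrite exchange_big; apply: eq_bigr => t _; rewrite mulr_sumr.
    by apply: eq_bigr => x _; rewrite mulr_sumr; apply: eq_bigr => z _; rewrite /= mulrA.
  by rewrite big1 // => y _; rewrite big1 // => t _; rewrite rel3 mulr0.
(* The quadratic coordinates of [m *: f2 = w *m fdiff F 2] convert the pairing with [g] into a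
   combination, weighted by the linear parts of [w], of the expressions killed by [cert3]. *)
move/eqP: nonzero; apply.
have Ew t b : rhot t m * eps (f2 0 b) =
    \sum_a \sum_i \sum_j rel t i j * (tau i (w 0 a) * tau j (fdiff F 2 a b)).
  rewrite -rhoF //; have /rowP /(_ b) := wE; rewrite !mxE => <-.
  rewrite (rhotM _ _ _ res) epsm mul0r add0r big1 ?addr0 // => i _.
  by rewrite big1 // => j _; rewrite tau_m mul0r mulr0.
transitivity (\sum_a \sum_i tau i (w 0 a) *
  (\sum_j \sum_x \sum_y (\sum_t rel t i j * g t x y) * s3 a j x y)); last first.
  by rewrite big1 // => a _; rewrite big1 // => i _; rewrite cert3 mulr0.
transitivity (\sum_t \sum_b \sum_a \sum_i \sum_j \sum_x \sum_y
    tau i (w 0 a) * (rel t i j * g t x y * (tau j (fdiff F 2 a b) * s2 b x y))).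
  apply: eq_bigr => t _; rewrite mulr_sumr.
  transitivity (\sum_b \sum_x \sum_y (rhot t m * eps (f2 0 b)) * (s2 b x y * g t x y)).
    rewrite exchange_big; apply: eq_bigr => x _ /=; rewrite mulr_sumr exchange_big.
    apply: eq_bigr => y _ /=; rewrite -E2 mulr_suml mulr_sumr.
    by apply: eq_bigr => b _; rewrite !mulrA.
  apply: eq_bigr => b _; rewrite Ew.
  under eq_bigr => x _ do under eq_bigr => y _ do rewrite mulr_suml.
  rewrite sum_rotate; apply: eq_bigr => a _.
  under eq_bigr => x _ do under eq_bigr => y _ do rewrite mulr_suml.
  rewrite sum_rotate; apply: eq_bigr => i _.
  under eq_bigr => x _ do under eq_bigr => y _ do rewrite mulr_suml.
  rewrite sum_rotate; apply: eq_bigr => j _.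
  by apply: eq_bigr => x _; apply: eq_bigr => y _; ring.
rewrite sum_rotate; apply: eq_bigr => a _; rewrite sum_rotate.
apply: eq_bigr => i _; rewrite mulr_sumr sum_rotate; apply: eq_bigr => j _.
rewrite mulr_sumr sum_rotate; apply: eq_bigr => x _.
rewrite mulr_sumr sum_rotate; apply: eq_bigr => y _.
rewrite mulr_suml mulr_sumr; apply: eq_bigr => t _.
by rewrite /s3 !mulr_sumr.
Qed.

End NonKoszulCriterion.

Definition o0 : 'I_4 := @Ordinal 4 0 isT.
Definition o1 : 'I_4 := @Ordinal 4 1 isT.
Definition o2 : 'I_4 := @Ordinal 4 2 isT.
Definition o3 : 'I_4 := @Ordinal 4 3 isT.

Lemma ord4_ind (P : 'I_4 -> Prop) : P o0 -> P o1 -> P o2 -> P o3 -> forall j, P j.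
Proof.
move=> P0 P1 P2 P3 [[|[|[|[|//]]]] lt].
- by rewrite (_ : Ordinal lt = o0) //; apply: val_inj.
- by rewrite (_ : Ordinal lt = o1) //; apply: val_inj.
- by rewrite (_ : Ordinal lt = o2) //; apply: val_inj.
- by rewrite (_ : Ordinal lt = o3) //; apply: val_inj.
Qed.

Lemma sum4 (V : nmodType) (F : 'I_4 -> V) :
  \sum_t F t = F o0 + F o1 + F o2 + F o3.
Proof.
rewrite !big_ord_recl big_ord0 addr0 !addrA.
by congr (F _ + F _ + F _ + F _); apply: val_inj.
Qed.

(** * The algebra [S/I] *)

Definition table := seq (seq (seq int)).
Definition entry (T : table) (t i j : nat) : int :=
  nth 0 (nth [::] (nth [::] T t) i) j.

(* [rel_table]: coefficients of the products of the variables [u, x, y, z] on the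
   basis [xy, xz, yz, z^2] of the quadratic part. *)
Definition rel_table : table :=
  [:: [:: [:: 1; 0; 0; -1]; [:: 0; -1; 1; 0]; [:: 0; 1; 0; 0]; [:: -1; 0; 0; 0]];
      [:: [:: 0; 0; -1; 0]; [:: 0; 0; 0; 1]; [:: -1; 0; 0; 0]; [:: 0; 1; 0; 0]];
      [:: [:: -1; 0; 0; 1]; [:: 0; 0; 0; 0]; [:: 0; 0; 0; 1]; [:: 1; 0; 1; 0]];
      [:: [:: 0; 0; 0; 0]; [:: 0; 0; 0; 0]; [:: 0; 0; -1; 0]; [:: 0; 0; 0; 1]]]%Z.

(* With [c1_table] and [c2_table], a witness for [not_koszul], found by solving the
   linear system of its certificate. *)
Definition g_table : table :=
  [:: [:: [:: 0; 0; 0; 0]; [:: 0; 0; 0; 1]; [:: 0; 0; 0; -1]; [:: 0; 0; 0; 0]];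
      [:: [:: 0; 0; 0; 0]; [:: 0; 1; -1; 0]; [:: 0; -1; 1; 0]; [:: 0; 0; 0; 0]];
      [:: [:: 0; 0; -1; 0]; [:: 0; 1; -1; 1]; [:: 0; -1; 0; -2]; [:: 0; 0; 0; 0]];
      [:: [:: -1; 0; 0; 1]; [:: 0; 1; -1; 1]; [:: -1; -2; 2; 0]; [:: 0; 0; 0; 0]]]%Z.

Definition c1_table : table :=
  [:: [:: [:: 0; 0; 0; 0]; [:: 0; 0; 0; 1]; [:: 0; 0; 0; -1]; [:: 0; -1; 1; 0]];
      [:: [:: 0; 0; 0; 0]; [:: 0; 0; 0; 0]; [:: 0; 0; 0; 0]; [:: 0; 0; 0; 0]];
      [:: [:: 0; 0; -1; 0]; [:: 0; 0; 0; 1]; [:: 1; 0; 0; -2]; [:: 0; -1; 2; 0]];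
      [:: [:: 0; 0; 1; 1]; [:: 0; 0; 1; 1]; [:: -1; -1; 0; 0]; [:: -1; -1; 0; 0]]]%Z.

Definition c2_table : table :=
  [:: [:: [:: 1; 0; 1; -1]; [:: 0; 0; 0; -1]; [:: 1; 0; 1; -1]; [:: -1; 0; -2; -1]];
      [:: [:: 0; 0; 0; 0]; [:: 0; 0; 0; 0]; [:: 0; 0; 0; 1]; [:: 0; 0; 1; 1]];
      [:: [:: 1; 0; 1; -1]; [:: 0; 0; 0; -1]; [:: 0; 0; 0; 0]; [:: -1; 0; -2; 0]];
      [:: [:: 0; 0; 0; -1]; [:: 0; 0; -1; -1]; [:: 1; 0; 2; 0]; [:: 0; 0; 0; 0]]]%Z.

(** All 256 identities are checked once over the integers by evaluation, and then mapped to an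
    arbitrary field. *)
Lemma certificate_int (i j x y : 'I_4) :
  \sum_(t < 4) entry rel_table t i j * entry g_table t x y =
  \sum_(t < 4) entry c1_table t i y * entry rel_table t j x +
  \sum_(t < 4) entry c2_table t i j * entry rel_table t x y.
Proof.
rewrite !sum4 /=; move: i j x y.
have check : all (fun i => all (fun j => all (fun x => all (fun y =>
    entry rel_table 0 i j * entry g_table 0 x y + entry rel_table 1 i j * entry g_table 1 x y +
    entry rel_table 2 i j * entry g_table 2 x y + entry rel_table 3 i j * entry g_table 3 x y ==
    (entry c1_table 0 i y * entry rel_table 0 j x + entry c1_table 1 i y * entry rel_table 1 j x +
     entry c1_table 2 i y * entry rel_table 2 j x + entry c1_table 3 i y * entry rel_table 3 j x) +
    (entry c2_table 0 i j * entry rel_table 0 x y + entry c2_table 1 i j * entry rel_table 1 x y +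
     entry c2_table 2 i j * entry rel_table 2 x y + entry c2_table 3 i j * entry rel_table 3 x y))
    (iota 0 4)) (iota 0 4)) (iota 0 4)) (iota 0 4) by vm_compute.
have mem4 (l : 'I_4) : (l : nat) \in iota 0 4 by rewrite mem_iota /=.
move=> i j x y.
by move/allP: check => /(_ _ (mem4 i)) /allP /(_ _ (mem4 j)) /allP /(_ _ (mem4 x)) /allP
  /(_ _ (mem4 y)) /eqP.
Qed.

Definition rel (k : pzRingType) (t i j : 'I_4) : k := (entry rel_table t i j)%:~R.

Lemma rel_sym (k : pzRingType) (t i j : 'I_4) : rel k t i j = rel k t j i.
Proof.
by rewrite /rel; congr (_%:~R); elim/ord4_ind: t; elim/ord4_ind: i; elim/ord4_ind: j.
Qed.

Definition qmonomial (B : comNzRingType) (v : 'I_4 -> B) (t : 'I_4) : B :=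
  nth 0 [:: v o1 * v o2; v o1 * v o3; v o2 * v o3; v o3 * v o3] t.

Section Products.
Variables (B : comNzRingType) (v : 'I_4 -> B).
Let u := v o0.
Let x := v o1.
Let y := v o2.
Let z := v o3.
Hypotheses (g0 : x ^+ 2 + y * z + u ^+ 2 = 0) (g1 : x * u = 0) (g2 : x ^+ 2 + x * y = 0)
  (g3 : x * z + y * u = 0) (g4 : z * u + u ^+ 2 = 0) (g5 : y ^+ 2 + z ^+ 2 = 0).
Local Notation m := (qmonomial v).

Lemma mul_vars i j : v i * v j = \sum_t rel B t i j * m t.
Proof.
have lc (a b e : B) : a - b = e -> e = 0 -> a = b.
  by move=> abe e0; apply/eqP; rewrite -subr_eq0 abe e0.
have uu : u * u = x * y - y * z.
  by apply: (@lc _ _ (x ^+ 2 + y * z + u ^+ 2 - (x ^+ 2 + x * y))); [ring|rewrite g0 g2 subr0].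
have ux : u * x = 0 by rewrite mulrC.
have uy : u * y = - (x * z).
  by apply: (@lc _ _ (x * z + y * u)) => //; ring.
have uz : u * z = y * z - x * y.
  apply: (@lc _ _ (z * u + u ^+ 2 - (x ^+ 2 + y * z + u ^+ 2 - (x ^+ 2 + x * y)))); first by ring.
  by rewrite g0 g2 g4 !subr0.
have xx : x * x = - (x * y) by apply: (@lc _ _ (x ^+ 2 + x * y)) => //; ring.
have yy : y * y = - (z * z) by apply: (@lc _ _ (y ^+ 2 + z ^+ 2)) => //; ring.
have yx : y * x = x * y by exact: mulrC.
have zx : z * x = x * z by exact: mulrC.
have zy : z * y = y * z by exact: mulrC.
have [xu yu zu] : [/\ x * u = 0, y * u = - (x * z) & z * u = y * z - x * y].
  by split; rewrite mulrC.
rewrite sum4 /rel /qmonomial; elim/ord4_ind: i; elim/ord4_ind: j => /=;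
  rewrite -/u -/x -/y -/z ?uu ?ux ?uy ?uz ?xx ?yy ?yx ?zx ?zy ?xu ?yu ?zu /entry /=
    ?NegzE ?mulrNz; ring.
Qed.

Lemma mul_var_qmonomial j t : v j * m t = 0.
Proof.
(* The arguments of [comb] below are linear forms, the cofactors that write each cubic monomial as
   an explicit combination of the six generators. *)
have comb c0 c1 c2 c3 c4 c5 : c0 * (x ^+ 2 + y * z + u ^+ 2) + c1 * (x * u) +
    c2 * (x ^+ 2 + x * y) + c3 * (x * z + y * u) + c4 * (z * u + u ^+ 2) +
    c5 * (y ^+ 2 + z ^+ 2) = 0.
  by rewrite g0 g1 g2 g3 g4 g5 !mulr0 !addr0.
have uxy : u * (x * y) = 0.
  by rewrite -(comb (0) (y) (0) (0) (0) (0)); ring.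
have uxz : u * (x * z) = 0.
  by rewrite -(comb (0) (z) (0) (0) (0) (0)); ring.
have uyz : u * (y * z) = 0.
  by rewrite -(comb (0) (- u) (0) (- u) (y + x) (0)); ring.
have uzz : u * (z * z) = 0.
  by rewrite -(comb (0) (- x) (z + u) (- y - x) (0) (u)); ring.
have xxy : x * (x * y) = 0.
  by rewrite -(comb (- x) (u - x) (z + u + x) (- x) (0) (0)); ring.
have xxz : x * (x * z) = 0.
  by rewrite -(comb (0) (x) (- u) (x) (0) (0)); ring.
have xyy : x * (y * y) = 0.
  by rewrite -(comb (x) (- u + x) (y - z - u - x) (x) (0) (0)); ring.
have xyz : x * (y * z) = 0.
  by rewrite -(comb (0) (- x) (z + u) (- x) (0) (0)); ring.
have xzz : x * (z * z) = 0.
  by rewrite -(comb (- x) (u - x) (- y + z + u + x) (- x) (0) (x)); ring.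
have yyz : y * (y * z) = 0.
  by rewrite -(comb (y + x) (x - u *+ 2) (- z - u - x) (x - u) (x) (0)); ring.
have yzz : y * (z * z) = 0.
  by rewrite -(comb (z + u) (- x *+ 2 + u) (u) (- x + u) (- u - y - x) (0)); ring.
have zzz : z * (z * z) = 0.
  by rewrite -(comb (- y - x) (- x + u *+ 2) (z + u + x) (- x + u) (- x) (z)); ring.
have yxy : y * (x * y) = 0 by rewrite mulrCA.
have yxz : y * (x * z) = 0 by rewrite mulrCA.
have zxy : z * (x * y) = 0 by rewrite mulrC -mulrA.
have zxz : z * (x * z) = 0 by rewrite mulrCA.
have zyz : z * (y * z) = 0 by rewrite mulrCA.
by rewrite /qmonomial; elim/ord4_ind: j; elim/ord4_ind: t.
Qed.

End Products.

(** * Normal forms modulo [I]: nine monomials remain independent *)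

Section ConcreteNormalForm.
Variable k : fieldType.
Local Notation S := {mpoly k[4]}.
Local Notation N := (1 + (4 + 4))%N.

Definition lin_part (j : 'I_4) : 'rV[k]_4 := delta_mx 0 j.
Definition quad_part (j : 'I_4) : 'M[k]_4 := \matrix_(i, t) rel k t i j.

(** Multiplication by [x_j] as dictated by [rel_table] on the blocks of degrees 0, 1, 2, with degree
    3 equal to 0. The matrices commute because the table is symmetric; so polynomials act on [k^9]
    before anything is known of [S/I]. *)
Definition shift_mx (j : 'I_4) : 'M[k]_N :=
  block_mx 0 (row_mx (lin_part j) 0) 0 (block_mx 0 (quad_part j) 0 0).

Lemma shift_mxM i j : shift_mx i *m shift_mx j =
  block_mx 0 (row_mx 0 (lin_part i *m quad_part j)) 0 0.
Proof.
rewrite /shift_mx mulmx_block mulmx_block mul_row_block.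
by rewrite !(mul0mx, mulmx0, add0r, addr0, block_mx0, row_mx0).
Qed.

Lemma shift_mxC i j : shift_mx i *m shift_mx j = shift_mx j *m shift_mx i.
Proof.
rewrite !shift_mxM; congr (block_mx _ (row_mx _ _) _ _); apply/rowP => t.
by rewrite /lin_part -!rowE !mxE rel_sym.
Qed.

Lemma shift_mx_nil j : shift_mx j ^+ 3 = 0.
Proof.
rewrite !exprS expr0 mulr1 -[_ * (_ * _)]/(shift_mx j *m (shift_mx j *m shift_mx j)).
rewrite shift_mxM /shift_mx mulmx_block.
by rewrite !(mul0mx, mulmx0, add0r, addr0, block_mx0, row_mx0).
Qed.

Definition one_vec : 'rV[k]_N := row_mx 1%:M 0.

(** The polynomial, evaluated at the matrices [shift_mx], is applied to the vector of [1]. Only the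
    four properties leave this opaque proof, so later steps never meet the division algorithm. *)
Lemma nf_spec : {f : S -> 'rV[k]_N | [/\ zmod_morphism f,
  forall j p, f ('X_j * p) = f p *m shift_mx j, forall c, f c%:MP = c *: one_vec &
  forall c p, f (c *: p) = c *: f p]}.
Proof.
exists (fun p => diag_eval shift_mx 3 (p *: map_mx (@mpolyC 4 k) one_vec)).
split=> [p q|j p|c|c p].
- by rewrite scalerBl raddfB.
- by rewrite -scalerA (diag_evalX shift_mxC shift_mx_nil).
- by rewrite (diag_evalZ shift_mx_nil) diag_evalC.
- by rewrite -mul_mpolyC -scalerA (diag_evalZ shift_mx_nil).
Qed.

(* Coordinates of the class of [p] in [S/I]. *)
Definition nf : S -> 'rV[k]_N := sval nf_spec.

Fact nf_additive : zmod_morphism nf.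
Proof. by have [] := svalP nf_spec. Qed.
HB.instance Definition _ := GRing.isZmodMorphism.Build S 'rV[k]_N nf nf_additive.

Lemma nfX j p : nf ('X_j * p) = nf p *m shift_mx j.
Proof. by have [_ + _ _] := svalP nf_spec; apply. Qed.

Lemma nfC c : nf c%:MP = c *: one_vec.
Proof. by have [_ _ + _] := svalP nf_spec; apply. Qed.

Lemma nfZ c p : nf (c *: p) = c *: nf p.
Proof. by have [_ _ _ +] := svalP nf_spec; apply. Qed.

Lemma nf_mul0 p q : nf q = 0 -> nf (p * q) = 0.
Proof.
move=> q0; elim/mpoly_indX: p => [c|p p' p0 p'0|j p p0].
- by rewrite mul_mpolyC nfZ q0 scaler0.
- by rewrite mulrDl raddfD /= p0 p'0 addr0.
- by rewrite -mulrA nfX p0 mul0mx.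
Qed.

Lemma nf_var j : nf 'X_j = row_mx 0 (row_mx (lin_part j) 0).
Proof.
rewrite -['X_j]mulr1 nfX -mpolyC1 nfC scale1r /one_vec /shift_mx mul_row_block.
by rewrite !(mul1mx, mul0mx, mulmx0, add0r, addr0, block_mx0, row_mx0).
Qed.

Lemma nf_var2 i j : nf ('X_j * 'X_i) = row_mx 0 (row_mx 0 (\row_t rel k t i j)).
Proof.
rewrite nfX nf_var /shift_mx mul_row_block mul_row_block.
rewrite !(mul0mx, mulmx0, add0r, addr0, block_mx0, row_mx0) /lin_part -rowE.
congr (row_mx _ (row_mx _ _)).
by apply/rowP => t; rewrite !mxE.
Qed.

End ConcreteNormalForm.

Local Open Scope quotient_scope.

Lemma poly_deg_ind (k : fieldType) (n : nat) (P : int -> {mpoly k[n]} -> Prop) :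
  (forall d, P d 0) -> (forall d p q, P d p -> P d q -> P d (p + q)) ->
  (forall c, P 0 c%:MP) -> (forall d j p, P d p -> P (d + 1) ('X_j * p)) ->
  forall d p, poly_deg d p -> P d p.
Proof.
move=> P0 PD PC PX d p /poly_degP pd; rewrite [p]mpolyE big_seq.
elim/big_ind: _ => [|x y|l]; [exact: P0|exact: PD|].
rewrite mcoeff_msupp => /pd ->; rewrite -mul_mpolyC mpolyXE_id mdegE.
elim: (index_enum _) => [|i s IH]; first by rewrite !big_nil mulr1.
rewrite !big_cons mulrCA; elim: (l i) => [|e IHe]; first by rewrite expr0 mul1r.
by rewrite exprS -mulrA addSn -addn1 PoszD; apply: PX.
Qed.

Section Ideal.
Variable k : fieldType.
Local Notation S := {mpoly k[4]}.

Lemma inord4 : [/\ inord 0 = o0, inord 1 = o1, inord 2 = o2 & inord 3 = o3 :> 'I_4].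
Proof. by split; apply: val_inj; rewrite /= inordK. Qed.

Lemma gensE : gensI k = [:: 'X_o1 ^+ 2 + 'X_o2 * 'X_o3 + 'X_o0 ^+ 2; 'X_o1 * 'X_o0;
  'X_o1 ^+ 2 + 'X_o1 * 'X_o2; 'X_o1 * 'X_o3 + 'X_o2 * 'X_o0;
  'X_o3 * 'X_o0 + 'X_o0 ^+ 2; 'X_o2 ^+ 2 + 'X_o3 ^+ 2].
Proof.
rewrite /gensI /var_u /var_x /var_y /var_z.
by have [-> -> -> ->] := inord4.
Qed.

Lemma quo_pi_gen (i : 'I_6) : quo_pi (gensI k)`_i = 0.
Proof.
apply/quo_pi_eq0/asboolP; exists (fun l => (l == i)%:R).
rewrite (bigD1 i) //= eqxx mul1r big1 ?addr0 // => l /negPf ->.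
by rewrite mul0r.
Qed.

Lemma nf_gen (i : 'I_6) : nf (gensI k)`_i = 0.
Proof.
rewrite gensE; case: i => -[|[|[|[|[|[|//]]]]]] /= _;
  rewrite ?expr2 ?raddfD /= ?nf_var2 ?add_row_mx ?addr0;
  rewrite -[RHS]row_mx0 -[in RHS]row_mx0; congr (row_mx _ (row_mx _ _));
  apply/rowP; elim/ord4_ind; rewrite !mxE /rel /entry /=
    ?NegzE ?mulrNz; ring.
Qed.

Lemma nf_ideal (p : S) : p \in @idealI k -> nf p = 0.
Proof.
move=> /asboolP [c ->]; rewrite raddf_sum big1 // => i _.
exact/nf_mul0/nf_gen.
Qed.

End Ideal.

(* [A] is the algebra [S/I] up to isomorphism; keeping it abstract prevents the
   unification algorithm from unfolding the quotient. *)
Section ConcreteAlgebra.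
Variables (k : fieldType) (A : gradedAlg k) (pi : {lrmorphism {mpoly k[4]} -> A}).
Local Notation S := {mpoly k[4]}.
Local Notation N := (1 + (4 + 4))%N.
Implicit Types (a b : A).

Hypothesis pi_surj : forall a, exists p, pi p = a.
Hypothesis pi_gen : forall i : 'I_6, pi (gensI k)`_i = 0.
Hypothesis pi_ker : forall p, pi p = 0 -> nf p = 0.
Hypothesis pi_deg : forall d a, adeg d a <-> exists2 p, poly_deg d p & a = pi p.

Definition xv (j : 'I_4) : A := pi 'X_j.

Lemma xv_relations : [/\ xv o1 ^+ 2 + xv o2 * xv o3 + xv o0 ^+ 2 = 0, xv o1 * xv o0 = 0,
  xv o1 ^+ 2 + xv o1 * xv o2 = 0, xv o1 * xv o3 + xv o2 * xv o0 = 0 &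
  xv o3 * xv o0 + xv o0 ^+ 2 = 0 /\ xv o2 ^+ 2 + xv o3 ^+ 2 = 0].
Proof.
have gen i (lt : (i < 6)%N) := pi_gen (Ordinal lt); rewrite /= gensE in gen.
have := (gen 0 isT, gen 1 isT, gen 2 isT, gen 3 isT, gen 4 isT, gen 5 isT).
by rewrite /= !(rmorphD, rmorphXn, rmorphM) /= => -[[[[[]]]]].
Qed.

Lemma xv_mul i j : xv i * xv j = \sum_t rel A t i j * qmonomial xv t.
Proof. by have [g0 g1 g2 g3 [g4 g5]] := xv_relations; exact: mul_vars. Qed.

Lemma xv_qmonomial j t : xv j * qmonomial xv t = 0.
Proof. by have [g0 g1 g2 g3 [g4 g5]] := xv_relations; exact: mul_var_qmonomial. Qed.

Lemma rco_spec : {f : A -> 'rV[k]_N | forall p, f (pi p) = nf p}.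
Proof.
exists (fun a => nf (sval (cid (pi_surj a)))) => p.
apply/eqP; rewrite -subr_eq0 -raddfB; apply/eqP/pi_ker.
by rewrite raddfB /= (svalP (cid (pi_surj (pi p)))) subrr.
Qed.

Definition rco : A -> 'rV[k]_N := sval rco_spec.

Lemma rco_pi (p : S) : rco (pi p) = nf p.
Proof. exact: (svalP rco_spec). Qed.

Lemma algP a : exists p : S, a = pi p.
Proof. by have [p <-] := pi_surj a; exists p. Qed.

Fact rco_linear : linear rco.
Proof.
move=> c a b; have [p ->] := algP a; have [q ->] := algP b.
have -> : c *: pi p + pi q = pi (c *: p + q) by rewrite linearP.
by rewrite !rco_pi raddfD /= nfZ.
Qed.
HB.instance Definition _ := GRing.isLinear.Build k A 'rV[k]_N _ rco rco_linear.

Lemma rcoB a b i : rco (a - b) 0 i = rco a 0 i - rco b 0 i.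
Proof. by rewrite raddfB [LHS]mxE [X in _ + X]mxE. Qed.

Lemma rco_xvM j a : rco (xv j * a) = rco a *m shift_mx k j.
Proof.
have [p ->] := algP a; rewrite /xv -(rmorphM pi) !rco_pi.
exact: nfX.
Qed.

Definition rmon (i : 'I_N) : S :=
  match split i with
  | inl _ => 1
  | inr i' => match split i' with inl j => 'X_j | inr t => qmonomial (fun j => 'X_j) t end
  end.

Definition rdeg (i : 'I_N) : nat :=
  match split i with inl _ => 0 | inr i' => match split i' with inl _ => 1 | inr _ => 2 end end.

Definition i_lin (j : 'I_4) : 'I_N := rshift 1 (lshift 4 j).
Definition i_quad (t : 'I_4) : 'I_N := rshift 1 (rshift 4 t).
Definition i_one : 'I_N := lshift (4 + 4) (0 : 'I_1).

Lemma ordN_ind (P : 'I_N -> Prop) : P i_one -> (forall j, P (i_lin j)) ->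
  (forall t, P (i_quad t)) -> forall i, P i.
Proof.
move=> P1 Pl Pq i; case: (split_ordP i) => [j ->|i' ->].
  by rewrite (ord1 j).
by case: (split_ordP i') => [j ->|t ->]; [exact: Pl|exact: Pq].
Qed.

Lemma sumN (V : nmodType) (F : 'I_N -> V) :
  \sum_i F i = F i_one + \sum_j F (i_lin j) + \sum_t F (i_quad t).
Proof. by rewrite big_split_ord /= big_ord1 big_split_ord /= addrA. Qed.

Lemma rmon1 : rmon i_one = 1.
Proof. by rewrite /rmon /i_one (unsplitK (inl _)). Qed.
Lemma rmon_lin j : rmon (i_lin j) = 'X_j.
Proof. by rewrite /rmon /i_lin (unsplitK (inr _)) (unsplitK (inl _)). Qed.
Lemma rmon_quad t : rmon (i_quad t) = qmonomial (fun j => 'X_j) t.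
Proof. by rewrite /rmon /i_quad (unsplitK (inr _)) (unsplitK (inr _)). Qed.
Lemma rdeg1 : rdeg i_one = 0%N.
Proof. by rewrite /rdeg /i_one (unsplitK (inl _)). Qed.
Lemma rdeg_lin j : rdeg (i_lin j) = 1%N.
Proof. by rewrite /rdeg /i_lin (unsplitK (inr _)) (unsplitK (inl _)). Qed.
Lemma rdeg_quad t : rdeg (i_quad t) = 2%N.
Proof. by rewrite /rdeg /i_quad (unsplitK (inr _)) (unsplitK (inr _)). Qed.

Definition rb (i : 'I_N) : A := pi (rmon i).

Lemma pi_qmonomial t : pi (qmonomial (fun j => 'X_j) t) = qmonomial xv t.
Proof. by elim/ord4_ind: t; rewrite /qmonomial /= rmorphM. Qed.

Lemma rb1 : rb i_one = 1. Proof. by rewrite /rb rmon1 rmorph1. Qed.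
Lemma rb_lin j : rb (i_lin j) = xv j. Proof. by rewrite /rb rmon_lin. Qed.
Lemma rb_quad t : rb (i_quad t) = qmonomial xv t.
Proof. by rewrite /rb rmon_quad pi_qmonomial. Qed.

Lemma row_mxN1 (c : 'rV[k]_1) d e : row_mx c (row_mx d e) 0 i_one = c 0 0.
Proof. by rewrite /i_one row_mxEl. Qed.
Lemma row_mxNl (c : 'rV[k]_1) (d : 'rV_4) (e : 'rV_4) j : row_mx c (row_mx d e) 0 (i_lin j) = d 0 j.
Proof. by rewrite /i_lin row_mxEr row_mxEl. Qed.
Lemma row_mxNq (c : 'rV[k]_1) (d : 'rV_4) (e : 'rV_4) t : row_mx c (row_mx d e) 0 (i_quad t) = e 0 t.
Proof. by rewrite /i_quad row_mxEr row_mxEr. Qed.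

Lemma shiftE (c : 'rV[k]_N) j : [/\ (c *m shift_mx k j) 0 i_one = 0,
  forall i, (c *m shift_mx k j) 0 (i_lin i) = c 0 i_one * (i == j)%:R &
  forall t, (c *m shift_mx k j) 0 (i_quad t) = \sum_l c 0 (i_lin l) * rel k t l j].
Proof.
have -> : c *m shift_mx k j = row_mx 0
    (row_mx (lsubmx c *m lin_part k j) (lsubmx (rsubmx c) *m quad_part k j)).
  rewrite -{1}[c]hsubmxK -{1}[rsubmx c]hsubmxK /shift_mx mul_row_block mul_row_block.
  by rewrite mul_mx_row !(mul0mx, mulmx0, add0r, addr0) add_row_mx !(add0r, addr0).
split=> [|i|t]; rewrite ?row_mxN1 ?row_mxNl ?row_mxNq ?mxE //.
  by rewrite big_ord1 !mxE eqxx /= eq_sym; congr (c 0 _ * _); apply: val_inj.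
by apply: eq_bigr => l _; rewrite !mxE.
Qed.

Lemma rcoK a : a = \sum_i rco a 0 i *: rb i.
Proof.
have [p ->] := algP a; rewrite rco_pi; elim/mpoly_indX: p => [c|p q IHp IHq|j p IHp].
- rewrite nfC sumN !big1 ?addr0.
  + rewrite rb1 mxE /one_vec /i_one row_mxEl mxE eqxx mulr1.
    by rewrite -[c%:MP]mulr1 mul_mpolyC linearZ /= rmorph1.
  + by move=> t _; rewrite mxE /one_vec /i_quad row_mxEr mxE mulr0 scale0r.
  + by move=> t _; rewrite mxE /one_vec /i_lin row_mxEr mxE mulr0 scale0r.
- rewrite (rmorphD pi) /= {1}IHp {1}IHq (raddfD (@nf k)) /= -big_split.
  by apply: eq_bigr => i _; rewrite /= -scalerDl; congr (_ *: _); rewrite [RHS]mxE.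
have [s1 sl sq] := shiftE (nf p) j.
rewrite (rmorphM pi) /= {1}IHp nfX !sumN s1 scale0r add0r -/(xv j) rb1 !mulrDr.
rewrite -scalerAr mulr1 [X in _ + X = _]mulr_sumr [X in _ + X = _]big1 ?addr0 => [|t _]; last first.
  by rewrite -scalerAr rb_quad xv_qmonomial scaler0.
congr (_ + _).
  rewrite (bigD1 j) //= sl eqxx mulr1 rb_lin big1 ?addr0 // => i /negPf ij.
  by rewrite sl ij mulr0 scale0r.
under [RHS]eq_bigr => t _ do rewrite sq scaler_suml.
rewrite exchange_big mulr_sumr; apply: eq_bigr => l _ /=.
rewrite -scalerAr rb_lin mulrC xv_mul scaler_sumr; apply: eq_bigr => t _.
by rewrite rb_quad -scalerA; congr (_ *: _); rewrite /rel scaler_int mulrzl.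
Qed.

Lemma rco_rb i : rco (rb i) = delta_mx 0 i.
Proof.
rewrite /rb rco_pi; apply/rowP => l; rewrite [RHS]mxE eqxx /=.
elim/ordN_ind: i => [|j|t].
- rewrite rmon1 -mpolyC1 nfC scale1r /one_vec -(row_mx0 _ _ 4 4).
  by elim/ordN_ind: l => [|j|t]; rewrite ?row_mxN1 ?row_mxNl ?row_mxNq ?mxE.
- rewrite rmon_lin nf_var.
  elim/ordN_ind: l => [|i|t]; rewrite ?row_mxN1 ?row_mxNl ?row_mxNq ?mxE //.
  by rewrite /i_lin !eq_shift ?eqxx /=.
have -> : nf (rmon (i_quad t) : S) = row_mx 0 (row_mx 0 (delta_mx 0 t)).
  have nfq i j : (forall t', rel k t' i j = (t' == t)%:R) ->
      nf ('X_j * 'X_i : S) = row_mx 0 (row_mx 0 (delta_mx 0 t)).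
    move=> rE; rewrite nf_var2; congr (row_mx _ (row_mx _ _)); apply/rowP => t'.
    by rewrite [LHS]mxE rE [RHS]mxE eqxx.
  by rewrite rmon_quad /qmonomial; elim/ord4_ind: t nfq => /= nfq; apply: nfq;
     elim/ord4_ind.
elim/ordN_ind: l => [|i|t']; rewrite ?row_mxN1 ?row_mxNl ?row_mxNq ?mxE //.
by rewrite /i_quad !eq_shift ?eqxx /=.
Qed.

Lemma rco_sum (c : 'rV[k]_N) : rco (\sum_i c 0 i *: rb i) = c.
Proof.
rewrite raddf_sum [RHS]row_sum_delta; apply: eq_bigr => i _.
by rewrite /= linearZ /= rco_rb.
Qed.

Lemma shift_deg j (c : 'rV[k]_N) d : (forall i, c 0 i != 0 -> d = (rdeg i)%:Z) ->
  forall i, (c *m shift_mx k j) 0 i != 0 -> d + 1 = (rdeg i)%:Z.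
Proof.
move=> cd; have [s1 sl sq] := shiftE c j; elim/ordN_ind => [|i|t].
- by rewrite s1 eqxx.
- rewrite sl mulf_eq0 negb_or => /andP [/cd -> _].
  by rewrite rdeg1 rdeg_lin.
rewrite sq => s0; have [l] : exists l, c 0 (i_lin l) != 0.
  apply/existsP; rewrite -[X in is_true X]negbK negb_exists; apply/negP => /forallP l0.
  move/eqP: s0; apply; rewrite big1 // => l _.
  by have := l0 l; rewrite negbK => /eqP ->; rewrite mul0r.
by move=> /cd ->; rewrite rdeg_lin rdeg_quad.
Qed.

Lemma rmon_deg i : poly_deg (rdeg i)%:Z (rmon i).
Proof.
elim/ordN_ind: i => [|j|t].
- by rewrite rdeg1 rmon1 -mpolyC1; exact: poly_degC.
- by rewrite rdeg_lin rmon_lin; exact: poly_degX.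
rewrite rdeg_quad rmon_quad; have XX i j : poly_deg 2%:Z ('X_i * 'X_j : S).
  by rewrite (_ : 2%:Z = 1 + 1) //; apply: poly_degM; exact: poly_degX.
by elim/ord4_ind: t; exact: XX.
Qed.

Lemma alg_deg d a : @adeg k A d a <-> forall i, rco a 0 i != 0 -> d = (rdeg i)%:Z.
Proof.
split=> [/pi_deg [p pd ->]|ad].
  rewrite rco_pi; elim/poly_deg_ind: pd => {d p} [d i|d p q IHp IHq i|c i|d j p IHp i].
  - by rewrite raddf0 mxE eqxx.
  - rewrite raddfD mxE; have [->|/IHp //] := eqVneq (nf p 0 i) 0.
    by rewrite add0r; exact: IHq.
  - rewrite nfC mxE; elim/ordN_ind: i => [|j|t]; rewrite ?rdeg1 //.
      by rewrite /one_vec /i_lin row_mxEr mxE mulr0 eqxx.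
    by rewrite /one_vec /i_quad row_mxEr mxE mulr0 eqxx.
  - by rewrite nfX; exact: shift_deg.
apply/pi_deg; exists (\sum_i rco a 0 i *: rmon i).
  apply: poly_deg_sum => i _; have [->|/ad ->] := eqVneq (rco a 0 i) 0.
    by rewrite scale0r; exact: poly_deg0.
  by rewrite -mul_mpolyC -[(rdeg i)%:Z]add0r; apply: poly_degM; [exact: poly_degC|exact: rmon_deg].
rewrite {1}[a]rcoK raddf_sum; apply: eq_bigr => i _.
by rewrite /= linearZ.
Qed.

Definition alg_basis : hbasis A N := HBasis rcoK rco_sum alg_deg.

Lemma alg_graded : is_graded_algebra A.
Proof.
split.
- have -> : @adeg k A = fun d a => forall i, rco a 0 i != 0 -> d = (rdeg i)%:Z.
    by apply/funext => d; apply/funext => a; rewrite propeqE; exact: alg_deg.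
  apply: (@coordinate_grading k A N (fun a i => rco a 0 i) (fun i => (rdeg i)%:Z)
    (fun d a => \sum_i (if (rdeg i)%:Z == d then rco a 0 i else 0) *: rb i)).
  - exact: rcoB.
  - by move=> a a0; rewrite [a]rcoK big1 // => i _; rewrite a0 scale0r.
  move=> d a i; pose c : 'rV[k]_N := \row_i (if (rdeg i)%:Z == d then rco a 0 i else 0).
  rewrite (eq_bigr (fun i => c 0 i *: rb i)) => [|l _]; last by rewrite [c 0 l]mxE.
  by rewrite rco_sum [LHS]mxE.
- by apply/pi_deg; exists 1; [rewrite -mpolyC1; exact: poly_degC|rewrite rmorph1].
- move=> d c a /pi_deg [p pd ->]; apply/pi_deg; exists (c *: p); last by rewrite linearZ.
  by rewrite -mul_mpolyC -[d]add0r; apply: poly_degM => //; exact: poly_degC.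
- move=> d e a b /pi_deg [p pd ->] /pi_deg [q qe ->]; apply/pi_deg; exists (p * q); last by rewrite rmorphM.
  exact: poly_degM.
Qed.

Lemma pi_presentation : is_presentation pi.
Proof. by split=> // d p pd; apply/pi_deg; exists p. Qed.

Definition ceps (a : A) : k := rco a 0 i_one.
Definition ctau j (a : A) : k := rco a 0 (i_lin j).
Definition crho t (a : A) : k := rco a 0 (i_quad t).

Fact ceps_additive : zmod_morphism ceps.
Proof. by move=> a b; rewrite /ceps rcoB. Qed.
Fact ctau_additive j : zmod_morphism (ctau j).
Proof. by move=> a b; rewrite /ctau rcoB. Qed.
Fact crho_additive t : zmod_morphism (crho t).
Proof. by move=> a b; rewrite /crho rcoB. Qed.
HB.instance Definition _ := GRing.isZmodMorphism.Build A k ceps ceps_additive.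
HB.instance Definition _ j := GRing.isZmodMorphism.Build A k (ctau j) (ctau_additive j).
HB.instance Definition _ t := GRing.isZmodMorphism.Build A k (crho t) (crho_additive t).

Lemma ceps_xvM j a : ceps (xv j * a) = 0.
Proof. by rewrite /ceps rco_xvM; have [] := shiftE (rco a) j. Qed.

Lemma ctau_xvM i j a : ctau i (xv j * a) = ceps a * (i == j)%:R.
Proof. by rewrite /ctau rco_xvM; have [_ -> _] := shiftE (rco a) j. Qed.

Lemma crho_xvM t j a : crho t (xv j * a) = \sum_l ctau l a * rel k t l j.
Proof. by rewrite /crho rco_xvM; have [_ _ ->] := shiftE (rco a) j. Qed.

Lemma coordsZ c a : [/\ ceps (c *: a) = c * ceps a, forall j, ctau j (c *: a) = c * ctau j a &
  forall t, crho t (c *: a) = c * crho t a].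
Proof. by split=> [|j|t]; rewrite /ceps /ctau /crho linearZ /= [LHS]mxE. Qed.

Lemma coords_one : [/\ ceps 1 = 1, forall j, ctau j 1 = 0 & forall t, crho t 1 = 0].
Proof.
rewrite -rb1 /ceps /ctau /crho rco_rb; split=> [|j|t]; rewrite mxE ?eqxx //.
Qed.

Lemma coords_xv j : [/\ ceps (xv j) = 0, forall i, ctau i (xv j) = (i == j)%:R &
  forall t, crho t (xv j) = 0].
Proof.
have [e1 t1 r1] := coords_one; rewrite -[xv j]mulr1; split=> [|i|t].
- exact: ceps_xvM.
- by rewrite ctau_xvM e1 mul1r.
by rewrite crho_xvM big1 // => l _; rewrite t1 mul0r.
Qed.

Lemma coords_qmonomial s : [/\ ceps (qmonomial xv s) = 0, forall i, ctau i (qmonomial xv s) = 0 &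
  forall t, crho t (qmonomial xv s) = (t == s)%:R].
Proof.
rewrite -rb_quad /ceps /ctau /crho rco_rb; split=> [|j|t]; rewrite mxE ?eqxx //.
by rewrite /i_quad !eq_shift.
Qed.

(** These rules are what [not_koszul] asks of [tau] and [rhot]. Induction on a polynomial
    representing [a] reduces them to multiplication by one variable. *)
Lemma coords_mul a b : [/\ ceps (a * b) = ceps a * ceps b,
  forall j, ctau j (a * b) = ceps a * ctau j b + ctau j a * ceps b &
  forall t, crho t (a * b) = ceps a * crho t b + crho t a * ceps b +
    \sum_i \sum_j rel k t i j * (ctau i a * ctau j b)].
Proof.
have [p ->] := algP a; elim/mpoly_indX: p => [c|p q [Ep Tp Rp] [Eq Tq Rq]|j p [Ep Tp Rp]].
- have -> : pi c%:MP = c *: (1 : A) by rewrite -[c%:MP]mulr1 mul_mpolyC linearZ /= rmorph1.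
  have [e1 t1 r1] := coords_one; have [eZ tZ rZ] := coordsZ c 1.
  rewrite -scalerAl mul1r; have [eb tb rb'] := coordsZ c b; split=> [|j|t].
  + by rewrite eb eZ e1 mulr1.
  + by rewrite tb eZ e1 tZ t1 mulr1 mulr0 mul0r addr0.
  + rewrite rb' eZ e1 rZ r1 mulr1 mulr0 mul0r addr0 big1 ?addr0 // => i _.
    by rewrite big1 // => l _; rewrite tZ t1 mulr0 mul0r mulr0.
- rewrite (rmorphD pi) mulrDl; split=> [|i|t].
  + by rewrite !(raddfD ceps) /= Ep Eq mulrDl.
  + by rewrite !(raddfD (ctau i)) /= Tp Tq; ring.
  + rewrite !(raddfD (crho t)) (raddfD ceps) /= Rp Rq.
    under [X in _ = _ + X]eq_bigr => i _.
      under eq_bigr => l _ do rewrite (raddfD (ctau i)) /= mulrDl mulrDr.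
      rewrite big_split /=; over.
    by rewrite big_split /=; ring.
- rewrite (rmorphM pi) /= -/(xv j) -mulrA; split=> [|i|t].
  + by rewrite !ceps_xvM mul0r.
  + by rewrite !ctau_xvM ceps_xvM Ep mul0r add0r mulrAC.
  rewrite !crho_xvM ceps_xvM mul0r add0r.
  under [LHS]eq_bigr => l _ do rewrite Tp mulrDl.
  rewrite big_split /= addrC; congr (_ + _).
    by rewrite mulr_suml; apply: eq_bigr => l _; rewrite mulrAC.
  rewrite [RHS](bigD1 j) //= [X in _ = _ + X]big1 ?addr0 => [|i /negPf ij]; last first.
    by rewrite big1 // => l _; rewrite ctau_xvM ij mulr0 mul0r mulr0.
  apply: eq_bigr => l _; rewrite ctau_xvM eqxx mulr1 rel_sym.
  by rewrite mulrC.
Qed.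

End ConcreteAlgebra.

(** * The dual of [S/I]: generators and linear presentation *)

Lemma graded_sum (k : fieldType) (A : gradedAlg k) (I : Type) (s : seq I) (P : pred I)
    (F : I -> A) d : is_graded_algebra A ->
  (forall i, P i -> adeg d (F i)) -> adeg d (\sum_(i <- s | P i) F i).
Proof.
move=> gA hF; have [g0 gB _ _] := galg_grading gA.
elim/big_ind: _ => // x y hx hy; rewrite -[y]opprK; apply: (gB) => //.
by rewrite -sub0r; apply: (gB).
Qed.

(* The products [piv_sign j *: x_(piv_var j) * e_(piv_gen j)] are the elements of
   degree -1 dual to the variables. *)
Definition piv_var (j : 'I_4) : 'I_4 := nth o0 [:: o2; o3; o2; o3] j.
Definition piv_gen (j : 'I_4) : 'I_4 := nth o0 [:: o1; o1; o3; o3] j.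
Definition piv_sign (j : 'I_4) : int := nth 0 [:: -1; 1; -1; 1]%Z j.

Lemma pivot_dual (j j' : 'I_4) :
  piv_sign j * entry rel_table (piv_gen j) (piv_var j) j' = (j == j')%:Z.
Proof. by elim/ord4_ind: j; elim/ord4_ind: j'. Qed.

Definition syz_product (a l t s t' : 'I_4) : int :=
  let f (j : 'I_4) := entry rel_table t l j * piv_sign j * (piv_gen j == t')%:Z *
             entry rel_table s a (piv_var j) in
  (t == t')%:Z * entry rel_table s a l - (f o0 + f o1 + f o2 + f o3).

(* [2 (m_s e_t - delta_st m_0 e_0)] as a combination, with the listed
   coefficients, of the products of [x_a] with the syzygy [(l, t)]. *)
Definition syz_table : seq (seq ('I_4 * 'I_4 * 'I_4 * int)) :=
  [:: [::];
      [:: (o1, o0, o0, 2); (o2, o0, o3, 2)];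
      [:: (o1, o1, o2, -2)];
      [:: (o1, o0, o1, -2)];
      [:: (o1, o3, o0, 2); (o1, o0, o0, 2); (o2, o0, o3, 2)];
      [:: (o1, o2, o0, -2)];
      [:: (o3, o1, o2, 2)];
      [:: (o2, o0, o3, -2)];
      [:: (o2, o3, o0, 1); (o3, o2, o0, 1)];
      [:: (o2, o2, o0, -1); (o3, o3, o0, -1)];
      [:: (o1, o2, o0, -2); (o2, o0, o1, 2); (o3, o2, o2, 2)];
      [:: (o0, o0, o3, -2); (o1, o0, o1, -2)];
      [:: (o3, o3, o0, 1); (o2, o2, o0, -1)];
      [:: (o3, o2, o0, -1); (o2, o3, o0, 1)];
      [:: (o2, o2, o2, -2); (o0, o0, o3, 2); (o1, o0, o1, 2)];
      [:: (o1, o2, o0, -2); (o2, o0, o1, 2)]]%Z.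

Definition syz_target (s t s' t' : 'I_4) : int :=
  ((s' == s) && (t' == t))%:Z - [&& s == t, s' == o0 & t' == o0]%:Z.

Lemma syz_tableE (s t s' t' : 'I_4) :
  foldr (fun x r => x.2 * syz_product x.1.1.1 x.1.1.2 x.1.2 s' t' + r) 0
    (nth [::] syz_table (4 * s + t)) = 2 * syz_target s t s' t'.
Proof.
apply/eqP; elim/ord4_ind: s; elim/ord4_ind: t; elim/ord4_ind: s'; elim/ord4_ind: t'.
all: by vm_compute.
Qed.

Section ConcreteCanonical.
Variables (k : fieldType) (A : gradedAlg k) (pi : {lrmorphism {mpoly k[4]} -> A}).
Local Notation S := {mpoly k[4]}.
Local Notation N := (1 + (4 + 4))%N.

Hypothesis k_char0 : [pchar k] =i pred0.
Hypothesis pi_surj : forall a, exists p, pi p = a.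
Hypothesis pi_gen : forall i : 'I_6, pi (gensI k)`_i = 0.
Hypothesis pi_ker : forall p, pi p = 0 -> nf p = 0.
Hypothesis pi_deg : forall d a, adeg d a <-> exists2 p, poly_deg d p & a = pi p.

Local Notation H := (alg_basis pi_surj pi_gen pi_ker pi_deg).
Local Notation gA := (alg_graded pi_surj pi_gen pi_ker pi_deg).
Local Notation xv := (xv pi).
Local Notation qm := (qmonomial xv).
Local Notation ceps := (ceps pi_surj pi_ker).
Local Notation ctau := (ctau pi_surj pi_ker).
Local Notation crho := (crho pi_surj pi_ker).
Local Notation W := (dual_graded H).

Lemma two_neq0 : 2%:R != 0 :> k.
Proof. by have := k_char0 2; rewrite !inE /= => ->. Qed.

Lemma xv_mulZ i j : xv i * xv j = \sum_t rel k t i j *: qm t.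
Proof.
rewrite (xv_mul pi_gen); apply: eq_bigr => t _.
by rewrite /rel scaler_int mulrzl.
Qed.

Lemma xv_deg j : adeg 1 (xv j).
Proof. by apply/pi_deg; exists 'X_j => //; exact: poly_degX. Qed.

Lemma coords_sum (I : finType) (F : I -> k) (G : I -> A) :
  [/\ ceps (\sum_i F i *: G i) = \sum_i F i * ceps (G i),
      forall j, ctau j (\sum_i F i *: G i) = \sum_i F i * ctau j (G i) &
      forall t, crho t (\sum_i F i *: G i) = \sum_i F i * crho t (G i)].
Proof.
split=> [|j|t]; rewrite raddf_sum; apply: eq_bigr => i _;
  by have [e1 e2 e3] := coordsZ pi_surj pi_ker (F i) (G i); rewrite /= ?e1 ?e2 ?e3.
Qed.

Lemma alg_decomp a : a = ceps a *: 1 + \sum_j ctau j a *: xv j + \sum_t crho t a *: qm t.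
Proof.
rewrite {1}[a](rcoK pi_surj pi_gen pi_ker) sumN rb1; congr (_ + _ + _).
  by apply: eq_bigr => j _; rewrite rb_lin.
by apply: eq_bigr => j _; rewrite rb_quad.
Qed.

Definition dual_gen (t : 'I_4) : W := (delta_mx (i_quad t) 0 : 'cV[k]_N).

Lemma dual_gen_deg t : mdg (- 2%:Z) (dual_gen t).
Proof.
move=> i; rewrite mxE andbT; case: (i =P i_quad t) => [->|_]; last by rewrite eqxx.
by rewrite /= rdeg_quad.
Qed.

Lemma dual_genE (c : 'I_4 -> A) i :
  (\sum_t c t *: dual_gen t : 'cV_N) i 0 = \sum_t crho t (c t * rb pi i).
Proof.
rewrite summxE; apply: eq_bigr => t _.
rewrite dual_scaleE mxE (bigD1 (i_quad t)) //= big1 ?addr0 => [|l /negPf lt].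
  by rewrite [X in _ * X]mxE !eqxx mulr1 [LHS]mxE.
by rewrite [X in _ * X]mxE lt mulr0.
Qed.

Lemma dual_gen_one c : (\sum_t c t *: dual_gen t : 'cV_N) i_one 0 = \sum_t crho t (c t).
Proof. by rewrite dual_genE; apply: eq_bigr => t _; rewrite rb1 mulr1. Qed.

Lemma dual_gen_lin c j : (\sum_t c t *: dual_gen t : 'cV_N) (i_lin j) 0 =
  \sum_t \sum_l ctau l (c t) * rel k t l j.
Proof.
by rewrite dual_genE; apply: eq_bigr => t _; rewrite rb_lin mulrC crho_xvM.
Qed.

Lemma dual_gen_quad c s : (\sum_t c t *: dual_gen t : 'cV_N) (i_quad s) 0 = ceps (c s).
Proof.
rewrite dual_genE (bigD1 s) //= big1 ?addr0 => [|t ts]; rewrite rb_quad.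
  have [_ _ ->] := coords_mul pi_surj pi_ker (c s) (qm s).
  have [q1 q2 q3] := coords_qmonomial pi_surj pi_ker s.
  rewrite q1 q3 eqxx mulr1 mulr0 addr0 big1 ?addr0 // => i _.
  by rewrite big1 // => j _; rewrite q2 !mulr0.
have [_ _ ->] := coords_mul pi_surj pi_ker (c t) (qm s).
have [q1 q2 q3] := coords_qmonomial pi_surj pi_ker s.
rewrite q1 q3 (negPf ts) !mulr0 addr0 big1 ?addr0 // => i _.
by rewrite big1 // => j _; rewrite q2 !mulr0.
Qed.

Lemma dual_gen_generates : generates dual_gen.
Proof.
move=> f; pose F i := (f : 'cV[k]_N) i 0.
(* Values on quadrics are reached by scalars, values on the variables by the pivot products, whose
   duality is [pivot_dual], and the value on [1] by [qm o0] times the first generator. *)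
pose c (t : 'I_4) : A := F (i_quad t) *: 1 +
  \sum_j (F (i_lin j) * (piv_sign j)%:~R * (piv_gen j == t)%:R) *: xv (piv_var j) +
  (F i_one * (t == o0)%:R) *: qm t.
exists c.
have cE t : [/\ ceps (c t) = F (i_quad t), forall l, ctau l (c t) =
    \sum_j (F (i_lin j) * (piv_sign j)%:~R * (piv_gen j == t)%:R) * (l == piv_var j)%:R &
    crho t (c t) = F i_one * (t == o0)%:R].
  have [e1 t1 r1] := coords_one pi_surj pi_ker.
  have [q1 q2 q3] := coords_qmonomial pi_surj pi_ker t.
  pose G j := F (i_lin j) * (piv_sign j)%:~R * (piv_gen j == t)%:R.
  have [s1 s2 s3] := coords_sum G (fun j => xv (piv_var j)).
  rewrite /c; split=> [|l|].
  - rewrite !(raddfD ceps) /= s1 big1 => [|j _]; last first.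
      by have [-> _ _] := coords_xv pi_surj pi_ker (piv_var j); rewrite mulr0.
    have [-> _ _] := coordsZ pi_surj pi_ker (F (i_quad t)) 1.
    have [-> _ _] := coordsZ pi_surj pi_ker (F i_one * (t == o0)%:R) (qm t).
    by rewrite e1 q1 mulr1 mulr0 !addr0.
  - rewrite !(raddfD (ctau l)) /= s2.
    have [_ -> _] := coordsZ pi_surj pi_ker (F (i_quad t)) 1.
    have [_ -> _] := coordsZ pi_surj pi_ker (F i_one * (t == o0)%:R) (qm t).
    rewrite t1 q2 !mulr0 addr0 add0r; apply: eq_bigr => j _.
    by have [_ -> _] := coords_xv pi_surj pi_ker (piv_var j).
  - rewrite !(raddfD (crho t)) /= s3 big1 => [|j _]; last first.
      by have [_ _ ->] := coords_xv pi_surj pi_ker (piv_var j); rewrite mulr0.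
    have [_ _ ->] := coordsZ pi_surj pi_ker (F (i_quad t)) 1.
    have [_ _ ->] := coordsZ pi_surj pi_ker (F i_one * (t == o0)%:R) (qm t).
    by rewrite r1 q3 eqxx mulr1 mulr0 !add0r.
apply/colP; elim/ordN_ind => [|j|s].
- rewrite dual_gen_one (bigD1 o0) //= big1 ?addr0 => [|t /negPf t0].
    by have [_ _ ->] := cE o0; rewrite eqxx mulr1.
  by have [_ _ ->] := cE t; rewrite t0 mulr0.
- rewrite dual_gen_lin.
  transitivity (\sum_j' F (i_lin j') * (j' == j)%:R).
    by rewrite (bigD1 j) //= eqxx mulr1 big1 ?addr0 // => i /negPf ->; rewrite mulr0.
  symmetry; under eq_bigr => t _.
    under eq_bigr => l _ do [have [_ -> _] := cE t; rewrite mulr_suml].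
    over.
  rewrite sum_rotate; apply: eq_bigr => j' _.
  rewrite (bigD1 (piv_gen j')) //= [X in _ + X]big1 ?addr0 => [|t tj]; last first.
    by rewrite big1 // => l _; rewrite eq_sym (negPf tj) mulr0 !mul0r.
  rewrite (bigD1 (piv_var j')) //= [X in _ + X]big1 ?addr0 => [|l lj]; last first.
    by rewrite (negPf lj) mulr0 mul0r.
  rewrite !eqxx !mulr1 -mulrA /rel -intrM pivot_dual.
  by case: (j' == j).
by rewrite dual_gen_quad; have [-> _ _] := cE s.
Qed.

(** Values on quadrics see only the constant parts of coefficients. Expressing the four generators
    through any [m'] elements therefore factors the identity matrix of size 4 through [k^m']. *)
Lemma dual_type : min_number_generators W 4.
Proof.
split; first by exists dual_gen; exact: dual_gen_generates.
move=> m' e gen; have /fin_all_exists [c cE] t := gen (dual_gen t).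
pose C : 'M[k]_(4, m') := \matrix_(t, i) ceps (c t i).
pose E : 'M[k]_(m', 4) := \matrix_(i, s) (e i : 'cV[k]_N) (i_quad s) 0.
have CE : C *m E = 1%:M.
  apply/matrixP => t s; rewrite !mxE.
  transitivity ((dual_gen t : 'cV_N) (i_quad s) 0); last first.
    by rewrite mxE andbT /i_quad !eq_shift eq_sym.
  rewrite (cE t) summxE; apply: eq_bigr => i _; rewrite dual_scaleE !mxE.
  rewrite (bigD1 (i_quad s)) //= big1 ?addr0 => [|l ls].
    congr (_ * _); rewrite mxE /= rb_quad.
    have [_ _ R] := coords_mul pi_surj pi_ker (c t i) (qm s).
    have [q1 q2 q3] := coords_qmonomial pi_surj pi_ker s.
    rewrite -[RHS]/(crho s _) R q1 q3 eqxx mulr1 mulr0 addr0 big1 ?addr0 // => x _.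
    by rewrite big1 // => y _; rewrite q2 !mulr0.
  rewrite mxE /= rb_quad [X in X * _](_ : _ = 0) ?mul0r //.
  have [R1 R2 R3] := coords_mul pi_surj pi_ker (c t i) (qm s).
  have [q1 q2 q3] := coords_qmonomial pi_surj pi_ker s.
  elim/ordN_ind: l ls => [|j|s'] ls.
  - by rewrite -[LHS]/(ceps _) R1 q1 mulr0.
  - by rewrite -[LHS]/(ctau j _) R2 q1 q2 !mulr0 addr0.
  rewrite -[LHS]/(crho s' _) R3 q1 q3 mulr0 addr0 big1 ?addr0 => [|x _]; last first.
    by rewrite big1 // => y _; rewrite q2 !mulr0.
  case: eqP => [s's|]; last by rewrite mulr0.
  by rewrite s's eqxx in ls.
have := mxrankM_maxl C E; rewrite CE mxrank1 => /leq_trans; apply.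
exact: rank_leq_col.
Qed.

(** [x_l e_t] takes the value [rel k t l j] at [x_j], hence equals the corresponding combination of
    pivot products; [syz l t] is the resulting relation. *)
Definition syz (l t t' : 'I_4) : A :=
  (t == t')%:R *: xv l -
  \sum_j (rel k t l j * (piv_sign j)%:~R * (piv_gen j == t')%:R) *: xv (piv_var j).

Lemma syz_deg l t t' : adeg 1 (syz l t t').
Proof.
have [_ gB _ _] := galg_grading gA; apply: gB.
  by apply: (galgZ gA); exact: xv_deg.
by apply: graded_sum gA _ => j _; apply: (galgZ gA); exact: xv_deg.
Qed.

Definition syz_span (c : 'I_4 -> A) :=
  exists b : 'I_4 -> 'I_4 -> A, forall t', c t' = \sum_l \sum_t b l t * syz l t t'.

Lemma syz_spanD c c' : syz_span c -> syz_span c' -> syz_span (fun t => c t + c' t).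
Proof.
move=> [b bE] [b' b'E]; exists (fun l t => b l t + b' l t) => t'.
rewrite bE b'E -big_split; apply: eq_bigr => l _; rewrite -big_split.
by apply: eq_bigr => t _; rewrite mulrDl.
Qed.

Lemma syz_spanZ (x : k) c : syz_span c -> syz_span (fun t => x *: c t).
Proof.
move=> [b bE]; exists (fun l t => x *: b l t) => t'.
rewrite bE scaler_sumr; apply: eq_bigr => l _; rewrite scaler_sumr.
by apply: eq_bigr => t _; rewrite scalerAl.
Qed.

Lemma syz_span0 : syz_span (fun=> 0).
Proof.
by exists (fun _ _ => 0) => t'; rewrite big1 // => l _; rewrite big1 // => t _; rewrite mul0r.
Qed.

Lemma syz_span_sum (I : Type) (s : seq I) (F : I -> 'I_4 -> A) :
  (forall i, syz_span (F i)) -> syz_span (fun t => \sum_(i <- s) F i t).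
Proof.
move=> hF; elim: s => [|i s IH].
  rewrite (_ : (fun _ => _) = fun=> 0); first exact: syz_span0.
  by apply/funext => t; rewrite big_nil.
rewrite (_ : (fun _ => _) = fun t => F i t + \sum_(i <- s) F i t).
  exact: syz_spanD.
by apply/funext => t; rewrite big_cons.
Qed.

Lemma eq_syz_span c c' : (forall t, c t = c' t) -> syz_span c -> syz_span c'.
Proof. by move=> /funext ->. Qed.

Lemma syz_span_mul (a : A) l t : syz_span (fun t' => a * syz l t t').
Proof.
exists (fun l' t0 => ((l' == l) && (t0 == t))%:R * a) => t'.
rewrite (bigD1 l) //= [X in _ = _ + X]big1 ?addr0 => [|l' /negPf l'l]; last first.
  by rewrite big1 // => t0 _; rewrite l'l !mul0r.
rewrite (bigD1 t) //= [X in _ = _ + X]big1 ?addr0 => [|t0 /negPf t0t]; last first.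
  by rewrite t0t andbF !mul0r.
by rewrite !eqxx mul1r.
Qed.

Lemma syz_productE a l t t' :
  xv a * syz l t t' = \sum_s (syz_product a l t s t')%:~R *: qm s.
Proof.
rewrite /syz mulrBr -scalerAr xv_mulZ scaler_sumr mulr_sumr.
under [X in _ - X]eq_bigr => j _ do rewrite -scalerAr xv_mulZ scaler_sumr.
rewrite exchange_big -sumrB; apply: eq_bigr => s _ /=.
under [X in _ - X]eq_bigr => j _ do rewrite scalerA.
rewrite -scaler_suml scalerA -scalerBl; congr (_ *: _).
have natI (b : bool) : b%:R = (b%:Z)%:~R :> k by [].
by rewrite /syz_product sum4 /rel !natI rmorphB !rmorphD !rmorphM /=.
Qed.

(** [syz_table] produces twice the target, and 2 is invertible. *)
Lemma syz_span_quad s t :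
  syz_span (fun t' => \sum_s' (syz_target s t s' t')%:~R *: qm s').
Proof.
pose w (x : 'I_4 * 'I_4 * 'I_4 * int) t' : A :=
  (x.2)%:~R *: (xv x.1.1.1 * syz x.1.1.2 x.1.2 t').
have spanw x : syz_span (w x) by apply: syz_spanZ; exact: syz_span_mul.
have := syz_spanZ (2%:R^-1) (syz_span_sum (nth [::] syz_table (4 * s + t)) spanw).
apply: eq_syz_span => t'.
transitivity (\sum_s' (2%:R^-1 * (2 * syz_target s t s' t')%:~R) *: qm s'); last first.
  by apply: eq_bigr => s' _; rewrite intrM mulKf // two_neq0.
under [RHS]eq_bigr => s' _ do rewrite -syz_tableE -scalerA.
rewrite -scaler_sumr; congr (_ *: _).
elim: (nth _ _ _) => [|x r IH] /=.
  by rewrite big_nil big1 // => s' _; rewrite scale0r.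
rewrite big_cons IH; under [RHS]eq_bigr => s' _ do rewrite rmorphD rmorphM scalerDl -scalerA.
by rewrite big_split /= -scaler_sumr /w syz_productE.
Qed.

Lemma syz_syzygy l t : \sum_t' syz l t t' *: dual_gen t' = 0.
Proof.
have rk t' i : crho t' (xv i) = 0 by have [_ _ ->] := coords_xv pi_surj pi_ker i.
have syzE t' : [/\ ceps (syz l t t') = 0, crho t' (syz l t t') = 0 & forall l',
    ctau l' (syz l t t') = (t == t')%:R * (l' == l)%:R - \sum_j
      (rel k t l j * (piv_sign j)%:~R * (piv_gen j == t')%:R) * (l' == piv_var j)%:R].
  pose G j := rel k t l j * (piv_sign j)%:~R * (piv_gen j == t')%:R.
  have [s1 s2 s3] := coords_sum G (fun j => xv (piv_var j)).
  have [z1 z2 z3] := coordsZ pi_surj pi_ker (t == t')%:R (xv l).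
  have [x1 x2 x3] := coords_xv pi_surj pi_ker l.
  rewrite /syz; split=> [||l'].
  - rewrite (raddfB ceps) /= z1 x1 s1 mulr0 big1 ?subr0 // => j _.
    by have [-> _ _] := coords_xv pi_surj pi_ker (piv_var j); rewrite mulr0.
  - rewrite (raddfB (crho t')) /= z3 rk mulr0 s3 big1 ?subr0 // => j _.
    by rewrite rk mulr0.
  rewrite (raddfB (ctau l')) /= z2 x2 s2; congr (_ - _); apply: eq_bigr => j _.
  by have [_ -> _] := coords_xv pi_surj pi_ker (piv_var j).
apply/colP; elim/ordN_ind => [|j|s]; rewrite [RHS]mxE.
- by rewrite dual_gen_one big1 // => t' _; have [_ -> _] := syzE t'.
- rewrite dual_gen_lin.
  transitivity (\sum_t' \sum_l' ((t == t')%:R * (l' == l)%:R * rel k t' l' j) -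
     \sum_t' \sum_l' \sum_i (rel k t l i * (piv_sign i)%:~R * (piv_gen i == t')%:R) *
        (l' == piv_var i)%:R * rel k t' l' j).
    rewrite -sumrB; apply: eq_bigr => t' _; rewrite -sumrB; apply: eq_bigr => l' _.
    by have [_ _ ->] := syzE t'; rewrite mulrBl mulr_suml.
  rewrite sum_rotate (bigD1 t) //= [X in _ + X - _]big1 ?addr0 => [|t' tt']; last first.
    by rewrite big1 // => l' _; rewrite eq_sym (negPf tt') !mul0r.
  rewrite (bigD1 l) //= [X in _ + X - _]big1 ?addr0 => [|l' ll']; last first.
    by rewrite (negPf ll') mulr0 mul0r.
  rewrite !eqxx !mul1r (bigD1 j) //= [X in _ - (_ + X)]big1 ?addr0 => [|i ij].
    rewrite (bigD1 (piv_gen j)) //= [X in _ - (_ + X)]big1 ?addr0 => [|t' tj]; last first.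
      by rewrite big1 // => l' _; rewrite eq_sym (negPf tj) mulr0 !mul0r.
    rewrite (bigD1 (piv_var j)) //= [X in _ - (_ + X)]big1 ?addr0 => [|l' lj]; last first.
      by rewrite (negPf lj) mulr0 mul0r.
    by rewrite !eqxx !mulr1 -mulrA /rel -intrM pivot_dual eqxx mulr1 subrr.
  rewrite (bigD1 (piv_gen i)) //= [X in _ + X]big1 ?addr0 => [|t' ti]; last first.
    by rewrite big1 // => l' _; rewrite eq_sym (negPf ti) mulr0 !mul0r.
  rewrite (bigD1 (piv_var i)) //= [X in _ + X]big1 ?addr0 => [|l' li]; last first.
    by rewrite (negPf li) mulr0 mul0r.
  by rewrite !eqxx !mulr1 -mulrA /rel -intrM pivot_dual (negPf ij) mulr0.
by rewrite dual_gen_quad; have [-> _ _] := syzE s.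
Qed.

(** Evaluating a relation on quadrics, variables and [1] gives [ce], [ct] and [cr]. By [ce] the
    constant parts vanish. By [ct] the pivot corrections cancel, so the linear part is a combination
    of the [syz l t]. By [cr] the quadratic part has trace 0, hence is spanned by the elements
    [syz_target]. *)
Lemma syzygies_linear (c : 'I_4 -> A) : \sum_t c t *: dual_gen t = 0 -> syz_span c.
Proof.
move=> c0; have c0i i : (\sum_t c t *: dual_gen t : 'cV_N) i 0 = 0 by rewrite c0 mxE.
have ce t : ceps (c t) = 0 by rewrite -dual_gen_quad.
have ct j : \sum_t \sum_l ctau l (c t) * rel k t l j = 0 by rewrite -dual_gen_lin.
have cr : \sum_t crho t (c t) = 0 by rewrite -dual_gen_one.
have span1 : syz_span (fun t' => \sum_l \sum_t ctau l (c t) *: syz l t t').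
  apply: syz_span_sum => l; apply: syz_span_sum => t; apply: syz_spanZ.
  by apply: eq_syz_span (syz_span_mul 1 l t) => t'; rewrite mul1r.
have span2 : syz_span (fun t' => \sum_s \sum_t crho s (c t) *:
    (\sum_s' (syz_target s t s' t')%:~R *: qm s')).
  by apply: syz_span_sum => s; apply: syz_span_sum => t; apply: syz_spanZ;
     exact: syz_span_quad.
apply: eq_syz_span (syz_spanD span1 span2) => t'.
rewrite [RHS]alg_decomp ce scale0r add0r; congr (_ + _).
  under eq_bigr => l _ do under eq_bigr => t _ do rewrite /syz scalerBr scaler_sumr scalerA.
  under eq_bigr => l _ do rewrite sumrB.
  rewrite sumrB [X in _ - X](_ : _ = 0) ?subr0.
    apply: eq_bigr => l _; rewrite (bigD1 t') //= eqxx mulr1 big1 ?addr0 // => t tt'.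
    by rewrite (negPf tt') mulr0 scale0r.
  rewrite exchange_big sum_rotate big1 // => j _ /=.
  under eq_bigr => t _ do under eq_bigr => l _ do rewrite scalerA !mulrA -mulrA mulrC -scalerA.
  by under eq_bigr => t _ do rewrite -scaler_sumr -scaler_suml;
     rewrite -scaler_sumr -scaler_suml ct scale0r scaler0.
have targetE s t : \sum_s' (syz_target s t s' t')%:~R *: qm s' =
    (t' == t)%:R *: qm s - ((s == t) && (t' == o0))%:R *: qm o0.
  have natI (b : bool) : (b%:Z)%:~R = b%:R :> k by [].
  under eq_bigr => s' _ do rewrite /syz_target mulrzBr !natI scalerBl.
  rewrite sumrB (bigD1 s) //= eqxx /= [X in _ + X - _]big1 ?addr0 => [|s' /negPf s's]; last first.
    by rewrite s's scale0r.
  rewrite (bigD1 o0) //= [X in _ - (_ + X)]big1 ?addr0 => [|s' /negPf s'0]; last first.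
    by rewrite s'0 andbF scale0r.
  by [].
under eq_bigr => s _ do under eq_bigr => t _ do rewrite targetE scalerBr !scalerA.
under eq_bigr => s _ do rewrite sumrB.
rewrite sumrB [X in _ - X](_ : _ = 0) ?subr0.
  apply: eq_bigr => s _; rewrite (bigD1 t') //= eqxx mulr1 big1 ?addr0 // => t tt'.
  by rewrite eq_sym (negPf tt') mulr0 scale0r.
transitivity ((\sum_s crho s (c s) * (t' == o0)%:R) *: qm o0); last first.
  by rewrite -mulr_suml cr mul0r scale0r.
rewrite scaler_suml; apply: eq_bigr => s _.
rewrite (bigD1 s) //= eqxx /= big1 ?addr0 // => t ts.
by rewrite eq_sym (negPf ts) mulr0 scale0r.
Qed.

Lemma dual_linearly_presented : linearly_presented W (- 2%:Z).
Proof.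
exists 4, dual_gen; split; [exact: dual_gen_deg|exact: dual_gen_generates|exact: dual_type|].
move=> c /syzygies_linear [b bE].
exists #|{: 'I_4 * 'I_4}|, (fun i => syz (enum_val i).1 (enum_val i).2),
  (fun i => b (enum_val i).1 (enum_val i).2); split.
- by move=> i t; exact: syz_deg.
- by move=> i; exact: syz_syzygy.
move=> t'; rewrite bE pair_big /= (reindex (@enum_val _ [pred x : 'I_4 * 'I_4 | true])) //.
by exists enum_rank => x _; [exact: enum_valK|exact: enum_rankK].
Qed.

End ConcreteCanonical.

(** * Tools for presentations: algebra homomorphisms, linear forms, spans of quadrics in a kernel *)

Section HbasisConsequences.
Variables (k : fieldType) (A : gradedAlg k) (m : nat) (H : hbasis A m).

Lemma hbasis_is_grading : is_grading (@adeg k A).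
Proof.
have -> : @adeg k A = fun d a => forall i, hco H a 0 i != 0 -> d = (hdeg H i)%:Z.
  by apply/funext => d; apply/funext => a; rewrite propeqE; exact: hadeg.
apply: (@coordinate_grading k A m (fun a i => hco H a 0 i) (fun i => (hdeg H i)%:Z)
  (fun d a => \sum_i (if (hdeg H i)%:Z == d then hco H a 0 i else 0) *: hb H i)).
- by move=> a b i; rewrite raddfB [LHS]mxE [X in _ + X]mxE.
- by move=> a a0; rewrite [a](hcoK H) big1 // => i _; rewrite a0 scale0r.
move=> d a i; pose c : 'rV[k]_m := \row_i (if (hdeg H i)%:Z == d then hco H a 0 i else 0).
rewrite (eq_bigr (fun i => c 0 i *: hb H i)) => [|l _]; last by rewrite [c 0 l]mxE.
by rewrite hco_sum [LHS]mxE.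
Qed.

Lemma hbasis_artinian : artinian A.
Proof. by exists m, (hb H) => a; exists (fun i => hco H a 0 i); exact: hcoK. Qed.

End HbasisConsequences.

Section AlgebraHom.
Variables (k : fieldType) (A : comAlgType k) (n : nat) (h : 'I_n -> A).

Definition alg_hom (p : {mpoly k[n]}) : A := mmap (in_alg A) h p.

Fact alg_hom_linear : linear alg_hom.
Proof. by move=> c p q; rewrite /alg_hom mmapD mmapZ /= mulr_algl. Qed.

Fact alg_hom_monoid : monoid_morphism alg_hom.
Proof. by split=> [|p q]; rewrite /alg_hom ?rmorph1 ?rmorphM. Qed.

HB.instance Definition _ := GRing.isLinear.Build k {mpoly k[n]} A _ alg_hom
  alg_hom_linear.
HB.instance Definition _ := GRing.isMonoidMorphism.Build {mpoly k[n]} A alg_hom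
  alg_hom_monoid.

Lemma alg_homX j : alg_hom 'X_j = h j.
Proof. by rewrite /alg_hom mmapX mmap1U. Qed.

End AlgebraHom.

Lemma homog1E (k : fieldType) (n : nat) (p : {mpoly k[n]}) :
  p \is 1.-homog -> p = \sum_j p@_U_(j) *: 'X_j.
Proof.
move=> /dhomogP p1; apply/mpolyP => l; rewrite raddf_sum /=.
have [lp|/memN_msupp_eq0 l0] := boolP (l \in msupp p).
  have /eqP := p1 _ lp; rewrite mdeg_eq1 => /existsP [j /eqP ->].
  rewrite (bigD1 j) //= mcoeffZ mcoeffX eqxx mulr1 big1 ?addr0 // => i /negPf ij.
  by rewrite mcoeffZ mcoeffXU ij mulr0.
rewrite l0 big1 // => j _; rewrite mcoeffZ mcoeffX.
by case: eqP => [jl|_]; rewrite ?mulr0 // jl l0 mul0r.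
Qed.

Section QuadricSpan.
Variables (k : fieldType) (A : gradedAlg k) (n : nat).
Variable pi : {lrmorphism {mpoly k[n]} -> A}.
Local Notation S := {mpoly k[n]}.

Definition quadric_span (p : S) := exists (m : nat) (q c : 'I_m -> S),
  (forall i, q i \is 2.-homog /\ pi (q i) = 0) /\ p = \sum_i c i * q i.

Lemma quadric_span0 : quadric_span 0.
Proof. by exists 0%N, (fun=> 0), (fun=> 0); split=> [[]//|]; rewrite big_ord0. Qed.

Lemma quadric_spanD p p' : quadric_span p -> quadric_span p' -> quadric_span (p + p').
Proof.
move=> [m [q [c [hq ->]]]] [m' [q' [c' [hq' ->]]]].
exists (m + m')%N, (fun i => match split i with inl j => q j | inr j => q' j end),
  (fun i => match split i with inl j => c j | inr j => c' j end); split.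
  by move=> i; case: (split i).
rewrite big_split_ord; congr (_ + _); apply: eq_bigr => i _.
  by rewrite (unsplitK (inl _)).
by rewrite (unsplitK (inr _)).
Qed.

Lemma quadric_spanM a p : quadric_span p -> quadric_span (a * p).
Proof.
move=> [m [q [c [hq ->]]]]; exists m, q, (fun i => a * c i); split=> //.
by rewrite mulr_sumr; apply: eq_bigr => i _; rewrite mulrA.
Qed.

Lemma quadric_span_gen q : q \is 2.-homog -> pi q = 0 -> quadric_span q.
Proof.
by move=> q2 q0; exists 1%N, (fun=> q), (fun=> 1); split=> //; rewrite big_ord1 mul1r.
Qed.

Lemma quadric_span_sum (I : Type) (s : seq I) (F : I -> S) :
  (forall i, quadric_span (F i)) -> quadric_span (\sum_(i <- s) F i).
Proof. by move=> hF; elim/big_ind: _ => //; [exact: quadric_span0|exact: quadric_spanD]. Qed.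

Lemma quadric_span_ker p : quadric_span p -> pi p = 0.
Proof.
move=> [m [q [c [hq ->]]]]; rewrite raddf_sum big1 // => i _.
by rewrite /= rmorphM /= (proj2 (hq i)) mulr0.
Qed.

End QuadricSpan.

Lemma certificate_k (k : fieldType) (i j x y : 'I_4) :
  \sum_(t < 4) rel k t i j * (entry g_table t x y)%:~R =
  \sum_(t < 4) (entry c1_table t i y)%:~R * rel k t j x +
  \sum_(t < 4) (entry c2_table t i j)%:~R * rel k t x y.
Proof.
have := congr1 (fun z : int => z%:~R : k) (certificate_int i j x y).
rewrite /rel rmorphD /= !rmorph_sum /=.
under eq_bigr => t _ do rewrite intrM.
move=> ->; congr (_ + _); apply: eq_bigr => t _; exact: intrM.
Qed.

(** * Non-Koszulness through retracts, and the properties of [S/I] *)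

Section Retract.
Variables (k : fieldType) (A : gradedAlg k) (pi : {lrmorphism {mpoly k[4]} -> A}).
Hypothesis k_char0 : [pchar k] =i pred0.
Hypothesis pi_surj : forall a, exists p, pi p = a.
Hypothesis pi_gen : forall i : 'I_6, pi (gensI k)`_i = 0.
Hypothesis pi_ker : forall p, pi p = 0 -> nf p = 0.
Hypothesis pi_deg : forall d a, adeg d a <-> exists2 p, poly_deg d p & a = pi p.

Local Notation H := (alg_basis pi_surj pi_gen pi_ker pi_deg).
Local Notation gA := (alg_graded pi_surj pi_gen pi_ker pi_deg).
Local Notation xv := (xv pi).
Local Notation qm := (qmonomial xv).
Local Notation ceps := (ceps pi_surj pi_ker).
Local Notation ctau := (ctau pi_surj pi_ker).
Local Notation crho := (crho pi_surj pi_ker).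

Lemma qm_deg t : adeg 2 (qm t).
Proof.
by rewrite -(rb_quad pi) -[2]/(2%N%:Z) -(rdeg_quad t); exact: (hb_deg H).
Qed.

Lemma retract_not_koszul (B : gradedAlg k) (phi : {lrmorphism A -> B})
    (psi : {rmorphism B -> A}) :
  cancel phi psi -> (forall d a, adeg d a -> adeg d (phi a)) ->
  (forall d b, adeg d b -> adeg d (psi b)) ->
  (forall (eps : {lrmorphism B -> k^o}) b, is_residue_map eps -> eps b = eps (phi (psi b))) ->
  ~ koszul B.
Proof.
move=> phiK phi_deg psi_deg eps_psi.
have epsE (eps : {lrmorphism B -> k^o}) b : is_residue_map eps ->
    eps b = ceps (psi b) :> k.
  move=> res; have x0 j : eps (phi (xv j)) = 0 :> k.
    by apply: (res 1) => //; apply: phi_deg; exact: (xv_deg pi_deg).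
  have q0 t : eps (phi (qm t)) = 0 :> k.
    by apply: (res 2) => //; apply: phi_deg; exact: qm_deg.
  rewrite eps_psi // [in LHS](alg_decomp pi_surj pi_gen pi_ker (psi b)).
  rewrite !raddfD /= !raddf_sum /= big1 => [|j _]; last first.
    by rewrite 2!linearZ /= [eps _]x0 scaler0.
  rewrite big1 => [|t _]; last by rewrite 2!linearZ /= [eps _]q0 scaler0.
  by rewrite !addr0 2!linearZ /= !rmorph1 [LHS]mulr1.
(* With [v] the four variables, the sum of the [u_j v_j] is the generator [y^2 + z^2]; the socle
   element [m] is [z^2]. *)
pose u (j : 'I_4) : B := if (1 < j)%N then phi (xv j) else 0.
pose tau j : {additive B -> k} := ctau j \o psi.
pose rhot t : {additive B -> k} := crho t \o psi.
have mul_c a b := coords_mul pi_surj pi_ker a b.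
have [x1 x2 x3] : [/\ forall j, ceps (xv j) = 0, forall j i, ctau i (xv j) = (i == j)%:R &
    forall j t, crho t (xv j) = 0].
  by split=> [j|j i|j t]; have [] := coords_xv pi_surj pi_ker j.
have [q1 q2 q3] := coords_qmonomial pi_surj pi_ker o3.
apply: (@not_koszul k B 4 4 (fun j => phi (xv j)) u (phi (qm o3)) tau rhot (rel k)
  (fun t x y : 'I_4 => (entry g_table t x y)%:~R) (fun t x y : 'I_4 => (entry c1_table t x y)%:~R)
  (fun t x y : 'I_4 => (entry c2_table t x y)%:~R)).
- move=> eps j a b res; rewrite !epsE // /tau /= rmorphM.
  by have [_ -> _] := mul_c (psi a) (psi b).
- move=> eps t a b res; rewrite !epsE // /rhot /= rmorphM.
  by have [_ _ ->] := mul_c (psi a) (psi b).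
- move=> t a /psi_deg /(hadeg H) a1; apply/eqP/negPn/negP => /a1.
  by rewrite /= rdeg_quad.
- by move=> j; apply: phi_deg; exact: (xv_deg pi_deg).
- move=> j; rewrite /u; case: ifP => _; first by apply: phi_deg; exact: (xv_deg pi_deg).
  rewrite -(raddf0 phi); apply: phi_deg; exact: (grading0 (galg_grading gA)).
- by apply: phi_deg; exact: qm_deg.
- by move=> i j; rewrite /tau /= phiK x2.
- by move=> j; rewrite /tau /= phiK q2.
- rewrite sum4 /u /= !mul0r !add0r.
  have [_ _ _ _ [_ r5]] := xv_relations pi_gen.
  have := congr1 phi r5; rewrite !expr2 raddf0 => <-.
  by rewrite (rmorphD phi) !(rmorphM phi).
- move=> j; rewrite /u; case: ifP => _; last by rewrite mulr0.
  by rewrite -(rmorphM phi) mulrC (xv_qmonomial pi_gen) raddf0.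
- exact: certificate_k.
have tu x y : ctau x (psi (u y)) = ((1 < y)%N && (x == y))%:R.
  rewrite /u; case: ifP => _ /=; first by rewrite phiK x2.
  by rewrite !raddf0.
(* Only the quadratic coordinate of [z^2] contributes, and the pairing reduces to the entries
   [(3,2,2)] and [(3,3,3)] of [g_table], namely [2 + 0]. *)
rewrite (bigD1 o3) //= [X in _ + X]big1 ?addr0 => [|t /negPf t3]; last first.
  by rewrite /rhot /= phiK q3 t3 mul0r.
rewrite /rhot /= phiK q3 eqxx mul1r.
rewrite !sum4 !tu /= !mul0r !mul1r !add0r !addr0.
exact: (two_neq0 k_char0).
Qed.

Lemma short_not_koszul : ~ koszul A.
Proof. exact: (@retract_not_koszul A idfun idfun). Qed.

Lemma short_canonical : is_canonical_module pi (dual_graded H).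
Proof.
apply: (@dual_is_canonical k A _ H gA 3 pi (pi_presentation pi_surj pi_deg) 2) => i.
by elim/ordN_ind: i => [|j|t]; rewrite /= ?rdeg1 ?rdeg_lin ?rdeg_quad.
Qed.

Lemma short_superlevel : superlevel pi.
Proof.
exists (dual_graded H); first exact: short_canonical.
exists (- 2%:Z); split; last exact: (dual_linearly_presented k_char0).
exists 4, (dual_gen pi_surj pi_gen pi_ker pi_deg); split; first exact: dual_gen_deg.
exact: dual_gen_generates.
Qed.

Lemma short_type : has_type pi 4.
Proof. by exists (dual_graded H); [exact: short_canonical|exact: dual_type]. Qed.

Lemma short_regularity : has_regularity pi 2.
Proof.
apply: (@kres_regularity k A _ H gA 3 pi (pi_presentation pi_surj pi_deg) 2) => [i|].
  by elim/ordN_ind: i => [|j|t]; rewrite /= ?rdeg1 ?rdeg_lin ?rdeg_quad.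
by exists (i_quad o0); rewrite /= rdeg_quad.
Qed.

End Retract.

Lemma lrmorph_cst (k : fieldType) (n : nat) (B : comAlgType k)
  (f : {lrmorphism {mpoly k[n]} -> B}) c : f c%:MP = c%:A.
Proof. by rewrite -[c%:MP]mulr1 mul_mpolyC linearZ /= rmorph1. Qed.

Lemma lrmorph_deg (k : fieldType) (n : nat) (B : gradedAlg k)
  (f : {lrmorphism {mpoly k[n]} -> B}) :
  is_graded_algebra B -> (forall i, adeg 1 (f 'X_i)) ->
  forall d p, poly_deg d p -> adeg d (f p).
Proof.
move=> gB fX d p; have [g0 gN _ _] := galg_grading gB.
elim/poly_deg_ind => {d p} [d|d p q hp hq|c|d j p hp].
- by rewrite raddf0; exact: g0.
- by rewrite raddfD /= -[f q]opprK; apply: (gN) => //; rewrite -sub0r; apply: (gN).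
- by rewrite lrmorph_cst; apply: (galgZ gB); exact: (galg1 gB).
- by rewrite rmorphM /= addrC; apply: (galgM gB).
Qed.

(** * The idealization *)

Section Idealization.
Variables (k : fieldType) (A : gradedAlg k) (pi : {lrmorphism {mpoly k[4]} -> A}).
Hypothesis k_char0 : [pchar k] =i pred0.
Hypothesis pi_surj : forall a, exists p, pi p = a.
Hypothesis pi_gen : forall i : 'I_6, pi (gensI k)`_i = 0.
Hypothesis pi_ker : forall p, pi p = 0 -> nf p = 0.
Hypothesis pi_deg : forall d a, adeg d a <-> exists2 p, poly_deg d p & a = pi p.
Hypothesis pi_kerI : forall p, pi p = 0 ->
  exists c : 'I_6 -> {mpoly k[4]}, p = \sum_i c i * (gensI k)`_i.

Local Notation H := (alg_basis pi_surj pi_gen pi_ker pi_deg).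
Local Notation gA := (alg_graded pi_surj pi_gen pi_ker pi_deg).
Local Notation xv := (xv pi).
Local Notation rco := (rco pi_surj pi_ker).
Local Notation W0 := (dual_graded H).
Local Notation N := (1 + (4 + 4))%N.
Local Notation dual_gen := (dual_gen pi_surj pi_gen pi_ker pi_deg).

Variables (M : gradedMod A) (th : {linear W0 -> M}) (ze : M -> W0).
Hypotheses (thK : cancel th ze) (zeK : cancel ze th).
Hypothesis th_deg : forall d f, mdg d (th f) <-> mdg (- 3 + d) f.
Hypothesis M_Z : forall d e (a : A) (w : M), adeg d a -> mdg e w -> mdg (d + e) (a *: w).

Local Notation Rt := (idealization_alg M).

Fact ze_linear : linear ze.
Proof. by move=> a w w'; apply: (can_inj thK); rewrite linearP !zeK. Qed.
HB.instance Definition _ := GRing.isLinear.Build A M W0 _ ze ze_linear.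

Definition rt_inl (a : A) : Rt := (a, 0).
Definition rt_inr (w : M) : Rt := (0, w).
Definition rt_fst (x : Rt) : A := x.1.

Lemma rtM (x y : Rt) : x * y = (x.1 * y.1, x.1 *: y.2 + y.1 *: x.2) :> Rt.
Proof. by []. Qed.
Lemma rtD (x y : Rt) : x + y = (x.1 + y.1, x.2 + y.2) :> Rt.
Proof. by []. Qed.
Lemma rtZ c (x : Rt) : c *: x = (c *: x.1, c%:A *: x.2) :> Rt.
Proof. by []. Qed.

Fact rt_inl_linear : linear rt_inl.
Proof. by move=> c a b; rewrite rtZ rtD /rt_inl /= scaler0 addr0. Qed.
Fact rt_inl_monoid : monoid_morphism rt_inl.
Proof. by split=> // a b; rewrite rtM /rt_inl /= !scaler0 addr0. Qed.
HB.instance Definition _ := GRing.isLinear.Build k A Rt _ rt_inl rt_inl_linear.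
HB.instance Definition _ := GRing.isMonoidMorphism.Build A Rt rt_inl rt_inl_monoid.

Fact rt_fst_additive : zmod_morphism rt_fst.
Proof. by []. Qed.
Fact rt_fst_monoid : monoid_morphism rt_fst.
Proof. by []. Qed.
HB.instance Definition _ := GRing.isZmodMorphism.Build Rt A rt_fst rt_fst_additive.
HB.instance Definition _ := GRing.isMonoidMorphism.Build Rt A rt_fst rt_fst_monoid.

Fact rt_inr_additive : zmod_morphism rt_inr.
Proof. by move=> w w'; rewrite /rt_inr; congr (_, _); rewrite subr0. Qed.
HB.instance Definition _ := GRing.isZmodMorphism.Build M Rt rt_inr rt_inr_additive.

Lemma rt_eta (x : Rt) : x = rt_inl x.1 + rt_inr x.2.
Proof. by case: x => a w; rewrite rtD /= addr0 add0r. Qed.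

Lemma rt_inrZ a w : rt_inl a * rt_inr w = rt_inr (a *: w).
Proof. by rewrite rtM /rt_inl /rt_inr /= mulr0 scale0r addr0. Qed.

Lemma rt_inrM w w' : rt_inr w * rt_inr w' = 0.
Proof. by rewrite rtM /rt_inr /= mulr0 !scale0r addr0. Qed.

Lemma dual_scale_alg c (f : W0) : c%:A *: f = c *: (f : 'cV[k]_N) :> 'cV[k]_N.
Proof. by rewrite dual_scaleE linearZ /= rho1 -scalemxAl mul1mx. Qed.

Definition rtb (i : 'I_(N + N)) : Rt :=
  match split i with
  | inl j => rt_inl (rb pi j)
  | inr j => rt_inr (th (delta_mx j 0 : 'cV[k]_N))
  end.
Definition rtco (x : Rt) : 'rV[k]_(N + N) := row_mx (rco x.1) (ze x.2 : 'cV[k]_N)^T.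
(** A functional dual to degree [d] has degree [-d], hence [3 - d] after the shift. The truncated
    subtraction is harmless since [d <= 2]. *)
Definition rtdeg (i : 'I_(N + N)) : nat :=
  match split i with inl j => rdeg j | inr j => 3 - rdeg j end.

Lemma rt_sum (c : 'rV[k]_(N + N)) : \sum_i c 0 i *: rtb i =
  (\sum_j lsubmx c 0 j *: rb pi j, th ((rsubmx c)^T : 'cV[k]_N)) :> Rt.
Proof.
rewrite [RHS]rt_eta /= big_split_ord raddf_sum /=; congr (_ + _).
  by apply: eq_bigr => j _; rewrite /rtb (unsplitK (inl _)) mxE linearZ.
have -> : ((rsubmx c)^T : W0) = \sum_j (rsubmx c 0 j)%:A *: (delta_mx j 0 : W0).
  rewrite [(rsubmx c)^T]matrix_sum_delta; apply: eq_bigr => j _.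
  by rewrite big_ord1 mxE dual_scale_alg.
rewrite !raddf_sum; apply: eq_bigr => j _ /=.
rewrite /rtb (unsplitK (inr _)) linearZ /= rtZ mxE; congr (_, _).
by rewrite /= scaler0.
Qed.

Lemma rtcoK x : x = \sum_i rtco x 0 i *: rtb i.
Proof.
rewrite rt_sum row_mxKl row_mxKr trmxK zeK; case: x => a w; congr (_, _).
exact: rcoK.
Qed.

Lemma rtco_sum (c : 'rV[k]_(N + N)) : rtco (\sum_i c 0 i *: rtb i) = c.
Proof. by rewrite rt_sum /rtco /= thK trmxK (rco_sum pi_surj pi_ker) hsubmxK. Qed.

Lemma rdeg_le2 i : (rdeg i <= 2)%N.
Proof. by elim/ordN_ind: i => [|j|t]; rewrite ?rdeg1 ?rdeg_lin ?rdeg_quad. Qed.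

Lemma rt_adeg d (x : Rt) : adeg d x <-> forall i, rtco x 0 i != 0 -> d = (rtdeg i)%:Z.
Proof.
have shift i : - 3 + (3 - rdeg i)%:Z = - (rdeg i)%:Z.
  by rewrite -subzn 1?(leq_trans (rdeg_le2 i)) // addrA addNr add0r.
split.
  case=> x1 x2 i; rewrite /rtco /rtdeg; case: (split_ordP i) => j ->.
    by rewrite row_mxEl; exact: (iffLR (hadeg H _ _) x1).
  rewrite row_mxEr mxE => nz.
  move: x2; rewrite -(zeK x.2) => /th_deg /(_ _ nz); rewrite -shift.
  exact: addrI.
move=> hx; split.
  apply/(hadeg H) => j nz; have := hx (lshift N j); rewrite /rtco /rtdeg row_mxEl.
  by rewrite (unsplitK (inl _)); apply.
rewrite -(zeK x.2); apply/th_deg => j nz.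
have := hx (rshift N j); rewrite /rtco /rtdeg row_mxEr (unsplitK (inr _)) mxE => /(_ nz) ->.
exact: shift.
Qed.

Definition rt_basis : hbasis Rt (N + N) := HBasis rtcoK rtco_sum rt_adeg.

Lemma rt_deg0 d : @mdg k A M d 0.
Proof. by rewrite -(raddf0 th); apply/th_deg => i; rewrite mxE eqxx. Qed.

Lemma rt_inl_deg d a : adeg d a -> adeg d (rt_inl a).
Proof. by move=> ad; split=> //; exact: rt_deg0. Qed.

Lemma rt_inr_deg d f : mdg (- 3 + d) f -> adeg d (rt_inr (th f)).
Proof. by move=> fd; split; [exact: (grading0 (galg_grading gA))|apply/th_deg]. Qed.

Lemma rt_graded : is_graded_algebra Rt.
Proof.
have degD d (w w' : M) : mdg d w -> mdg d w' -> mdg d (w + w').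
  rewrite -(zeK w) -(zeK w') -raddfD => /th_deg wd /th_deg wd'; apply/th_deg => i.
  rewrite mxE; have [->|/wd //] := eqVneq ((ze w : 'cV_N) i 0) 0.
  by rewrite add0r; exact: wd'.
split.
- exact: hbasis_is_grading rt_basis.
- exact/rt_inl_deg/(galg1 gA).
- move=> d c x [x1 x2]; split; first exact: (galgZ gA).
  by rewrite -[d]add0r; apply: M_Z => //; apply: (galgZ gA); exact: (galg1 gA).
- move=> d e x y [x1 x2] [y1 y2]; split; first exact: (galgM gA).
  by apply: degD; [exact: M_Z|rewrite addrC; exact: M_Z].
Qed.

Lemma rt_not_koszul : ~ koszul Rt.
Proof.
apply: (@retract_not_koszul k A pi k_char0 pi_surj pi_gen pi_ker pi_deg Rt rt_inl rt_fst) => //.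
- exact: rt_inl_deg.
- by move=> d x [].
move=> eps x res; rewrite {1}[x]rt_eta raddfD /= [X in _ + X](_ : _ = 0) ?addr0 //.
(* The module summand squares to zero, so every algebra map to the field [k] kills it. *)
have : eps (rt_inr x.2) * eps (rt_inr x.2) = 0 by rewrite -rmorphM rt_inrM rmorph0.
by move=> /eqP; rewrite mulf_eq0 orbb => /eqP.
Qed.

Definition rt_var (i : 'I_(4 + 4)) : Rt :=
  match split i with
  | inl j => rt_inl (xv j)
  | inr t => rt_inr (th (dual_gen t))
  end.

Local Notation S4 := {mpoly k[4]}.
Local Notation S8 := {mpoly k[4 + 4]}.

Definition rt_pi : {lrmorphism S8 -> Rt} := alg_hom rt_var.
Definition emb : {lrmorphism S4 -> S8} := alg_hom (fun j => 'X_(lshift 4 j)).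
Definition yv (t : 'I_4) : S8 := 'X_(rshift 4 t).

Lemma embX j : emb 'X_j = 'X_(lshift 4 j).
Proof. exact: alg_homX. Qed.

Lemma rt_piX j : rt_pi 'X_(lshift 4 j) = rt_inl (xv j).
Proof. by rewrite [LHS]alg_homX /rt_var (unsplitK (inl _)). Qed.

Lemma rt_piY t : rt_pi (yv t) = rt_inr (th (dual_gen t)).
Proof. by rewrite [LHS]alg_homX /rt_var (unsplitK (inr _)). Qed.

Lemma rt_pi_emb p : rt_pi (emb p) = rt_inl (pi p).
Proof.
elim/mpoly_indX: p => [c|p q IHp IHq|j p IHp].
- by rewrite !lrmorph_cst linearZ /= rmorph1 linearZ /= rmorph1.
- by rewrite !raddfD /= IHp IHq.
- by rewrite !rmorphM /= embX rt_piX IHp.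
Qed.

Lemma emb_deg d p : poly_deg d p -> poly_deg d (emb p).
Proof.
elim/poly_deg_ind => {d p} [d|d p q hp hq|c|d j p hp].
- by rewrite raddf0; exact: poly_deg0.
- by rewrite raddfD; exact: poly_degD.
- by rewrite lrmorph_cst alg_mpolyC; exact: poly_degC.
- by rewrite rmorphM /= embX addrC; apply: poly_degM => //; exact: poly_degX.
Qed.

Lemma rt_var_deg i : adeg 1 (rt_var i).
Proof.
rewrite /rt_var; case: (split i) => [j|t].
  by apply: rt_inl_deg; exact: (xv_deg pi_deg).
by apply: rt_inr_deg; exact: dual_gen_deg.
Qed.

Lemma rt_presentation : is_presentation rt_pi.
Proof.
split=> [x|d p].
  have [p pE] := pi_surj x.1; have [c cE] :=
    dual_gen_generates (ze x.2 : W0).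
  have /fin_all_exists [q qE] : forall t, exists q, pi q = c t by move=> t; exact: pi_surj.
  exists (emb p + \sum_t emb (q t) * yv t).
  rewrite raddfD /= rt_pi_emb pE [RHS]rt_eta; congr (_ + _).
  rewrite raddf_sum -[in RHS](zeK x.2) cE !raddf_sum; apply: eq_bigr => t _ /=.
  by rewrite rmorphM /= rt_pi_emb qE rt_piY rt_inrZ linearZ.
apply: (lrmorph_deg rt_graded) => i.
by rewrite [rt_pi _]alg_homX; exact: rt_var_deg.
Qed.

Lemma rtdeg_le i : (rtdeg i <= 3)%N.
Proof.
rewrite /rtdeg; case: (split i) => j; last exact: leq_subr.
exact: leq_trans (rdeg_le2 j) _.
Qed.

(** The top degree 3 belongs to the functional dual to [1]. *)
Lemma rt_regularity : has_regularity rt_pi 3.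
Proof.
apply: (@kres_regularity k Rt _ rt_basis rt_graded 7 rt_pi rt_presentation 3 rtdeg_le).
by exists (rshift N i_one); rewrite /= /rtdeg (unsplitK (inr _)) rdeg1.
Qed.
Lemma rtco_r x i : rtco x 0 (rshift N i) = (ze x.2 : 'cV[k]_N) i 0.
Proof. by rewrite /rtco row_mxEr mxE. Qed.

(* The pairing of [R] with its dual makes [(r, f) |-> f 1] generate the dual of
   the idealization. *)
Lemma rt_gorenstein : gorenstein rt_pi.
Proof.
exists (dual_graded rt_basis).
  exact: (@dual_is_canonical k Rt _ rt_basis rt_graded 7 rt_pi rt_presentation 3 rtdeg_le).
pose phi : dual_graded rt_basis := (delta_mx (rshift N i_one) 0 : 'cV[k]_(N + N)).
have phiE (x : Rt) i : (x *: phi : 'cV_(N + N)) i 0 =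
    (ze (x * rtb i).2 : 'cV[k]_N) i_one 0.
  rewrite dual_scaleE mxE (bigD1 (rshift N i_one)) //= big1 ?addr0 => [|l /negPf lt].
    by rewrite [X in _ * X]mxE !eqxx mulr1 [LHS]mxE [LHS]rtco_r.
  by rewrite [X in _ * X]mxE lt mulr0.
have rho_one (a : A) (f : W0) : (a *: f : 'cV_N) i_one 0 = \sum_l rco a 0 l * (f : 'cV_N) l 0.
  rewrite dual_scaleE mxE; apply: eq_bigr => l _; congr (_ * _).
  by rewrite [LHS]mxE /= rb1 mulr1.
split.
  exists (fun=> phi) => f.
  pose F i := (f : 'cV[k]_(N + N)) i 0.
  (* The pairing exchanges the summands: values of [f] on the module give the ring component of [x],
     values on the ring its module component. *)
  pose x : Rt := rt_inl (\sum_i F (rshift N i) *: rb pi i) +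
    rt_inr (th (\col_i F (lshift N i) : 'cV[k]_N)).
  exists (fun=> x); rewrite big_ord1; apply/colP => i; rewrite phiE.
  have xE : x = (\sum_i F (rshift N i) *: rb pi i, th (\col_i F (lshift N i) : 'cV[k]_N)) :> Rt.
    by rewrite /x rtD /= addr0 add0r.
  rewrite xE rtM /rtb; case: (split_ordP i) => j ->.
    rewrite /= scaler0 add0r linearZ /= thK rho_one.
    rewrite (rco_rb pi_surj pi_ker) (bigD1 j) //= big1 ?addr0 => [|l /negPf lj].
      by rewrite !mxE !eqxx mul1r.
    by rewrite [X in X * _]mxE lj andbF mul0r.
  rewrite /= scale0r addr0 linearZ /= thK rho_one.
  pose c : 'rV[k]_N := \row_i F (rshift N i).
  rewrite [\sum_i F (rshift N i) *: _](eq_bigr (fun i => c 0 i *: rb pi i)) => [|l _]; last first.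
    by rewrite [c 0 l]mxE.
  rewrite (rco_sum pi_surj pi_ker) (bigD1 j) //= big1 ?addr0 => [|l /negPf lj]; last first.
    by rewrite [X in _ * X]mxE lj mulr0.
  by rewrite [X in _ * X]mxE !eqxx mulr1 [RHS]mxE.
move=> [|m'] e //= gen; have [c] := gen phi.
rewrite big_ord0 => /colP /(_ (rshift N i_one)); rewrite !mxE !eqxx => /eqP.
by rewrite oner_eq0.
Qed.

Lemma sum_rt_var (c : 'I_(4 + 4) -> k) : \sum_i c i *: rt_var i =
  (\sum_j c (lshift 4 j) *: xv j, th (\sum_t (c (rshift 4 t))%:A *: dual_gen t)) :> Rt.
Proof.
rewrite [RHS]rt_eta /= big_split_ord !raddf_sum /=; congr (_ + _).
  by apply: eq_bigr => j _; rewrite /rt_var (unsplitK (inl _)) linearZ.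
apply: eq_bigr => t _; rewrite /rt_var (unsplitK (inr _)) linearZ /= rtZ.
by congr (_, _); rewrite /= scaler0.
Qed.

Lemma rt_var_free (c : 'I_(4 + 4) -> k) : \sum_i c i *: rt_var i = 0 -> forall i, c i = 0.
Proof.
rewrite sum_rt_var => -[c1 c2] i; case: (split_ordP i) => j ->.
  have [_ s2 _] := coords_sum pi_surj pi_ker (fun j => c (lshift 4 j)) xv.
  have := s2 j; rewrite c1 raddf0 (bigD1 j) //= big1 ?addr0 => [|l /negPf lj].
    by have [_ -> _] := coords_xv pi_surj pi_ker j; rewrite eqxx mulr1.
  by have [_ -> _] := coords_xv pi_surj pi_ker l; rewrite eq_sym lj mulr0.
have d0 : \sum_t (c (rshift 4 t))%:A *: dual_gen t = 0.
  by apply: (can_inj thK); rewrite c2 raddf0.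
have := @dual_gen_quad k A pi pi_surj pi_gen pi_ker pi_deg (fun t : 'I_4 => (c (rshift 4 t))%:A) j.
rewrite d0 mxE; have [-> _ _] := coordsZ pi_surj pi_ker (c (rshift 4 j)) 1.
by have [-> _ _] := coords_one pi_surj pi_ker; rewrite mulr1.
Qed.

(** Degree 1 consists of the four variables and, since [3 - 2 = 1], of the functionals dual to the
    four quadrics. *)
Lemma rt_codim : has_codim rt_pi 8.
Proof.
split.
  move=> p p1; rewrite [in rt_pi p](homog1E p1) raddf_sum.
  rewrite (eq_bigr (fun i => p@_U_(i) *: rt_var i)) => [|i _]; last first.
    by rewrite /= linearZ /= [rt_pi _]alg_homX.
  by move=> /rt_var_free p0; rewrite [p](homog1E p1) big1 // => i _; rewrite p0 scale0r.
exists rt_var; split; [exact: rt_var_deg| |exact: rt_var_free].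
move=> x /rt_adeg x1.
have x0 i : rtdeg i != 1 -> rtco x 0 i = 0.
  by move=> /negP h; apply/eqP/negPn/negP => /x1 [] /esym /eqP.
have lE j : lsubmx (rtco x) 0 j = rtco x 0 (lshift N j) by rewrite [LHS]mxE.
exists (fun i => match split i with
  | inl j => rtco x 0 (lshift N (i_lin j)) | inr t => rtco x 0 (rshift N (i_quad t)) end).
rewrite sum_rt_var [LHS](rtcoK x) rt_sum; congr (_, _).
  rewrite sumN !lE x0 ?scale0r ?add0r; last by rewrite /rtdeg (unsplitK (inl _)) rdeg1.
  rewrite [X in _ + X]big1 ?addr0 => [|t _]; last first.
    by rewrite lE x0 ?scale0r // /rtdeg (unsplitK (inl _)) rdeg_quad.
  by apply: eq_bigr => j _; rewrite lE (unsplitK (inl _)) rb_lin.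
congr (th _); apply/colP => i; rewrite mxE [in LHS]mxE.
have -> : \sum_t (match split (rshift 4 t) with
    | inl j => rtco x 0 (lshift N (i_lin j)) | inr t => rtco x 0 (rshift N (i_quad t)) end)%:A *:
    dual_gen t = \sum_t rtco x 0 (rshift N (i_quad t)) *: (dual_gen t : 'cV[k]_N) :> 'cV_N.
  by apply: eq_bigr => t _; rewrite (unsplitK (inr _)) dual_scale_alg.
rewrite summxE; elim/ordN_ind: i => [|j|s].
- rewrite [LHS](_ : _ = 0) ?big1 // => [t _|]; first by rewrite !mxE mulr0.
  by apply: x0; rewrite /rtdeg (unsplitK (inr _)) rdeg1.
- rewrite [LHS](_ : _ = 0) ?big1 // => [t _|].
    by rewrite mxE [X in _ * X]mxE /i_lin /i_quad !eq_shift mulr0.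
  by apply: x0; rewrite /rtdeg (unsplitK (inr _)) rdeg_lin.
rewrite (bigD1 s) //= big1 ?addr0 => [|t /negPf ts].
  by rewrite [RHS]mxE [X in _ * X]mxE !eqxx mulr1.
by rewrite mxE [X in _ * X]mxE /i_quad !eq_shift eq_sym ts mulr0.
Qed.

Definition lin_syz (l t t' : 'I_4) : S4 :=
  (t == t')%:R *: 'X_l -
  \sum_j (rel k t l j * (piv_sign j)%:~R * (piv_gen j == t')%:R) *: 'X_(piv_var j).

Lemma pi_lin_syz l t t' : pi (lin_syz l t t') = syz pi l t t'.
Proof.
rewrite /lin_syz raddfB /= linearZ /= raddf_sum; congr (_ - _).
by apply: eq_bigr => j _; rewrite /= linearZ.
Qed.

Lemma lin_syz_deg l t t' : poly_deg 1 (lin_syz l t t').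
Proof.
have degZ c j : poly_deg 1 (c *: 'X_j : S4).
  by rewrite -mul_mpolyC -[1]add0r; apply: poly_degM; [exact: poly_degC|exact: poly_degX].
apply: poly_degD; first exact: degZ.
by apply: poly_degN; apply: poly_deg_sum => j _; exact: degZ.
Qed.

Local Notation span := (quadric_span rt_pi).

(** The products [yv i * yv t] are quadrics in the kernel, so modulo quadrics every polynomial has
    degree at most 1 in the new variables. *)
Lemma quadric_span_decomp p : exists (p0 : S4) (q : 'I_4 -> S4),
  span (p - (emb p0 + \sum_t emb (q t) * yv t)).
Proof.
elim/mpoly_indX: p => [c|p p' [p0 [q hp]] [p0' [q' hp']]|j p [p0 [q hp]]].
- exists c%:MP, (fun=> 0); rewrite big1 => [|t _]; last by rewrite raddf0 mul0r.
  rewrite addr0 lrmorph_cst alg_mpolyC subrr; exact: quadric_span0.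
- exists (p0 + p0'), (fun t => q t + q' t).
  have -> : p + p' - (emb (p0 + p0') + \sum_t emb (q t + q' t) * yv t) =
      (p - (emb p0 + \sum_t emb (q t) * yv t)) +
      (p' - (emb p0' + \sum_t emb (q' t) * yv t)); last exact: quadric_spanD hp hp'.
  under eq_bigr => t _ do rewrite raddfD mulrDl.
  by rewrite raddfD big_split /=; ring.
case: (split_ordP j) => i ->.
  exists ('X_i * p0), (fun t => 'X_i * q t).
  rewrite (_ : _ - _ = 'X_(lshift 4 i) * (p - (emb p0 + \sum_t emb (q t) * yv t))).
    exact: quadric_spanM.
  under eq_bigr => t _ do rewrite rmorphM /= embX -mulrA.
  by rewrite rmorphM /= embX -mulr_sumr; ring.
exists 0, (fun t => if t == i then p0 else 0).
have -> : \sum_t emb (if t == i then p0 else 0) * yv t = emb p0 * yv i.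
  by rewrite (bigD1 i) //= eqxx big1 ?addr0 // => t /negPf ->; rewrite raddf0 mul0r.
rewrite raddf0 add0r (_ : _ - _ = yv i * (p - (emb p0 + \sum_t emb (q t) * yv t)) +
    \sum_t emb (q t) * (yv i * yv t)).
  apply: quadric_spanD; first exact: quadric_spanM.
  apply: quadric_span_sum => t; apply: quadric_spanM; apply: quadric_span_gen.
    exact: (poly_degM (poly_degX _ _) (poly_degX _ _)).
  by rewrite rmorphM /= !rt_piY rt_inrM.
have -> : \sum_t emb (q t) * (yv i * yv t) = yv i * \sum_t emb (q t) * yv t.
  by rewrite mulr_sumr; apply: eq_bigr => t _; rewrite mulrCA.
by rewrite -/(yv i); ring.
Qed.

Lemma quadric_span_emb p : pi p = 0 -> span (emb p).
Proof.
move=> /pi_kerI [c ->]; rewrite raddf_sum; apply: quadric_span_sum => i.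
rewrite /= rmorphM; apply: quadric_spanM; apply: quadric_span_gen.
  apply: (emb_deg (d := 2)); rewrite gensE.
  have XX a b : poly_deg 2 ('X_a * 'X_b : S4).
    by rewrite -[2]/(1 + 1 : int); apply: poly_degM; exact: poly_degX.
  case: i => -[|[|[|[|[|[|//]]]]]] /= _; rewrite ?expr2;
    do ?[exact: XX | apply: (@poly_degD _ _ 2)].
by rewrite /= rt_pi_emb pi_gen raddf0.
Qed.

(** For a kernel element in that reduced form, the part free of [yv] lies in [I], and the
    coefficients of the [yv t] map to a syzygy of the dual. *)
Lemma rt_quadratic : quadratic rt_pi.
Proof.
move=> p pp0; suff : span p by [].
have [p0 [q hp]] := quadric_span_decomp p.
have /eqP := quadric_span_ker hp; rewrite raddfB /= pp0 sub0r oppr_eq0 raddfD /= rt_pi_emb.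
have -> : rt_pi (\sum_t emb (q t) * yv t) = rt_inr (th (\sum_t pi (q t) *: dual_gen t)).
  rewrite !raddf_sum; apply: eq_bigr => t _ /=.
  by rewrite rmorphM /= rt_pi_emb rt_piY rt_inrZ linearZ.
rewrite rtD /= addr0 add0r => /eqP [pip0 th0].
have /(syzygies_linear k_char0) [b bE] : \sum_t pi (q t) *: dual_gen t = 0.
  by apply: (can_inj thK); rewrite raddf0; exact: th0.
have /fin_all_exists [B BE] : forall l, exists B, forall t, pi (B t) = b l t.
  by move=> l; have [f fE] := fin_all_exists (fun t => pi_surj (b l t)); exists f.
rewrite -[p](subrK (emb p0 + \sum_t emb (q t) * yv t)).
apply: quadric_spanD => //; apply: quadric_spanD; first exact: quadric_span_emb.
(* Lifting the linear syzygies splits the sum into coefficients lying in [I] and multiples of forms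
   linear both in the old variables and in the [yv t]. *)
have -> : \sum_t emb (q t) * yv t =
    \sum_t emb (q t - \sum_l \sum_t0 B l t0 * lin_syz l t0 t) * yv t +
    \sum_l \sum_t0 emb (B l t0) * (\sum_t emb (lin_syz l t0 t) * yv t).
  under [X in _ = _ + X]eq_bigr => l _ do under eq_bigr => t0 _ do rewrite mulr_sumr.
  rewrite sum_rotate -big_split; apply: eq_bigr => t _ /=.
  rewrite raddfB mulrBl /=.
  have -> : emb (\sum_l \sum_t0 B l t0 * lin_syz l t0 t) * yv t =
      \sum_l \sum_t0 emb (B l t0) * (emb (lin_syz l t0 t) * yv t).
    rewrite (raddf_sum emb) mulr_suml; apply: eq_bigr => l _.
    rewrite (raddf_sum emb) mulr_suml; apply: eq_bigr => t0 _ /=.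
    by rewrite (rmorphM emb) mulrA.
  by rewrite subrK.
apply: quadric_spanD; apply: quadric_span_sum => t.
  rewrite mulrC; apply: quadric_spanM; apply: quadric_span_emb.
  rewrite raddfB /= bE raddf_sum /=; apply/eqP; rewrite subr_eq0; apply/eqP.
  apply: eq_bigr => l _; rewrite raddf_sum; apply: eq_bigr => t0 _ /=.
  by rewrite rmorphM /= pi_lin_syz BE.
apply: quadric_span_sum => t0; apply: quadric_spanM; apply: quadric_span_gen.
  apply: (@poly_deg_sum _ _ _ _ _ 2) => t' _.
  rewrite -[2]/(1 + 1 : int); apply: poly_degM; last exact: poly_degX.
  by apply: emb_deg; exact: lin_syz_deg.
rewrite raddf_sum.
transitivity (rt_inr (th (\sum_t' syz pi t t0 t' *: dual_gen t'))).
  rewrite !raddf_sum; apply: eq_bigr => t' _ /=.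
  by rewrite rmorphM /= rt_pi_emb rt_piY rt_inrZ linearZ /= pi_lin_syz.
by rewrite syz_syzygy !raddf0.
Qed.

End Idealization.

Theorem theorem3p2 (k : fieldType) (k_char0 : [pchar k] =i pred0) :
  [/\ ~ koszul (algR k), artinian (algR k), superlevel (piR k),
      has_regularity (piR k) 2 & has_type (piR k) 4] /\
  forall W : gradedMod (algR k), is_canonical_module (piR k) W ->
    let Rt := idealization_alg (mshift W (- 3)) in
    [/\ ~ koszul Rt, is_graded_algebra Rt, artinian Rt
      & exists (n : nat) (pi : {lrmorphism {mpoly k[n]} -> Rt}),
          [/\ is_presentation pi, quadratic pi, gorenstein pi,
              has_regularity pi 3 & has_codim pi 8]].
Proof.
have surj a : exists p, piR k p = a.
  exists (repr (a : {ideal_quot @idealI k})%qT); rewrite /piR /= /quo_pi; exact: reprK.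
have gen (i : 'I_6) : piR k (gensI k)`_i = 0 by exact: quo_pi_gen.
have kerI p : piR k p = 0 -> exists c : 'I_6 -> {mpoly k[4]}, p = \sum_i c i * (gensI k)`_i.
  by move=> /quo_pi_eq0 /asboolP.
have ker p : piR k p = 0 -> nf p = 0 by move=> /quo_pi_eq0; exact: nf_ideal.
have deg d a : @adeg k (algR k) d a <-> exists2 p, poly_deg d p & a = piR k p by [].
split.
  split.
  - exact: (short_not_koszul k_char0 surj gen ker deg).
  - exact: (hbasis_artinian (alg_basis surj gen ker deg)).
  - exact: (short_superlevel k_char0 surj gen ker deg).
  - exact: (short_regularity surj gen ker deg).
  - exact: (short_type surj gen ker deg).
move=> W canW Rt.
have gW := proj1 canW.
have rle2 i : (hdeg (alg_basis surj gen ker deg) i <= 2)%N by exact: rdeg_le2.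
(* An arbitrary canonical module is replaced by the explicit dual; [th] preserves and reflects
   degrees, so the shift by [-3] carries over. *)
have [th [[ze thK zeK] thD]] := @canonical_unique k (algR k) _ _
  (alg_graded surj gen ker deg) 3 (piR k) (pi_presentation surj deg) 2 rle2 W canW.
pose M := mshift W (- 3).
have thM d f : @mdg k _ M d (th f) <-> mdg (- 3 + d) f by exact: thD.
have MZ d e (a : algR k) (w : M) : adeg d a -> mdg e w -> mdg (d + e) (a *: w).
  by move=> ad we; have := gmodZ gW ad we; rewrite addrCA.
split.
- exact: (rt_not_koszul (M := M) k_char0 thM).
- exact: (rt_graded (M := M) (th := th) thK zeK thM MZ).
- exact: (hbasis_artinian (rt_basis (M := M) (th := th) thK zeK thM)).
exists (4 + 4)%N, (rt_pi (th : {linear _ -> M})); split.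
- exact: (rt_presentation (M := M) (th := th) thK zeK thM MZ).
- exact: (rt_quadratic (M := M) (th := th) k_char0 kerI thK).
- exact: (rt_gorenstein (M := M) (th := th) thK zeK thM MZ).
- exact: (rt_regularity (M := M) (th := th) thK zeK thM MZ).
- exact: (rt_codim (M := M) (th := th) thK zeK thM).
Qed.
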